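(* Let $\mathcal{A}$ be a unital Banach algebra with a $C_w$-group $\Psi$ and let $r>0$. Then the Bessel potential space $\mathcal{P}_r(\mathcal{A})$ admits norm-controlled inversion in $\mathcal{A}$. For $0<r<1$ the norm control is given explicitly as follows: there is a constant $C_r>0$ (for the given $\mathcal{A}$ and $\Psi$, and independent of $a$) such that for every $a\in\mathcal{P}_r(\mathcal{A})$ that is invertible in $\mathcal{A}$, $$\|a^{-1}\|_{\mathcal{P}_r(\mathcal{A})}\le C_r\,\|a^{-1}\|_{\mathcal{A}}^3\,\|a\|_{\mathcal{P}_r(\mathcal{A})}^2 .$$
   Context: A (one-parameter) automorphism group on $\mathcal{A}$ is a family $\Psi=\{\psi_t\}_{t\in\mathbb{R}}$ of Banach algebra automorphisms of $\mathcal{A}$ with $\psi_s\psi_t=\psi_{s+t}$ for all $s,t$ and $M_\Psi=\sup_t\|\psi_t\|_{\mathcal{A}\to\mathcal{A}}<\infty$ (if $\mathcal{A}$ is a $*$-algebra, the $\psi_t$ are $*$-automorphisms). $C_w$-group: a weakly continuous automorphism group for which convolution with bounded measures is well defined. Concretely: there is a norm-closed subspace $F\subseteq\mathcal{A}^*$ that is norming ($\|a\|=\sup\{|\varphi(a)|:\varphi\in F,\|\varphi\|\le1\}$), such that the $\sigma(\mathcal{A},F)$-closed convex hull of each $\sigma(\mathcal{A},F)$-compact set is $\sigma(\mathcal{A},F)$-compact, each $\psi_t$ is $\sigma(\mathcal{A},F)$-continuous, and $t\mapsto\psi_t(a)$ is $\sigma(\mathcal{A},F)$-continuous for each $a\in\mathcal{A}$.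 This includes the case that $\lim_{t\to0}\|\psi_t(a)-a\|_{\mathcal{A}}=0$ for all $a\in\mathcal{A}$. For a bounded Borel measure $\mu$ on $\mathbb{R}$ and $a\in\mathcal{A}$ the convolution is $\mu*a=\int_{\mathbb{R}}\psi_{-t}(a)\,d\mu(t)\in\mathcal{A}$ (defined weakly with respect to $F$). An $L^1$ function is identified with the corresponding measure. The Bessel kernel $\mathcal{G}_r$, $r>0$, is the function on $\mathbb{R}$ with Fourier transform $(1+|2\pi\omega|^2)^{-r/2}$. The Bessel potential space is $\mathcal{P}_r(\mathcal{A})=\{\mathcal{G}_r*y:y\in\mathcal{A}\}$ with norm $\|\mathcal{G}_r*y\|_{\mathcal{P}_r(\mathcal{A})}=\|y\|_{\mathcal{A}}$. For Banach algebras $\mathcal{C}\subseteq\mathcal{B}$ with common unit, $\mathcal{C}$ admits norm-controlled inversion in $\mathcal{B}$ if there is a function $h:\mathbb{R}_+^2\to\mathbb{R}_+$ such that every $a\in\mathcal{C}$ invertible in $\mathcal{B}$ satisfies $a^{-1}\in\mathcal{C}$ and $\|a^{-1}\|_{\mathcal{C}}\le h(\|a\|_{\mathcal{C}},\|a^{-1}\|_{\mathcal{B}})$.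
   Formalization: The formal theorem additionally assumes that the Bessel potential space P_r(A) is closed under multiplication; with the stated definition of C_w-group this can fail, and then the inverse of an element of P_r(A) need not lie in P_r(A). *)

(* Defs.v *)
From HB Require Import structures.
From mathcomp Require Import all_boot all_order all_algebra.
From mathcomp Require Import all_classical all_reals all_analysis.
From mathcomp Require Import complex.

Set Implicit Arguments.
Unset Strict Implicit.
Unset Printing Implicit Defensive.

Import Order.TTheory GRing.Theory Num.Theory.
Import numFieldNormedType.Exports.

Local Open Scope classical_set_scope.
Local Open Scope ring_scope.
Local Open Scope complex_scope.

(* A join of GRing.NzRing with the normed modules cannot be declared: HB requires
   it to be an ancestor of numDomainType.  The product is therefore an operation
   on a complete normed module, and the ring structure that it induces is put on
   the alias [alg A] of A.  No normalization `|1| = 1 is required. *)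
HB.mixin Record CompleteNormedModule_isBanachAlgebra (K : numFieldType) A
    & CompleteNormedModule K A := {
  bone : A;
  bmul : A -> A -> A;
  bmulA : associative bmul;
  bmul1r : left_id bone bmul;
  bmulr1 : right_id bone bmul;
  bmulDl : left_distributive bmul +%R;
  bmulDr : right_distributive bmul +%R;
  bone_neq0 : bone != 0;
  bscaleAl : forall (k : K) (x y : A), k *: bmul x y = bmul (k *: x) y;
  bscaleAr : forall (k : K) (x y : A), k *: bmul x y = bmul x (k *: y);
  bnormM_le : forall x y : A, `|bmul x y| <= `|x| * `|y|
}.

#[short(type="banachAlgType")]
HB.structure Definition BanachAlgebra (K : numFieldType) :=
  {A of CompleteNormedModule K A & CompleteNormedModule_isBanachAlgebra K A}.

Definition alg (K : numFieldType) (A : banachAlgType K) : Type := A.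

Section alg_structure.
Context (K : numFieldType) (A : banachAlgType K).

HB.instance Definition _ := GRing.Lmodule.copy (alg A) A.
HB.instance Definition _ := GRing.Zmodule_isNzRing.Build (alg A)
  (@bmulA K A) (@bmul1r K A) (@bmulr1 K A) (@bmulDl K A) (@bmulDr K A)
  (@bone_neq0 K A).
HB.instance Definition _ := GRing.Lmodule_isLalgebra.Build K (alg A)
  (@bscaleAl K A).
HB.instance Definition _ := GRing.Lalgebra_isAlgebra.Build K (alg A)
  (@bscaleAr K A).

Definition is_inverse (x y : alg A) : Prop := y * x = 1 /\ x * y = 1.

Definition alg_unit : pred (alg A) := fun x => `[< exists y, is_inverse x y >].

Definition alg_inv (x : alg A) : alg A := xget x [set y | is_inverse x y].

Fact alg_mulVr : {in alg_unit, left_inverse 1 alg_inv *%R}.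
Proof.
by move=> x /asboolP[y xy]; rewrite /alg_inv; case: xgetP => [z _ []|/(_ y)].
Qed.

Fact alg_mulrV : {in alg_unit, right_inverse 1 alg_inv *%R}.
Proof.
by move=> x /asboolP[y xy]; rewrite /alg_inv; case: xgetP => [z _ []|/(_ y)].
Qed.

Fact alg_unitP (x y : alg A) : y * x = 1 /\ x * y = 1 -> alg_unit x.
Proof. by move=> xy; apply/asboolP; exists y. Qed.

Fact alg_inv_out : {in [predC alg_unit], alg_inv =1 id}.
Proof.
move=> x /asboolPn nx; rewrite /alg_inv; case: xgetP => // y _ xy.
by case: nx; exists y.
Qed.

HB.instance Definition _ := GRing.NzRing_hasMulInverse.Build (alg A)
  alg_mulVr alg_mulrV alg_unitP alg_inv_out.

End alg_structure.

(* The norm of a normed module over R[i] takes its values in R[i]. *)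
Definition nrm (R : realType) (V : normedModType R[i]) (x : V) : R :=
  complex.Re `|x|.

Section dual.
Context (R : realType) (V W : normedModType R[i]).

(* Valued in \bar R, so that it is +oo on unbounded maps, where the
   real-valued [sup] would return 0. *)
Definition opnorm (f : V -> W) : \bar R :=
  ereal_sup [set (nrm (f x))%:E | x in [set x : V | nrm x <= 1]].

End dual.

Section weak_topology.
Context (R : realType) (A : normedModType R[i]).

Definition dual : set (A -> R[i]^o) := [set phi : A -> R[i]^o | linear phi /\ continuous phi].

Definition sigma_top (F : set (A -> R[i]^o)) : topologicalType :=
  @initial_topology A {ptws set_type F -> R[i]^o}
    (fun a (phi : set_type F) => set_val phi a).

Definition norm_closed_subspace (F : set (A -> R[i]^o)) : Prop :=
  [/\ F `<=` dual,
      F (fun=> 0),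
      forall (c : R[i]) phi psi, F phi -> F psi ->
        F (fun a => c * phi a + psi a) &
      forall phi, dual phi ->
        (forall e : R, 0 < e ->
           exists2 psi, F psi & (opnorm (fun a => phi a - psi a)%R <= e%:E)%E) ->
        F phi].

Definition norming (F : set (A -> R[i]^o)) : Prop :=
  forall a : A, (nrm a)%:E =
    ereal_sup [set (nrm (phi a))%:E | phi in [set phi | F phi /\ (opnorm phi <= 1)%E]].

Definition closed_convex_hull (F : set (A -> R[i]^o)) (K : set A)
    : set A :=
  closure (smallest (@convex_set R[i] A) K : set (sigma_top F)).

Definition convex_compactness (F : set (A -> R[i]^o)) : Prop :=
  forall K : set A, compact (K : set (sigma_top F)) ->
    compact (closed_convex_hull F K : set (sigma_top F)).

End weak_topology.

Section groups.
Context (R : realType) (A : banachAlgType R[i]).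

Definition automorphism_group (psi : R -> {lrmorphism alg A -> alg A}) : Prop :=
  [/\ forall t, bijective (psi t),
      forall s t a, psi s (psi t a) = psi (s + t) a &
      (ereal_sup (range (fun t => opnorm (psi t))) < +oo)%E].

Definition Cw_group (F : set (A -> R[i]^o)) (psi : R -> {lrmorphism alg A -> alg A})
    : Prop :=
  automorphism_group psi /\
  [/\ norm_closed_subspace F,
      norming F,
      convex_compactness F,
      forall t, continuous (psi t : sigma_top F -> sigma_top F) &
      forall a, continuous (fun t : R => psi t a : sigma_top F)].

End groups.

Section kernels.
Context (R : realType).
Local Notation mu := (@lebesgue_measure R).

Definition cintegrable (f : R -> R[i]) : Prop :=
  mu.-integrable setT (fun t => (complex.Re (f t))%:E) /\
  mu.-integrable setT (fun t => (complex.Im (f t))%:E).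

Definition cintegral (f : R -> R[i]) : R[i] :=
  (\int[mu]_t complex.Re (f t)) +i* (\int[mu]_t complex.Im (f t)).

Definition expi (x : R) : R[i] := cos x +i* sin x.

Definition fourier (f : R -> R[i]) (w : R) : R[i] :=
  cintegral (fun t => f t * expi (- (2 * pi * w * t))).

(* G represents the Bessel kernel of order r; it is determined up to a null
   set, on which convolution with G does not depend. *)
Definition is_bessel_kernel (r : R) (G : R -> R[i]) : Prop :=
  cintegrable G /\
  forall w : R, fourier G w = ((1 + `|2 * pi * w| ^+ 2) `^ (- (r / 2)))%:C.

End kernels.

Section bessel_potential.
Context (R : realType) (A : banachAlgType R[i]).
Context (F : set (A -> R[i]^o)) (psi : R -> {lrmorphism alg A -> alg A}).

(* x = f * a, an integral in the weak sense with respect to F; there is at most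
   one such x when F is norming. *)
Definition is_conv (f : R -> R[i]) (a x : A) : Prop :=
  forall phi, F phi -> phi x = cintegral (fun t => phi (psi (- t) a) * f t).

Definition bessel_potential (G : R -> R[i]) : set A :=
  [set x | exists y, is_conv G y x].

(* The common value of the norms of all y with x = G * y (for the Bessel
   kernel, there is only one such y). *)
Definition bessel_norm (G : R -> R[i]) (x : A) : R :=
  xget 0 [set nrm y | y in [set y | is_conv G y x]].

End bessel_potential.

(* Meaningful for C a Banach algebra under normC with the unit of B; the
   definition does not assert that. *)
Definition norm_controlled_inversion (R : realType) (B : banachAlgType R[i])
    (C : set (alg B)) (normC : alg B -> R) : Prop :=
  exists h : R -> R -> R,
    (forall x y, 0 <= x -> 0 <= y -> 0 <= h x y) /\
    (forall a : alg B, C a -> a \is a GRing.unit ->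
       C a^-1 /\ normC a^-1 <= h (normC a) (nrm a^-1)).

(* Main.v *)
Require Import Defs.
From HB Require Import structures.
From mathcomp Require Import all_boot all_order all_algebra.
From mathcomp Require Import all_classical all_reals all_analysis.
From mathcomp Require Import complex.
From mathcomp Require Import measurable_realfun ring lra.

Set Implicit Arguments.
Unset Strict Implicit.
Unset Printing Implicit Defensive.

Import Order.TTheory GRing.Theory Num.Theory.
Import numFieldNormedType.Exports.

Local Open Scope classical_set_scope.
Local Open Scope ring_scope.

(** Let [D] be the generator of the group and [mu = 1 - D ^ 2], so that the potential
    space is the range of [mu ^ (- r / 2)] and the Bessel norm of [x] is the norm of
    [mu ^ (r / 2) x]. Write [r / 2 = s m] with [s < 1/2]. The power [mu ^ s] is
    approximated by the bounded operators
    [frac N = (N mu / (N + mu)) ^ s = N ^ s (1 - kappa_N)], in which [kappa_N] is an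
    average over the group against an even positive measure, [kapF s N]. On a Bessel
    potential of [y], the product of [m] of these operators is [y] averaged at small
    scales; hence the Bessel norm is the supremum [sn m] of the norms of the vectors
    [frac N1 (.. (frac Nm x))] ([fin_pot], [pot_norm]).

    Because [kappa_N] is an average over algebra automorphisms, [frac N] obeys the
    Leibniz rule up to the average of the products of increments
    [(psi_h x - x) (psi_h y - y)] against [N ^ s kappa_N] ([leib_defect_fun]). Vectors
    of order one are Hoelder continuous with an exponent [b > s] ([bnd_hoelder]), while
    [N ^ s kappa_N] has bounded moments of order [2 b] because [2 b] can be chosen at
    most one ([kapF_tmod]); so the defect is of lower order. Induction on the order gives
    [sn m (x y) <= sn m x |y| + (e sn m x + C_e |x|) sn m y] with [e] as small as desired
    ([leibnizP]).

    Let [x] be the inverse of [a]. Its increments are bounded by those of [a]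
    ([pn_increment_inverse]), so smoothing [x] at a scale that depends only on the norms
    yields a potential [b] with [c = 1 - a b] small in the norm of the algebra. Then [x]
    is the sum of the [b c ^ k], and the Leibniz inequality, in which the smallness of
    [|c|] governs the main term and that of [e] the remaining one, shows that the series
    converges geometrically in the Bessel norm as well ([inverse_pot]). For [r < 1] one
    may take [m = 1], and the Leibniz rule for [x a = 1] gives [frac N x] explicitly in
    terms of [frac N a] and increments of [a]; this is the cubic bound ([bnd_inverse]).

    All measures are represented by functionals on bounded continuous functions that are
    continuous under bounded convergence ([bplin], [pfun]). Identities between them are
    identities between their Fourier transforms ([bplin_unique]), and the ones in use are
    mixtures of Laplace laws under Beta laws. They act on scalar orbits, and on
    norm-continuous vectors through Riemann sums ([act_ex]). Elements of the algebra are
    compared through the orbits [t |-> Re phi (psi_t x)] with [phi] in the unit ball of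
    [F], for which the given kernel reduces to such a functional ([is_convE]). *)

(** * Functionals on bounded continuous functions *)

Section bounded_continuous.
Context {R : realType}.
Implicit Types (f g : R -> R) (L : (R -> R) -> R).

Lemma seq_continuous_at (f : R -> R) (x : R) :
  (forall u : nat -> R, u @ \oo --> x -> f (u n) @[n --> \oo] --> f x) ->
  {for x, continuous f}.
Proof. by move=> H; apply/(@cvg_nbhsP R R^o f x (f x)) => u /H. Qed.

Definition bcont f := continuous f /\ exists K, forall x, `|f x| <= K.

Lemma bcont_cst a : bcont (fun=> a).
Proof. by split; [move=> x; exact: cvg_cst|exists `|a|]. Qed.

Lemma bcontD f g : bcont f -> bcont g -> bcont (fun x => f x + g x).
Proof.
move=> [cf [K fK]] [cg [K' gK]]; split; first by move=> x; apply: cvgD; [exact: cf|exact: cg].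
by exists (K + K') => x; rewrite (le_trans (ler_normD _ _))// lerD.
Qed.

Lemma bcontM f g : bcont f -> bcont g -> bcont (fun x => f x * g x).
Proof.
move=> [cf [K fK]] [cg [K' gK]]; split; first by move=> x; apply: cvgM; [exact: cf|exact: cg].
by exists (K * K') => x; rewrite normrM ler_pM.
Qed.

Lemma bcontZ a f : bcont f -> bcont (fun x => a * f x).
Proof. by move=> fb; apply: bcontM => //; exact: bcont_cst. Qed.

Lemma bcontN f : bcont f -> bcont (fun x => - f x).
Proof.
move=> /(bcontZ (-1)); congr bcont; apply/funext => x; by rewrite mulN1r.
Qed.

Lemma bcontB f g : bcont f -> bcont g -> bcont (fun x => f x - g x).
Proof. by move=> fb gb; apply: bcontD => //; exact: bcontN. Qed.

Lemma bcont_comp f (g : R -> R) : bcont f -> continuous g -> bcont (fun x => f (g x)).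
Proof.
move=> [cf [K fK]] cg; split; last by exists K => x.
by move=> x; apply: continuous_comp; [exact: cg|exact: cf].
Qed.

Lemma continuous_addl (a : R) : continuous (fun x : R => a + x).
Proof. by move=> x; apply: cvgD; [exact: cvg_cst|exact: cvg_id]. Qed.

Lemma continuous_mull (a : R) : continuous (fun x : R => a * x).
Proof. by move=> x; apply: cvgM; [exact: cvg_cst|exact: cvg_id]. Qed.

Lemma bcont_shift f a : bcont f -> bcont (fun x => f (a + x)).
Proof. by move=> fb; apply: bcont_comp => //; exact: continuous_addl. Qed.

Lemma bcont_scale f a : bcont f -> bcont (fun x => f (a * x)).
Proof. by move=> fb; apply: bcont_comp => //; exact: continuous_mull. Qed.

Lemma bcont_opp f : bcont f -> bcont (fun x => f (- x)).
Proof. by move=> fb; apply: bcont_comp => //; exact: opp_continuous. Qed.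

Lemma bcont_cos w : bcont (fun x => cos (w * x)).
Proof.
apply: (@bcont_scale cos w); split; first exact: continuous_cos.
by exists 1 => x; rewrite ler_norml cos_le1 cos_geN1.
Qed.

Lemma bcont_sin w : bcont (fun x => sin (w * x)).
Proof.
apply: (@bcont_scale sin w); split; first exact: continuous_sin.
by exists 1 => x; rewrite ler_norml sin_le1 sin_geN1.
Qed.

(** Functionals that behave like integration against a finite signed measure:
    bounded pointwise convergence takes the place of dominated convergence. *)
Record bplin L : Prop := BpLin {
  bplinD : forall f g, bcont f -> bcont g -> L (fun x => f x + g x) = L f + L g;
  bplinZ : forall a f, bcont f -> L (fun x => a * f x) = a * L f;
  bplin_cvg : forall (u : nat -> R -> R) f K, (forall n, bcont (u n)) -> bcont f ->
    (forall n x, `|u n x| <= K) -> (forall x, u n x @[n --> \oo] --> f x) ->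
    L (u n) @[n --> \oo] --> L f }.

(** Integration against an even positive measure of mass at most one. Evenness makes
    its Fourier transform real, so that the functional is determined by cosines. *)
Record pfun L : Prop := PFun {
  pfun_bp :> bplin L;
  pfun_ge0 : forall f, bcont f -> (forall x, 0 <= f x) -> 0 <= L f;
  pfun_even : forall f, bcont f -> L (fun x => f (- x)) = L f;
  pfun_mass : L (fun=> 1) <= 1 }.

Lemma bplinN L f : bplin L -> bcont f -> L (fun x => - f x) = - L f.
Proof.
move=> bL fb; rewrite -mulN1r -(bplinZ bL)//; congr L; apply/funext => x.
by rewrite mulN1r.
Qed.

Lemma bplinB L f g : bplin L -> bcont f -> bcont g ->
  L (fun x => f x - g x) = L f - L g.
Proof. by move=> bL fb gb; rewrite (bplinD bL)// ?(bplinN bL)//; exact: bcontN. Qed.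

Lemma bplin_cst L a : bplin L -> L (fun=> a) = a * L (fun=> 1).
Proof.
move=> bL; rewrite -(bplinZ bL); last exact: bcont_cst.
by congr L; apply/funext => x; rewrite mulr1.
Qed.

Lemma pfun_le L f g : pfun L -> bcont f -> bcont g -> (forall x, f x <= g x) ->
  L f <= L g.
Proof.
move=> pL fb gb fg; rewrite -subr_ge0 -bplinB//; last exact: pfun_bp.
by apply: pfun_ge0 => //; [exact: bcontB|move=> x; rewrite subr_ge0].
Qed.

Lemma pfun_mass_ge0 L : pfun L -> 0 <= L (fun=> 1).
Proof. by move=> pL; apply: pfun_ge0 => //; exact: bcont_cst. Qed.

Lemma pfun_norm_le L f g : pfun L -> bcont f -> bcont g ->
  (forall x, `|f x| <= g x) -> `|L f| <= L g.
Proof.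
move=> pL fb gb fg; rewrite ler_norml; apply/andP; split.
  rewrite -bplinN//; last exact: pfun_bp.
  by apply: pfun_le => //; [exact: bcontN|move=> x; have := fg x; rewrite ler_norml => /andP[]].
by apply: pfun_le => // x; have := fg x; rewrite ler_norml => /andP[].
Qed.

Lemma pfun_bound L f K : pfun L -> bcont f -> (forall x, `|f x| <= K) ->
  `|L f| <= K.
Proof.
move=> pL fb fK; have K0 : 0 <= K by apply: le_trans (fK 0).
apply: le_trans (pfun_norm_le pL fb (bcont_cst K) fK) _.
rewrite bplin_cst; last exact: pfun_bp.
by rewrite ler_piMr// pfun_mass.
Qed.

Lemma bplin_comb L1 L2 a b : bplin L1 -> bplin L2 ->
  bplin (fun f => a * L1 f + b * L2 f).
Proof.
move=> b1 b2; split.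
- by move=> f g fb gb; rewrite (bplinD b1)// (bplinD b2)//; ring.
- by move=> c f fb; rewrite (bplinZ b1)// (bplinZ b2)//; ring.
- move=> u f K ub fb uK uf; apply: cvgD; apply: cvgM; try exact: cvg_cst.
    exact: bplin_cvg uK uf.
  exact: bplin_cvg uK uf.
Qed.

Definition dirac0 f := f 0.

Lemma pfun_dirac0 : pfun dirac0.
Proof.
split; rewrite /dirac0.
- by split => // u f K _ _ _; exact.
- by [].
- by move=> f _; rewrite oppr0.
- by [].
Qed.

(** Translation-invariant operator with convolution kernel [L]. *)
Definition conv L f x := L (fun h => f (x + h)).

Lemma conv_bound L f K : pfun L -> bcont f -> (forall x, `|f x| <= K) ->
  forall x, `|conv L f x| <= K.
Proof. by move=> pL fb fK x; apply: pfun_bound => //; exact: bcont_shift. Qed.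

Lemma bcont_conv L f : pfun L -> bcont f -> bcont (conv L f).
Proof.
move=> pL [cf [K fK]]; have fb : bcont f by split => //; exists K.
split; last by exists K; exact: conv_bound.
move=> x; apply: seq_continuous_at => u ux.
apply: (bplin_cvg (pfun_bp pL) (K := K)) => //.
- by move=> n; exact: bcont_shift.
- exact: bcont_shift.
- by move=> h; apply: (cvg_comp _ _ (_ : u n + h @[n --> \oo] --> x + h));
    [apply: cvgD => //; exact: cvg_cst|exact: cf].
Qed.

Lemma conv_cvg L (u : nat -> R -> R) f K : pfun L -> (forall n, bcont (u n)) -> bcont f ->
    (forall n x, `|u n x| <= K) -> (forall x, u n x @[n --> \oo] --> f x) ->
  forall x, conv L (u n) x @[n --> \oo] --> conv L f x.
Proof.
move=> pL ub fb uK uf x; apply: (bplin_cvg (pfun_bp pL) (K := K)) => //.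
- by move=> n; exact: bcont_shift.
- exact: bcont_shift.
Qed.

Lemma convD L f g : bplin L -> bcont f -> bcont g ->
  conv L (fun x => f x + g x) = fun x => conv L f x + conv L g x.
Proof. by move=> pL fb gb; apply/funext => x; rewrite /conv bplinD//; exact: bcont_shift. Qed.

Lemma convZ L a f : bplin L -> bcont f ->
  conv L (fun x => a * f x) = fun x => a * conv L f x.
Proof. by move=> pL fb; apply/funext => x; rewrite /conv bplinZ//; exact: bcont_shift. Qed.

Lemma convB L f g : bplin L -> bcont f -> bcont g ->
  conv L (fun x => f x - g x) = fun x => conv L f x - conv L g x.
Proof. by move=> pL fb gb; apply/funext => x; rewrite /conv bplinB//; exact: bcont_shift. Qed.

Lemma conv_shift L f a : conv L (fun x => f (a + x)) = fun x => conv L f (a + x).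
Proof. by apply/funext => x; rewrite /conv; congr L; apply/funext => h; rewrite addrA. Qed.

(** Convolution of two functionals. *)
Definition comp L1 L2 f := L1 (conv L2 f).

Lemma conv_comp L1 L2 f : conv (comp L1 L2) f = conv L1 (conv L2 f).
Proof.
by apply/funext => x; rewrite /comp /conv; congr L1; apply/funext => h; congr L2;
  apply/funext => h'; rewrite addrA.
Qed.

Lemma bplin_comp L1 L2 : bplin L1 -> pfun L2 -> bplin (comp L1 L2).
Proof.
move=> b1 p2; have b2 := pfun_bp p2; split.
- by move=> f g fb gb; rewrite /comp convD// bplinD//; exact: bcont_conv.
- by move=> a f fb; rewrite /comp convZ// bplinZ//; exact: bcont_conv.
- move=> u f K ub fb uK uf; apply: (bplin_cvg b1 (K := K)).
  + by move=> n; exact: bcont_conv.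
  + exact: bcont_conv.
  + by move=> n; exact: conv_bound.
  + exact: conv_cvg uK uf.
Qed.

Lemma pfun_comp L1 L2 : pfun L1 -> pfun L2 -> pfun (comp L1 L2).
Proof.
move=> p1 p2; split; first by apply: bplin_comp => //; exact: pfun_bp.
- move=> f fb f0; rewrite /comp; apply: (pfun_ge0 p1); first exact: bcont_conv.
  by move=> x; apply: (pfun_ge0 p2); [exact: bcont_shift|move=> y; exact: f0].
- move=> f fb; rewrite /comp -[RHS](pfun_even p1); last exact: bcont_conv.
  congr L1; apply/funext => x; rewrite /conv.
  rewrite -[RHS](pfun_even p2); last exact: bcont_shift.
  by congr L2; apply/funext => h; rewrite opprD.
- rewrite /comp; apply: le_trans (ler_norm _) _; apply: pfun_bound => //.
    by apply: bcont_conv => //; exact: bcont_cst.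
  by apply: conv_bound => //; [exact: bcont_cst|move=> _; rewrite normr1].
Qed.

(** Fourier transform of an even functional. *)
Definition symb L (w : R) := L (fun x => cos (w * x)).

Lemma pfun_sin L w : pfun L -> L (fun x => sin (w * x)) = 0.
Proof.
move=> pL; have := pfun_even pL (bcont_sin w).
have -> : (fun x : R => sin (w * - x)) = fun x => - sin (w * x).
  by apply/funext => x; rewrite mulrN sinN.
rewrite bplinN; [lra|exact: pfun_bp|exact: bcont_sin].
Qed.

Lemma conv_cos L w : pfun L ->
  conv L (fun x => cos (w * x)) = fun x => symb L w * cos (w * x).
Proof.
move=> pL; apply/funext => x; rewrite /conv.
have -> : (fun h : R => cos (w * (x + h))) =
    fun h => cos (w * x) * cos (w * h) - sin (w * x) * sin (w * h).
  by apply/funext => h; rewrite mulrDr cosD.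
rewrite bplinB; [|exact: pfun_bp|apply: bcontZ; exact: bcont_cos|apply: bcontZ; exact: bcont_sin].
rewrite !bplinZ; [|exact: pfun_bp|exact: bcont_sin|exact: pfun_bp|exact: bcont_cos].
by rewrite pfun_sin// mulr0 subr0 mulrC.
Qed.

Lemma symb_comp L1 L2 w : pfun L1 -> pfun L2 ->
  symb (comp L1 L2) w = symb L1 w * symb L2 w.
Proof.
move=> p1 p2; rewrite /symb /comp (conv_cos w p2).
by rewrite (bplinZ (pfun_bp p1) _ (bcont_cos w)) mulrC.
Qed.

Lemma symb_dirac0 w : symb dirac0 w = 1.
Proof. by rewrite /symb /dirac0 mulr0 cos0. Qed.

Lemma conv_dirac0 f : conv dirac0 f = f.
Proof. by apply/funext => x; rewrite /conv /dirac0 addr0. Qed.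

End bounded_continuous.

(** * Mixtures of functionals *)

Section mixture.
Context {R : realType}.
Local Notation mu := (@lebesgue_measure R).
Implicit Types (f g w : R -> R).
Local Notation integrable f := (mu.-integrable setT (EFin \o f)).

Lemma integrable_le f g : measurable_fun setT f -> (forall x, `|f x| <= g x) ->
  integrable g -> integrable f.
Proof.
move=> mf fg; apply: le_integrable => //.
  exact/measurable_EFinP.
by move=> x _ /=; rewrite lee_fin (le_trans (fg x))// ler_norm.
Qed.

Lemma integrable_continuous_le f g : continuous f -> (forall x, `|f x| <= g x) ->
  integrable g -> integrable f.
Proof. by move=> cf; apply: integrable_le; exact: continuous_measurable_fun. Qed.

Lemma integrable_mul_bounded w f K : integrable w -> measurable_fun setT f ->
  (forall x, `|f x| <= K) -> integrable (fun x => w x * f x).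
Proof.
move=> wi mf fK; have mw : measurable_fun setT w.
  by apply/measurable_EFinP; exact: measurable_int wi.
apply: (@integrable_le _ (fun x => `|w x| * K)).
- exact: measurable_funM.
- by move=> x; rewrite normrM ler_wpM2l.
- exact: (integrableZr measurableT K (integrable_norm wi)).
Qed.

Lemma Rintegral_dominated_cvg (u : nat -> R -> R) f g :
  (forall n, measurable_fun setT (u n)) -> integrable g ->
  (forall n x, `|u n x| <= g x) -> (forall x, u n x @[n --> \oo] --> f x) ->
  \int[mu]_x u n x @[n --> \oo] --> \int[mu]_x f x.
Proof.
move=> mu_ gi ug uf.
have ui n : integrable (u n) by apply: (integrable_le (mu_ n) (ug n)).
have mf : measurable_fun setT f by apply: measurable_fun_cvg => // x _; exact: uf.
have fg x : `|f x| <= g x.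
  apply: (@cvgr_to_le _ \oo _ _ (fun n => `|u n x|)); first by apply: cvg_norm; exact: uf.
  by apply: nearW => n; exact: ug.
have fi : integrable f by apply: (integrable_le mf fg).
apply: fine_cvg; rewrite fineK; last exact: integrable_fin_num.
apply: (@dominated_cvg _ _ _ mu setT measurableT (fun n x => (u n x)%:E) (EFin \o f) (EFin \o g)) => //.
- by move=> n; apply/measurable_EFinP; exact: mu_.
- by move=> x _; apply: cvg_EFin; [exact: nearW|exact: uf].
- by move=> n x _ /=; rewrite lee_fin; exact: ug.
Qed.

(** Superpositions of functionals with an integrable weight: every functional
    used in the proof is one, starting from symmetric pairs of point masses. *)
Lemma pfun_mixture w (L : R -> (R -> R) -> R) :
  (forall t, 0 <= w t) -> integrable w -> \int[mu]_t w t <= 1 ->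
  (forall t, pfun (L t)) -> (forall f, bcont f -> measurable_fun setT (L^~ f)) ->
  pfun (fun f => \int[mu]_t (w t * L t f)).
Proof.
move=> w0 wi w1 pL mL.
have intL f : bcont f -> integrable (fun t => w t * L t f).
  move=> fb; have [_ [K fK]] := fb.
  by apply: (@integrable_mul_bounded _ _ K) => //; [exact: mL|move=> t; exact: pfun_bound].
have mw : measurable_fun setT w by apply/measurable_EFinP; exact: measurable_int wi.
split; first split.
- move=> f g fb gb; rewrite -RintegralD//; [|exact: intL|exact: intL].
  by apply: eq_Rintegral => t _; rewrite (bplinD (pfun_bp (pL t)))// mulrDr.
- move=> a f fb; rewrite -RintegralZl//; last exact: intL.
  by apply: eq_Rintegral => t _; rewrite (bplinZ (pfun_bp (pL t)))// mulrCA.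
- move=> u f K ub fb uK uf.
  apply: (@Rintegral_dominated_cvg (fun n t => w t * L t (u n)) _ (fun t => w t * K)).
  + by move=> n; apply: measurable_funM => //; exact: mL.
  + exact: (integrableZr measurableT K wi).
  + by move=> n t; rewrite normrM ger0_norm// ler_wpM2l// pfun_bound.
  + move=> t; apply: cvgM; first exact: cvg_cst.
    exact: (bplin_cvg (pfun_bp (pL t)) ub fb uK uf).
- move=> f fb f0; apply: Rintegral_ge0 => t _; rewrite mulr_ge0//.
  exact: pfun_ge0.
- by move=> f fb; apply: eq_Rintegral => t _; rewrite pfun_even.
- apply: le_trans w1; apply: le_Rintegral => //; first by apply: intL; exact: bcont_cst.
  by move=> t _; rewrite ler_piMr// pfun_mass.
Qed.

End mixture.

(** * Uniqueness of Fourier transforms *)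

Section uniqueness.
Context {R : realType}.
Implicit Types (f g : R -> R) (L : (R -> R) -> R).

(** Expectation of [f k] when [k] counts the successes of [n] independent trials
    of success probability [u]; the recursion conditions on the first trial. *)
Fixpoint bern (n : nat) (f : nat -> R) (u : R) : R :=
  if n is n'.+1 then u * bern n' (f \o succn) u + (1 - u) * bern n' f u else f 0%N.

Lemma bernD n (f g : nat -> R) u : bern n (fun k => f k + g k) u = bern n f u + bern n g u.
Proof.
elim: n f g => //= n IH f g.
by rewrite (IH (f \o succn) (g \o succn)) IH; ring.
Qed.

Lemma bernZ n a (f : nat -> R) u : bern n (fun k => a * f k) u = a * bern n f u.
Proof. by elim: n f => //= n IH f; rewrite (IH (f \o succn)) IH; ring. Qed.

Lemma bern_cst n a u : bern n (fun=> a) u = a.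
Proof. by elim: n => //= n IH; rewrite (_ : _ \o succn = fun=> a)// !IH; ring. Qed.

Lemma bern_le n (f g : nat -> R) u : 0 <= u <= 1 -> (forall k, f k <= g k) ->
  bern n f u <= bern n g u.
Proof.
move=> /andP[u0 u1]; elim: n f g => //= n IH f g fg.
by apply: lerD; apply: ler_wpM2l; rewrite ?subr_ge0// IH// => k; exact: fg.
Qed.

Lemma bern_norm_le n (f g : nat -> R) u : 0 <= u <= 1 -> (forall k, `|f k| <= g k) ->
  `|bern n f u| <= bern n g u.
Proof.
move=> u01 fg; rewrite ler_norml; apply/andP; split.
  have -> : - bern n g u = bern n (fun k => -1 * g k) u by rewrite bernZ mulN1r.
  by apply: bern_le => // k; have := fg k; rewrite ler_norml mulN1r => /andP[].
by apply: bern_le => // k; have := fg k; rewrite ler_norml => /andP[].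
Qed.

Lemma bern_sq n a b u : bern n (fun k => (a * k%:R + b) ^+ 2) u =
  (a * n%:R * u + b) ^+ 2 + a ^+ 2 * n%:R * u * (1 - u).
Proof.
elim: n b => [b /=|n IH b /=]; first ring.
rewrite IH (_ : _ \o succn = fun k => (a * k%:R + (a + b)) ^+ 2); last first.
  by apply/funext => k /=; rewrite -natr1; ring.
by rewrite IH -natr1; ring.
Qed.

Lemma sin_div_cvg (x : R) :
  n.+1%:R * sin (x / n.+1%:R) @[n --> \oo] --> x.
Proof.
have [->|x0] := eqVneq x 0.
  have -> : (fun n : nat => n.+1%:R * sin (0 / n.+1%:R)) = (fun=> 0 : R).
    by apply/funext => n; rewrite mul0r sin0 mulr0.
  exact: cvg_cst.
have : (h : R)^-1 * sin h @[h --> 0^'] --> (1 : R).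
  have := @is_derive_sin R 0; rewrite cos0 => -[+ <-].
  rewrite /derivable /derive; set F := (X in cvg (X @ _) -> _).
  move=> /cvg_ex[l Fl]; rewrite (cvg_lim _ Fl)//.
  apply: cvg_trans Fl; apply: near_eq_cvg; near=> h.
  by rewrite /F /= sin0 subr0 addr0 /GRing.scale /= mulr1.
move=> /cvgr_dnbhsP/(_ (fun n => x / n.+1%:R)) H.
have {}H : (x / n.+1%:R)^-1 * sin (x / n.+1%:R) @[n --> \oo] --> (1:R).
  apply: H; split.
    by move=> n; rewrite mulf_neq0// invr_eq0 pnatr_eq0.
  rewrite -[X in _ --> X](mulr0 x); apply: cvgM; first exact: cvg_cst.
  exact: cvg_harmonic.
rewrite -[X in _ --> X](mulr1 x).
have -> : (fun n => n.+1%:R * sin (x / n.+1%:R)) =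
    (fun n => x * ((x / n.+1%:R)^-1 * sin (x / n.+1%:R))).
  apply/funext => n; have : n.+1%:R != 0 :> R by rewrite pnatr_eq0.
  by move: (n.+1%:R) (sin _) => m s m0; field; rewrite x0 m0.
by apply: cvgM => //; exact: cvg_cst.
Unshelve. all: by end_near. Qed.

Section trigonometric_polynomials.
Variables (L : (R -> R) -> R).
Hypotheses (bL : bplin L) (Lcos : forall w, L (fun x => cos (w * x)) = 0)
  (Lsin : forall w, L (fun x => sin (w * x)) = 0).

(** Not only [L f] but also all frequency shifts of [f] have to be killed for the
    condition to be stable under multiplication by a sine. *)
Let killed f := [/\ bcont f, (forall w, L (fun x => f x * cos (w * x)) = 0)
  & (forall w, L (fun x => f x * sin (w * x)) = 0)].

Let killed_cst a : killed (fun=> a).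
Proof.
split; first exact: bcont_cst.
- by move=> w; rewrite bplinZ//; [rewrite Lcos mulr0|exact: bcont_cos].
- by move=> w; rewrite bplinZ//; [rewrite Lsin mulr0|exact: bcont_sin].
Qed.

Let killed_comb a b f g : killed f -> killed g -> killed (fun x => a * f x + b * g x).
Proof.
move=> [bf fc fs] [bg gc gs]; split.
- by apply: bcontD; exact: bcontZ.
- move=> w; rewrite (_ : (fun x => _) = fun x => a * (f x * cos (w * x)) + b * (g x * cos (w * x))).
    rewrite bplinD//; [|by apply: bcontZ; apply: bcontM => //; exact: bcont_cos..].
    by rewrite !bplinZ//; [rewrite fc gc !mulr0 addr0|apply: bcontM => //; exact: bcont_cos..].
  by apply/funext => x; ring.
- move=> w; rewrite (_ : (fun x => _) = fun x => a * (f x * sin (w * x)) + b * (g x * sin (w * x))).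
    rewrite bplinD//; [|by apply: bcontZ; apply: bcontM => //; exact: bcont_sin..].
    by rewrite !bplinZ//; [rewrite fs gs !mulr0 addr0|apply: bcontM => //; exact: bcont_sin..].
  by apply/funext => x; ring.
Qed.

Let killed_sin a f : killed f -> killed (fun x => f x * sin (a * x)).
Proof.
move=> [bf fc fs].
have bfc w : bcont (fun x => f x * cos (w * x)) by apply: bcontM => //; exact: bcont_cos.
have bfs w : bcont (fun x => f x * sin (w * x)) by apply: bcontM => //; exact: bcont_sin.
split; first exact: bfs.
- move=> w; rewrite (_ : (fun x => _) =
    fun x => 2^-1 * (f x * sin ((w + a) * x)) + (- 2^-1) * (f x * sin ((w - a) * x))).
    by rewrite bplinD//; [rewrite !bplinZ// !fs !mulr0 addr0|exact: bcontZ..].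
  by apply/funext => x; rewrite !mulrDl !mulNr !sinD sinN cosN; field.
- move=> w; rewrite (_ : (fun x => _) =
    fun x => 2^-1 * (f x * cos ((w - a) * x)) + (- 2^-1) * (f x * cos ((w + a) * x))).
    by rewrite bplinD//; [rewrite !bplinZ// !fc !mulr0 addr0|exact: bcontZ..].
  by apply/funext => x; rewrite !mulrDl !mulNr !cosD sinN cosN; field.
Qed.

Let unit_sin a x : R := (1 + sin (a * x)) / 2.

Let unit_sin01 a x : 0 <= unit_sin a x <= 1.
Proof.
have := sin_le1 (a * x); have := sin_geN1 (a * x); rewrite /unit_sin => h1 h2.
by apply/andP; split; lra.
Qed.

Let killed_bern a n (c : nat -> R) : killed (fun x => bern n c (unit_sin a x)).
Proof.
elim: n c => [|n IH] c /=; first exact: killed_cst.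
have mulu f : killed f -> killed (fun x => 2^-1 * f x + 2^-1 * (f x * sin (a * x))).
  by move=> kf; apply: killed_comb => //; exact: killed_sin.
have mulv f : killed f -> killed (fun x => 2^-1 * f x + (- 2^-1) * (f x * sin (a * x))).
  by move=> kf; apply: killed_comb => //; exact: killed_sin.
have := killed_comb 1 1 (mulu _ (IH (c \o succn))) (mulv _ (IH c)).
congr killed; apply/funext => x; rewrite /unit_sin; set b := bern _ _ _; set b' := bern _ _ _.
by field.
Qed.

(** Sampling [f] at [N * s], where [s] in [-1, 1] is [2k/n - 1] for a binomial [k]
    of mean [n (1 + sin (x / N)) / 2], gives a trigonometric polynomial in [x].
    The sample point has mean [N * sin (x / N)], close to [x], and variance at
    most [N ^ 2 / n], so the polynomials tend to [f] if [n] is [N ^ 3]. *)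
Let approx f N x : R := let M := N.+1 in
  bern (M ^ 3) (fun k => f (M%:R * (2 * k%:R / (M ^ 3)%:R - 1))) (unit_sin M%:R^-1 x).

Let approx_cvg f x : bcont f -> approx f N x @[N --> \oo] --> f x.
Proof.
move=> [cf [K fK]]; apply/cvgrPdist_le => e e0.
have K0 : 0 <= K by apply: le_trans (fK 0).
have /cvgrPdist_le/(_ _ (divr_gt0 e0 (ltr0n _ 2)))[d /= d0 dP] := cf x.
pose c := 2 * K / d ^+ 2.
have c0 : 0 <= c by apply: divr_ge0; [apply: mulr_ge0|exact: sqr_ge0].
have fle y : `|f y - f x| <= e / 2 + c * (y - x) ^+ 2.
  have [yx|yx] := ltP `|x - y| d.
    by rewrite distrC; apply: le_trans (dP _ yx) _; rewrite lerDl mulr_ge0// sqr_ge0.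
  apply: (@le_trans _ _ (K + K)); first by rewrite (le_trans (ler_normB _ _))// lerD.
  rewrite -[X in X <= _]add0r; apply: lerD; first by rewrite divr_ge0// ltW.
  rewrite (_ : K + K = 2 * K * 1); last by ring.
  rewrite (_ : c * _ = 2 * K * ((d ^+ 2)^-1 * (y - x) ^+ 2)); last by rewrite /c; ring.
  rewrite ler_wpM2l ?mulr_ge0// ler_pdivlMl ?exprn_gt0// mulr1 -[X in _ <= X]real_normK ?num_real//.
  by rewrite distrC lerXn2r// nnegrE ltW.
have bound N : `|approx f N x - f x| <=
    e / 2 + c * ((N.+1%:R * sin (x / N.+1%:R) - x) ^+ 2 + (N.+1%:R)^-1).
  rewrite /approx; set M := N.+1; set n := (M ^ 3)%N; set u := unit_sin _ x.
  have M0 : 0 < M%:R :> R by rewrite ltr0n.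
  have Mn : n%:R = M%:R ^+ 3 :> R by rewrite natrX.
  have -> : forall b, b - f x = b + bern n (fun=> - f x) u by move=> b; rewrite bern_cst.
  rewrite -bernD.
  pose g (k : nat) := e / 2 + c * (2 * M%:R / n%:R * k%:R + (- M%:R - x)) ^+ 2.
  apply: (@le_trans _ _ (bern n g u)).
  - apply: bern_norm_le; first exact: unit_sin01.
    move=> k; apply: le_trans (fle _) _; rewrite lerD2l ler_wpM2l//.
    by rewrite le_eqVlt; apply/orP; left; apply/eqP; congr (_ ^+ 2); ring.
  - rewrite /g bernD bern_cst bernZ bern_sq lerD2l ler_wpM2l// Mn.
    apply: lerD.
      rewrite le_eqVlt; apply/orP; left; apply/eqP; congr (_ ^+ 2).
      by rewrite /u /unit_sin [x / _]mulrC; field; rewrite lt0r_neq0.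
    have -> : (2 * M%:R / M%:R ^+ 3) ^+ 2 * M%:R ^+ 3 * u * (1 - u) = M%:R^-1 * (4 * (u * (1 - u))).
      by field; rewrite lt0r_neq0.
    apply: ler_piMr; first by rewrite invr_ge0 ltW.
    rewrite -subr_ge0 (_ : _ - _ = (2 * u - 1) ^+ 2) ?sqr_ge0//.
    by ring.
have lim0 : c * ((n.+1%:R * sin (x / n.+1%:R) - x) ^+ 2 + (n.+1%:R)^-1) @[n --> \oo] --> (0 : R).
  rewrite -(mulr0 c); apply: cvgM; first exact: cvg_cst.
  rewrite -(addr0 0); apply: cvgD; last exact: cvg_harmonic.
  have H : n.+1%:R * sin (x / n.+1%:R) - x @[n --> \oo] --> (0 : R).
    by rewrite -(subrr x); apply: cvgB; [exact: sin_div_cvg|exact: cvg_cst].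
  have H2 := cvgM H H _; rewrite mulr0 in H2.
  apply: cvg_trans (H2 _); apply: near_eq_cvg.
  by apply: nearW => n; rewrite expr2.
have /cvgrPdist_le/(_ _ (divr_gt0 e0 (ltr0n _ 2))) := lim0.
apply: filterS => n; rewrite sub0r normrN => ne.
rewrite distrC (le_trans (bound n))// [leRHS](splitr e) lerD2l.
exact: le_trans (ler_norm _) ne.
Qed.

(** The polynomials [approx f N] are bounded by the bound of [f] and tend to [f]
    pointwise, so that bounded convergence applies. *)
Lemma bplin_eq0 f : bcont f -> L f = 0.
Proof.
move=> fb; have [cf [K fK]] := fb.
have : L (approx f N) @[N --> \oo] --> L f.
  apply: (bplin_cvg bL (K := K)) => //.
  - by move=> n; case: (killed_bern (n.+1%:R^-1) (n.+1 ^ 3)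
      (fun k => f (n.+1%:R * (2 * k%:R / (n.+1 ^ 3)%:R - 1)))).
  - move=> n x; rewrite /approx -[K](bern_cst (n.+1 ^ 3) K (unit_sin n.+1%:R^-1 x)).
    by apply: bern_norm_le => //; exact: unit_sin01.
  - by move=> x; exact: approx_cvg.
have -> : (fun N => L (approx f N)) = fun=> 0.
  apply/funext => n; case: (killed_bern (n.+1%:R^-1) (n.+1 ^ 3)
      (fun k => f (n.+1%:R * (2 * k%:R / (n.+1 ^ 3)%:R - 1)))) => _ /(_ 0) + _.
  move=> <-; congr L; apply/funext => x; by rewrite mul0r cos0 mulr1.
by move=> /cvg_lim <- //; rewrite lim_cst.
Qed.

End trigonometric_polynomials.

(** Uniqueness theorem for Fourier transforms: a bounded continuous function is a
    bounded pointwise limit of trigonometric polynomials. *)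
Lemma bplin_unique L1 L2 : bplin L1 -> bplin L2 ->
  (forall w, L1 (fun x => cos (w * x)) = L2 (fun x => cos (w * x))) ->
  (forall w, L1 (fun x => sin (w * x)) = L2 (fun x => sin (w * x))) ->
  forall f, bcont f -> L1 f = L2 f.
Proof.
move=> b1 b2 hc hs f fb; apply/eqP; rewrite -subr_eq0; apply/eqP.
have := @bplin_eq0 (fun f => 1 * L1 f + (-1) * L2 f) (bplin_comb 1 (-1) b1 b2) _ _ f fb.
rewrite mul1r mulN1r; apply => w; [rewrite hc|rewrite hs]; ring.
Qed.

End uniqueness.

(** * The Laplace law *)

Section elementary_functionals.
Context {R : realType}.
Local Notation mu := (@lebesgue_measure R).
Implicit Types (f g : R -> R) (L : (R -> R) -> R).
Local Notation integrable f := (mu.-integrable setT (EFin \o f)).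

Lemma cvg_expRN a : 0 < a -> expR (- (a * x)) @[x --> +oo] --> (0 : R).
Proof.
move=> a0; apply/cvgrPdist_le => e e0; near=> x.
rewrite sub0r normrN ger0_norm ?expR_ge0// expRN invf_ple ?posrE ?expR_gt0//.
rewrite (le_trans _ (expR_ge1Dx _))// ler_wpDl// mulrC -(ler_pdivrMr _ _ a0).
near: x; apply: nbhs_pinfty_ge; exact: num_real.
Unshelve. all: by end_near. Qed.

(** An even nonnegative function is integrated through an antiderivative on the
    half-line. *)
Lemma even_integral f (F : R -> R) l : (forall x, 0 <= f x) -> continuous f ->
  (forall x, f (- x) = f x) -> (forall x : R, is_derive x 1 F (if 0 < x then f x else 'D_1 F x)) ->
  F x @[x --> +oo] --> l -> integrable f /\ \int[mu]_x f x = 2 * (l - F 0).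
Proof.
move=> f0 cf ef dF Fl.
have E : (\int[mu]_x (f x)%:E = (2 * (l - F 0))%:E)%E.
  rewrite ge0_symfun_integralT//; last by move=> x /=; rewrite ef.
  rewrite (_ : [set x | _] = `[0, +oo[%classic); last first.
    by apply/seteqP; split => x /=; rewrite in_itv/= andbT.
  rewrite (@ge0_continuous_FTC2y _ f F 0 l)//.
  - exact: continuous_subspaceT.
  - apply: cvg_at_right_filter; apply: differentiable_continuous.
    by apply/derivable1_diffP; case: (dF 0).
  - move=> x; rewrite in_itv/= andbT => x0; rewrite derive1E.
    by case: (dF x); rewrite x0.
split; last by rewrite /Rintegral E.
apply/integrableP; split; first by apply/measurable_EFinP; exact: continuous_measurable_fun.
have -> : (\int[mu]_x `|(EFin \o f) x| = \int[mu]_x (f x)%:E)%E.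
  by apply: eq_integral => x _ /=; rewrite ger0_norm.
by rewrite E ltry.
Qed.

Lemma continuous_expRNnorm a : continuous (fun u : R => expR (- (a * `|u|))).
Proof.
move=> x; apply: continuous_comp; last exact: continuous_expR.
by apply: cvgN; apply: cvgM; [exact: cvg_cst|exact: norm_continuous].
Qed.

Lemma expRNnorm_integral a : 0 < a ->
  integrable (fun u => expR (- (a * `|u|))) /\ \int[mu]_u expR (- (a * `|u|)) = 2 / a.
Proof.
move=> a0; rewrite (_ : 2 / a = 2 * (0 - (- a^-1 * expR (- (a * 0))))); last first.
  by rewrite mulr0 oppr0 expR0; ring.
apply: (@even_integral _ (fun u => - a^-1 * expR (- (a * u)))).
- by move=> x; exact: expR_ge0.
- exact: continuous_expRNnorm.
- by move=> x; rewrite normrN.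
- move=> x; case: ifPn => x0; last by apply: derivableP.
  apply: is_derive_eq; rewrite ger0_norm ?ltW//= /GRing.scale/=.
  by field; rewrite gt_eqF.
- rewrite -[X in _ --> X](mulr0 (- a^-1)); apply: cvgM; first exact: cvg_cst.
  exact: cvg_expRN.
Qed.

(** The Laplace density. *)
Definition lap (u : R) : R := expR (- `|u|) / 2.

Lemma lap_ge0 u : 0 <= lap u. Proof. by rewrite divr_ge0// expR_ge0. Qed.

Lemma continuous_lap : continuous lap.
Proof.
rewrite (_ : lap = fun u => expR (- (1 * `|u|)) * 2^-1); last first.
  by apply/funext => u; rewrite mul1r.
by move=> x; apply: cvgM; [exact: continuous_expRNnorm|exact: cvg_cst].
Qed.

Lemma lap_integral : integrable lap /\ \int[mu]_u lap u = 1.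
Proof.
have -> : lap = fun u => 2^-1 * expR (- (1 * `|u|)).
  by apply/funext => u; rewrite mul1r mulrC.
have [i1 i2] := expRNnorm_integral (@ltr01 R); split.
  exact: (integrableZl measurableT _ i1).
by rewrite RintegralZl// i2 divr1 mulVf.
Qed.

Lemma lap_mul_integrable f : bcont f -> integrable (fun u => lap u * f u).
Proof.
move=> [cf [K fK]]; apply: (integrable_mul_bounded (K := K)) => //.
  by case: lap_integral.
exact: continuous_measurable_fun.
Qed.

Lemma lap_cos_integral w : \int[mu]_u (lap u * cos (w * u)) = (1 + w ^+ 2)^-1.
Proof.
have w0 : 1 + w ^+ 2 != 0 by rewrite gt_eqF// ltr_pwDl// sqr_ge0.
pose F u := - (2^-1) * expR (- (1 * u)) -
  2^-1 * expR (- (1 * u)) * (w * sin (w * u) - cos (w * u)) / (1 + w ^+ 2).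
have [] := @even_integral (fun u => lap u * (1 - cos (w * u))) F 0.
- by move=> x; rewrite mulr_ge0 ?lap_ge0// subr_ge0 cos_le1.
- move=> x; apply: cvgM; first exact: continuous_lap.
  by apply: cvgB; [exact: cvg_cst|apply: (proj1 (bcont_cos w))].
- by move=> x; rewrite /lap normrN mulrN cosN.
- move=> x; case: ifPn => x0.
    apply: is_derive_eq; rewrite /lap ger0_norm ?ltW// /GRing.scale/= !mul1r.
    by field.
  by apply: derivableP; apply: ex_derive.
- rewrite -[X in _ --> X](subr0 0); apply: cvgB.
    rewrite -[X in _ --> X](mulr0 (- 2^-1)); apply: cvgM; first exact: cvg_cst.
    exact: cvg_expRN.
  apply/cvgrPdist_le => e e0.
  pose C := (`|w| + 1) / (1 + w ^+ 2).
  have C0 : 0 < C + 1.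
    by rewrite ltr_wpDl// divr_ge0 ?addr_ge0// sqr_ge0.
  have /cvgrPdist_le/(_ _ (divr_gt0 e0 C0)) := cvg_expRN (@ltr01 R).
  apply: filterS => x; rewrite !sub0r !normrN ger0_norm ?expR_ge0// ler_pdivlMr// => H.
  apply: le_trans H; rewrite -!mulrA normrM [leRHS]mulrC ger0_norm// normrM (ger0_norm (expR_ge0 _)).
  rewrite mulrCA [leRHS]mulrC ler_wpM2l ?expR_ge0//.
  rewrite normrM normfV (gtr0_norm (_ : 0 < 1 + w ^+ 2)); last by rewrite ltr_pwDl// sqr_ge0.
  apply: (@le_trans _ _ C); last by rewrite lerDl.
  apply: (@le_trans _ _ (`|w * sin (w * x) - cos (w * x)| / (1 + w ^+ 2))).
    by rewrite ler_piMl// ?invf_le1// ?ler1n// divr_ge0 ?addr_ge0// sqr_ge0.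
  rewrite ler_wpM2r// ?invr_ge0 ?addr_ge0 ?sqr_ge0//.
  rewrite (le_trans (ler_normB _ _))// lerD//.
    by rewrite normrM ler_piMr// ler_norml sin_le1 sin_geN1.
  by rewrite ler_norml cos_le1 cos_geN1.
move=> i1; rewrite /F !mulr0 !oppr0 expR0 sin0 cos0 => E.
have [li l1] := lap_integral; have lc := lap_mul_integrable (bcont_cos w).
have : \int[mu]_u (lap u * (1 - cos (w * u))) = 1 - \int[mu]_u (lap u * cos (w * u)).
  by rewrite -[X in _ = X - _]l1 -RintegralB//; apply: eq_Rintegral => u _; rewrite mulrBr mulr1.
rewrite E => /eqP; rewrite eq_sym subr_eq => /eqP E2.
apply: (@addrI _ (2 * (0 - (- 2^-1 * 1 - 2^-1 * 1 * (w * 0 - 1) / (1 + w ^+ 2))))).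
by rewrite -E2; field.
Qed.

Definition dpair (u : R) f := (f u + f (- u)) / 2.

Lemma pfun_dpair u : pfun (dpair u).
Proof.
split; first split.
- by move=> f g _ _; rewrite /dpair; ring.
- by move=> a f _; rewrite /dpair; ring.
- move=> v f K _ _ _ vf; rewrite /dpair; apply: cvgM; last exact: cvg_cst.
  by apply: cvgD; exact: vf.
- by move=> f _ f0; rewrite divr_ge0// addr_ge0.
- by move=> f _; rewrite /dpair opprK addrC.
- by rewrite /dpair; lra.
Qed.

End elementary_functionals.

(** Integration against the Laplace law; symmetric pairs make evenness evident. *)
HB.lock Definition lapF {R : realType} (f : R -> R) : R :=
  \int[@lebesgue_measure R]_u (lap u * dpair u f).

Section laplace_functional.
Context {R : realType}.
Local Notation mu := (@lebesgue_measure R).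
Implicit Types (f g : R -> R) (L : (R -> R) -> R).
Local Notation integrable f := (mu.-integrable setT (EFin \o f)).

Lemma lapFE f : lapF f = \int[mu]_u (lap u * dpair u f).
Proof. by rewrite lapF.unlock. Qed.

Lemma pfun_lapF : pfun (@lapF R).
Proof.
have [li l1] := @lap_integral R.
rewrite (_ : @lapF R = fun f => \int[mu]_u (lap u * dpair u f)); last first.
  by apply/funext => f; exact: lapFE.
apply: (@pfun_mixture R lap dpair) => //; [exact: lap_ge0|by rewrite l1|exact: pfun_dpair|].
move=> f [cf _]; apply: continuous_measurable_fun => u.
apply: cvgM; last exact: cvg_cst.
by apply: cvgD; [exact: cf|apply: continuous_comp; [exact: opp_continuous|exact: cf]].
Qed.

Lemma symb_lapF (w : R) : symb lapF w = (1 + w ^+ 2)^-1.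
Proof.
rewrite -lap_cos_integral /symb lapFE; apply: eq_Rintegral => u _; rewrite /dpair mulrN cosN; congr (_ * _).
lra.
Qed.

Definition dil (th : R) L f := L (fun x => f (th * x)).

Lemma pfun_dil th L : pfun L -> pfun (dil th L).
Proof.
move=> pL; have bL := pfun_bp pL; split; first split; rewrite /dil.
- by move=> f g fb gb; rewrite (bplinD bL)//; exact: bcont_scale.
- by move=> a f fb; rewrite (bplinZ bL)//; exact: bcont_scale.
- move=> u f K ub fb uK uf; apply: (bplin_cvg bL (K := K)) => //.
    by move=> n; exact: bcont_scale.
  exact: bcont_scale.
- by move=> f fb f0; apply: (pfun_ge0 pL) => //; exact: bcont_scale.
- move=> f fb; rewrite -[RHS](pfun_even pL); last exact: bcont_scale.
  by congr L; apply/funext => x; rewrite mulrN.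
- exact: pfun_mass.
Qed.

Lemma symb_dil th L w : symb (dil th L) w = symb L (w * th).
Proof. by rewrite /symb /dil; congr L; apply/funext => x; rewrite mulrA. Qed.

Lemma dil_cvg L f (u : nat -> R) th : pfun L -> bcont f -> u @ \oo --> th ->
  dil (u n) L f @[n --> \oo] --> dil th L f.
Proof.
move=> pL fb uth; have [cf [K fK]] := fb.
apply: (bplin_cvg (pfun_bp pL) (K := K)) => //.
- by move=> n; exact: bcont_scale.
- exact: bcont_scale.
- move=> x; apply: (cvg_comp _ _ (_ : u n * x @[n --> \oo] --> th * x)); last exact: cf.
  by apply: cvgM => //; exact: cvg_cst.
Qed.

Lemma continuous_dil L f : pfun L -> bcont f -> continuous (fun th => dil th L f).
Proof. by move=> pL fb th; apply: seq_continuous_at => u; exact: dil_cvg. Qed.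

(** Translation invariance, by way of the substitution rule for nonnegative
    functions. *)
Lemma Rintegral_shift f a : continuous f -> integrable f ->
  integrable (fun x => f (x + a)) /\ \int[mu]_x f (x + a) = \int[mu]_x f x.
Proof.
have ge0 g : continuous g -> (forall x, 0 <= g x) ->
    (\int[mu]_x (g (x + a))%:E = \int[mu]_x (g x)%:E)%E.
  move=> cg g0; have dF (x : R) : is_derive x 1 (fun x : R => x + a) 1.
    by apply: is_derive_eq; rewrite addr0.
  have F' : derive1 (fun x : R => x + a) = cst 1.
    by apply/funext => x; rewrite derive1E derive_val.
  rewrite [RHS](@increasing_ge0_integration_by_substitutionT _ (fun x => x + a) g)//.
  - by apply: eq_integral => x _ /=; rewrite F' /= mulr1.
  - by move=> x y xy; rewrite ltrD2r.
  - by rewrite F'; move=> x; exact: cvg_cst.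
  - by rewrite F'; exact: is_cvg_cst.
  - by rewrite F'; exact: is_cvg_cst.
  - apply/cvgrNyPle => A; near=> x; rewrite -lerBrDr.
    near: x; apply: nbhs_ninfty_le; exact: num_real.
  - apply/cvgryPge => A; near=> x; rewrite -lerBlDr.
    near: x; apply: nbhs_pinfty_ge; exact: num_real.
move=> cf fi.
have cfa : continuous (fun x => f (x + a)).
  move=> x; apply: continuous_comp; last exact: cf.
  by apply: cvgD; [exact: cvg_id|exact: cvg_cst].
have cnf : continuous (fun x => `|f x|).
  by move=> x; apply: continuous_comp; [exact: cf|exact: norm_continuous].
have ni : integrable (fun x => `|f (x + a)|).
  apply/integrableP; split.
    apply/measurable_EFinP; apply: continuous_measurable_fun => x.
    by apply: continuous_comp; [exact: cfa|exact: norm_continuous].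
  have -> : (\int[mu]_x `|(EFin \o (fun x => `|f (x + a)|)%R) x| = \int[mu]_x (`|f (x + a)|)%:E)%E.
    by apply: eq_integral => x _ /=; rewrite normr_id.
  by rewrite (ge0 (fun x => `|f x|))//; move/integrableP : fi => [].
have fai : integrable (fun x => f (x + a)).
  by apply: integrable_continuous_le ni => // x.
split => //.
have E g : integrable g ->
    \int[mu]_x g x = \int[mu]_x (g x + `|g x|) - \int[mu]_x `|g x|.
  by move=> ig; rewrite RintegralD ?addrK//; exact: integrable_norm.
rewrite (E _ fai) (E _ fi).
congr (_ - _); rewrite /Rintegral; congr fine.
  apply: (ge0 (fun x => f x + `|f x|)).
    by move=> x; apply: cvgD; [exact: cf|exact: cnf].
  by move=> x; rewrite -lerBlDr sub0r lerNl -normrN ler_norm.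
exact: (ge0 (fun x => `|f x|)).
Unshelve. all: by end_near. Qed.

End laplace_functional.

Section laplace_estimates.
Context {R : realType}.
Local Notation mu := (@lebesgue_measure R).
Implicit Types (f g : R -> R) (L : (R -> R) -> R).
Local Notation integrable f := (mu.-integrable setT (EFin \o f)).

Lemma integrable_add f g : integrable f -> integrable g -> integrable (fun x => f x + g x).
Proof. by move=> fi gi; exact: (integrableD measurableT fi gi). Qed.

Lemma integrable_sub f g : integrable f -> integrable g -> integrable (fun x => f x - g x).
Proof. by move=> fi gi; exact: (integrableB measurableT fi gi). Qed.

(** The logarithm of the Laplace density is Lipschitz with constant one. *)
Lemma lap_shift_le (u a : R) : `|lap (u - a) - lap u| <= lap u * (expR `|a| - 1).
Proof.
have e0 : 0 < expR `|a| by exact: expR_gt0.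
rewrite ler_norml; apply/andP; split.
- rewrite lerNl opprB lerBlDr -lerBlDl.
  have H : lap u * expR (- `|a|) <= lap (u - a).
    rewrite /lap mulrAC ler_pM2r ?invr_gt0// -expRD ler_expR -opprD lerN2.
    exact: ler_normB.
  apply: le_trans H; rewrite -[X in X - _]mulr1 -mulrBr ler_wpM2l ?lap_ge0//.
  rewrite expRN; have : (expR `|a|)^-1 * (expR `|a| - 1) ^+ 2 >= 0.
    by rewrite mulr_ge0 ?sqr_ge0// invr_ge0 ltW.
  rewrite (_ : _ * _ = (expR `|a|)^-1 + expR `|a| - 2); first by lra.
  by field; rewrite gt_eqF.
- rewrite mulrBr mulr1 lerD2r /lap [leRHS]mulrAC ler_pM2r ?invr_gt0//.
  rewrite -expRD ler_expR lerNl opprD opprK.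
  by have := ler_normD (u - a) a; rewrite subrK; lra.
Qed.

Lemma expR_sub1_le (x : R) : 0 <= x <= 2^-1 -> expR x - 1 <= 2 * x.
Proof.
move=> /andP[x0 x2]; have := expR_ge1Dx (- x); rewrite expRN => H.
have x1 : 0 < 1 - x by lra.
have : expR x <= (1 - x)^-1.
  by rewrite -[expR x]invrK lef_pV2 ?posrE// ?invr_gt0 ?expR_gt0.
move=> /le_trans; apply: (_ : _ -> _) => /(_ (1 + 2 * x)) h; rewrite lerBlDl h//.
rewrite -div1r ler_pdivrMr//.
suff : 0 <= x * (1 - 2 * x) by lra.
by apply: mulr_ge0 => //; lra.
Qed.

(** A translation of the function is a translation of the density. For [`|a|] above
    one half the bound is trivial. *)
Lemma lapF_lipschitz g K a : bcont g -> (forall x, `|g x| <= K) ->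
  `|lapF (fun x => g (x + a)) - lapF g| <= 4 * `|a| * K.
Proof.
have half f (b : R) : bcont f -> (forall x, `|f x| <= K) -> `|b| <= 2^-1 ->
    `|\int[mu]_u (lap u * f (u + b)) - \int[mu]_u (lap u * f u)| <= 2 * `|b| * K.
  move=> fb fK b2; have [cf _] := fb.
  have K0 : 0 <= K by apply: le_trans (fK 0).
  have [li l1] := @lap_integral R.
  have cs : continuous (fun u : R => u - b).
    by move=> x; apply: cvgB; [exact: cvg_id|exact: cvg_cst].
  have clb : continuous (fun u => lap (u - b) * f u).
    move=> u; apply: cvgM; last exact: cf.
    by apply: (continuous_comp (f := fun u : R => u - b)); [exact: cs|exact: continuous_lap].
  have ie : integrable (fun u => lap u * (expR `|b| - 1)) by exact: (integrableZr measurableT _ li).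
  have E1 : 0 <= expR `|b| - 1 by have := expR_ge1Dx `|b|; have := normr_ge0 b; lra.
  have ilb : integrable (fun u => lap (u - b) * f u).
    apply: (@integrable_continuous_le _ _ (fun u => lap u * (expR `|b| * K))) => //.
      move=> u; rewrite normrM ger0_norm ?lap_ge0// mulrA ler_pM ?lap_ge0//.
      have := lap_shift_le u b; rewrite ler_norml => /andP[_]; rewrite mulrBr mulr1; lra.
    exact: (integrableZr measurableT _ li).
  have [_] := Rintegral_shift b clb ilb; under eq_Rintegral do rewrite addrK.
  move=> ->; have il := lap_mul_integrable fb.
  rewrite -RintegralB//.
  apply: le_trans (le_normr_Rintegral measurableT _) _.
    exact: integrable_sub.
  apply: (@le_trans _ _ (\int[mu]_u (lap u * (expR `|b| - 1) * K))).
    apply: le_Rintegral => //.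
    - apply: integrable_norm; exact: integrable_sub.
    - exact: (integrableZr measurableT _ ie).
    - by move=> u _; rewrite -mulrBl normrM ler_pM// lap_shift_le.
  rewrite RintegralZr// RintegralZr// l1 mul1r ler_wpM2r// expR_sub1_le//.
  by rewrite normr_ge0.
move=> gb gK; have K0 : 0 <= K by apply: le_trans (gK 0).
have [a2|a2] := leP `|a| 2^-1; last first.
  have gab : bcont (fun x => g (x + a)).
    apply: (bcont_comp gb) => x; apply: cvgD; [exact: cvg_id|exact: cvg_cst].
  rewrite (le_trans (ler_normB _ _))//.
  have := pfun_bound pfun_lapF gb gK; have := pfun_bound pfun_lapF gab (fun x => gK (x + a)).
  have : (`|a| - 2^-1) * K >= 0 by rewrite mulr_ge0// subr_ge0 ltW.
  lra.
have split f : bcont f -> lapF f = 2^-1 * (\int[mu]_u (lap u * f u) + \int[mu]_u (lap u * f (- u))).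
  move=> fb; have if1 := lap_mul_integrable fb; have if2 := lap_mul_integrable (bcont_opp fb).
  rewrite lapFE -RintegralD// -RintegralZl//; last exact: integrable_add.
  by apply: eq_Rintegral => u _; rewrite /dpair; ring.
have gab : bcont (fun x => g (x + a)).
  apply: (bcont_comp gb) => x; apply: cvgD; [exact: cvg_id|exact: cvg_cst].
rewrite split// split// -mulrBr normrM ger0_norm ?invr_ge0//.
have := half g a gb gK a2.
have := half (fun u => g (- u)) (- a) (bcont_opp gb) (fun x => gK (- x)).
rewrite normrN => /(_ a2); under [X in `|X - _|]eq_Rintegral do rewrite opprD opprK.
set i1 := \int[mu]_u _; set i2 := \int[mu]_u _; set i3 := \int[mu]_u _; set i4 := \int[mu]_u _.
rewrite (_ : i3 + i1 - (i4 + i2) = (i3 - i4) + (i1 - i2)); last by ring.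
move=> h1 h2; have := ler_normD (i3 - i4) (i1 - i2).
have : 0 <= `|a| * K by exact: mulr_ge0.
lra.
Qed.

Lemma continuous_powR_norm p : 0 < p -> continuous (fun x : R => `|x| `^ p).
Proof.
move=> p0 x; have [->|x0] := eqVneq x 0.
  apply/cvgrPdist_le => e e0; apply/nbhs_ballP.
  exists (e `^ p^-1); first exact: powR_gt0.
  move=> y; rewrite /ball/= sub0r normrN => /ltW ye.
  rewrite normr0 powR0 ?gt_eqF// sub0r normrN ger0_norm ?powR_ge0//.
  have -> : e = (e `^ p^-1) `^ p by rewrite -powRrM mulVf ?gt_eqF// powRr1// ltW.
  by apply: ge0_ler_powR => //; [exact: ltW|rewrite nnegrE powR_ge0].
have nx : 0 < `|x| by rewrite normr_gt0.
have E : \forall y \near x, expR (p * ln `|y|) = `|y| `^ p.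
  near=> y; rewrite /powR ifN// normr_eq0.
  near: y; apply: (cvgr_neq0 x) => //; exact: cvg_id.
apply: cvg_trans (near_eq_cvg E) _.
rewrite /continuous_at /powR ifN ?gt_eqF//.
apply: (@cvg_comp _ _ _ (fun y : R => p * ln `|y|) expR _ (nbhs (p * ln `|x|))).
  apply: cvgM; first exact: cvg_cst.
  by apply: (continuous_cvg _ (continuous_ln nx)); apply: cvg_norm; exact: cvg_id.
exact: continuous_expR.
Unshelve. all: by end_near. Qed.

(** Truncation makes the modulus an admissible argument of the functionals; the
    estimates are uniform in its level. *)
Definition tmod (p n x : R) := Num.min (`|x| `^ p) n.

Lemma bcont_tmod p n : 0 < p -> 0 <= n -> bcont (tmod p n).
Proof.
move=> p0 n0; split.
  move=> x; apply: (@continuous_min _ _ (fun x : R => `|x| `^ p) (fun=> n) x).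
    exact: continuous_powR_norm.
  exact: cvg_cst.
exists n => x; rewrite ger0_norm ?le_min ?powR_ge0// /tmod.
by rewrite ge_min lexx orbT.
Qed.

(** [`|u| ^ p] is at most [1 + `|u|], which half of the exponential decay of the
    density absorbs. *)
Lemma lap_tmod p n th : 0 < p <= 1 -> 0 <= n -> 0 <= th ->
  dil th lapF (tmod p n) <= 4 * th `^ p.
Proof.
move=> /andP[p0 p1] n0 th0; have tb := bcont_tmod p0 n0.
have [hi h1] := @expRNnorm_integral R 2^-1 (ltac:(lra)).
have -> : 4 * th `^ p = \int[mu]_u (th `^ p * expR (- (2^-1 * `|u|))).
  by rewrite RintegralZl// h1 invrK; ring.
rewrite /dil lapFE; apply: le_Rintegral => //.
- have bd u : bcont (fun x => tmod p n (th * x)) by exact: bcont_scale.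
  apply: lap_mul_integrable; rewrite /dpair; have := bcontZ 2^-1 (bcontD (bcont_scale th tb) (bcont_opp (bcont_scale th tb))).
  by congr bcont; apply/funext => u; ring.
- exact: (integrableZl measurableT _ hi).
move=> u _; apply: (@le_trans _ _ (lap u * (th `^ p * (1 + `|u|)))).
  rewrite ler_wpM2l ?lap_ge0//.
  have H v : tmod p n (th * v) <= th `^ p * (1 + `|v|).
    rewrite /tmod (@le_trans _ _ (`|th * v| `^ p))//; first by rewrite ge_min lexx.
    rewrite normrM ger0_norm// powRM// ler_wpM2l ?powR_ge0//.
    have [v1|v1] := leP 1 `|v|; first by rewrite (le_trans (ler1_powR v1 p1))// lerDr.
    have : `|v| `^ p <= 1 `^ p by apply: ge0_ler_powR; rewrite ?nnegrE//; exact: ltW.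
    by rewrite powR1 => /le_trans; apply; rewrite lerDl.
  by have := H u; have := H (- u); rewrite /dpair/= !mulrN normrN; lra.
rewrite mulrCA ler_wpM2l ?powR_ge0// /lap.
have -> : - `|u| = - (2^-1 * `|u|) - 2^-1 * `|u| by lra.
rewrite expRD; set e1 := expR _.
rewrite [leLHS](_ : _ = e1 * (e1 * ((1 + `|u|) / 2))); last by ring.
apply: ler_piMr; first exact: expR_ge0.
rewrite /e1 expRN ler_pdivrMl ?expR_gt0// mulr1.
by have := expR_ge1Dx (2^-1 * `|u|); have := normr_ge0 u; lra.
Qed.

End laplace_estimates.

(** * Fractional powers as Beta mixtures *)

Section beta_mixtures.
Context {R : realType}.
Local Notation mu := (@lebesgue_measure R).
Implicit Types (f g : R -> R) (L : (R -> R) -> R).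
Local Notation integrable f := (mu.-integrable setT (EFin \o f)).

Lemma one_powR (b : R) : 1 `^ b = 1. Proof. by rewrite powR1. Qed.

Lemma expR_add1_gt0 (t : R) : 0 < 1 + expR t.
Proof. by rewrite addr_gt0// expR_gt0. Qed.

Lemma continuous_expRM (a : R) : continuous (fun t => expR (a * t)).
Proof. by move=> t; apply: continuous_comp; [exact: continuous_mull|exact: continuous_expR]. Qed.

Lemma continuous_expR_add1 : continuous (fun t : R => 1 + expR t).
Proof. by move=> t; apply: cvgD; [exact: cvg_cst|exact: continuous_expR]. Qed.

Lemma continuous_powR_pos (g : R -> R) b : continuous g -> (forall t, 0 < g t) ->
  continuous (fun t => g t `^ b).
Proof.
move=> cg g0; have -> : (fun t => g t `^ b) = fun t => expR (b * ln (g t)).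
  by apply/funext => t; rewrite /powR gt_eqF.
move=> t; apply: (continuous_cvg _ (@continuous_expR R _)).
apply: cvgM; first exact: cvg_cst.
by apply: (continuous_cvg _ (continuous_ln (g0 t))); exact: cg.
Qed.

Lemma continuous_expR_add1_powR b : continuous (fun t : R => (1 + expR t) `^ b).
Proof. by apply: continuous_powR_pos => [|t]; [exact: continuous_expR_add1|exact: expR_add1_gt0]. Qed.

Lemma logistic_integrable a b : 0 < a < b ->
  integrable (fun t => expR (a * t) * (1 + expR t) `^ (- b)).
Proof.
move=> /andP[a0 ab]; pose c := Num.min a (b - a).
have c0 : 0 < c by rewrite lt_min a0 subr_gt0.
have [ci _] := expRNnorm_integral c0.
apply: integrable_continuous_le ci.
  by move=> t; apply: cvgM; [exact: continuous_expRM|exact: continuous_expR_add1_powR].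
move=> t; rewrite ger0_norm ?mulr_ge0 ?expR_ge0 ?powR_ge0//.
have ca : c <= a by rewrite ge_min lexx.
have cb : c <= b - a by rewrite ge_min lexx orbT.
have b0 : 0 <= b by lra.
have [t0|t0] := leP 0 t.
  apply: (@le_trans _ _ (expR (a * t) * expR (t * - b))).
    rewrite ler_wpM2l ?expR_ge0// expRM !powRN lef_pV2 ?posrE ?powR_gt0 ?expR_gt0 ?expR_add1_gt0//.
    by apply: ge0_ler_powR => //; rewrite ?nnegrE ?expR_ge0 ?(ltW (expR_add1_gt0 _))// lerDr.
  rewrite -expRD ler_expR ger0_norm//; have := mulr_ge0 t0 (_ : 0 <= b - a - c); rewrite subr_ge0 => /(_ cb).
  lra.
apply: (@le_trans _ _ (expR (a * t))).
  rewrite ler_piMr ?expR_ge0// powRN invf_le1 ?powR_gt0 ?expR_add1_gt0//.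
  rewrite -[X in X <= _](one_powR b); apply: ge0_ler_powR => //; rewrite ?nnegrE ?(ltW (expR_add1_gt0 _))//.
  by rewrite lerDl expR_ge0.
rewrite ler_expR ltr0_norm//; have := mulr_ge0 (ltW (_ : 0 < - t)) (_ : 0 <= a - c).
rewrite oppr_gt0 subr_ge0 => /(_ t0 ca); lra.
Qed.

(** Under [v = e^t / (1 + e^t)] this is, up to normalization, the density of the
    Beta law with parameters [s] and [1 - s]. *)
Definition bdens (s t : R) : R := expR (s * t) / (1 + expR t).

Definition logis (t : R) : R := expR t / (1 + expR t).

Lemma logis_bounds t : 0 < logis t < 1.
Proof.
have := expR_add1_gt0 t; have := expR_gt0 t => h1 h2.
by rewrite /logis divr_gt0//= ltr_pdivrMr// mul1r ltrDr.
Qed.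

Lemma mul_logis_ge0 x t : 0 <= x -> 0 <= x * logis t.
Proof. by move=> x0; apply: mulr_ge0 => //; apply: ltW; case/andP: (logis_bounds t). Qed.

Lemma add1_mul_logis_ge1 x t : 0 <= x -> 1 <= 1 + x * logis t.
Proof. by move=> x0; rewrite lerDl; exact: mul_logis_ge0. Qed.

Lemma add1_mul_logis_gt0 x t : 0 <= x -> 0 < 1 + x * logis t.
Proof. by move=> /(add1_mul_logis_ge1 t); exact: lt_le_trans ltr01. Qed.

Lemma continuous_logis : continuous logis.
Proof.
move=> t; apply: cvgM; first exact: continuous_expR.
by apply: cvgV; [rewrite gt_eqF// expR_add1_gt0|exact: continuous_expR_add1].
Qed.

Variable s : R.
Hypothesis s01 : 0 < s < 1.

Lemma continuous_bdens : continuous (bdens s).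
Proof.
move=> t; apply: cvgM; first exact: continuous_expRM.
by apply: cvgV; [rewrite gt_eqF// expR_add1_gt0|exact: continuous_expR_add1].
Qed.

Lemma bdens_integrable : integrable (bdens s).
Proof.
have := logistic_integrable s01; congr (mu.-integrable _ (_ \o _)).
by apply/funext => t; rewrite /bdens powR_inv1// ltW// expR_add1_gt0.
Qed.

Lemma bdens_ge0 t : 0 <= bdens s t.
Proof. by rewrite divr_ge0 ?expR_ge0// ltW// expR_add1_gt0. Qed.

Definition bB : R := \int[mu]_t bdens s t.

(** The Laplace density is smaller. *)
Lemma bB_ge1 : 1 <= bB.
Proof.
have [li <-] := @lap_integral R; apply: le_Rintegral => //; first exact: bdens_integrable.
move=> t _; rewrite /lap /bdens ler_pdivrMr// mulrAC ler_pdivlMr ?expR_add1_gt0//.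
have [s0 s1] := andP s01; have [t0|t0] := leP 0 t.
  rewrite ger0_norm// mulrDr mulr1 -expRD addNr expR0.
  have : expR (- t) <= expR 0 by rewrite ler_expR oppr_le0.
  have : expR 0 <= expR (s * t) by rewrite ler_expR mulr_ge0// ltW.
  by rewrite expR0; lra.
rewrite ltr0_norm// opprK mulrDr mulr1.
have E : expR t <= expR (s * t).
  rewrite ler_expR; have := mulr_ge0 (ltW (_ : 0 < - t)) (ltW (_ : 0 < 1 - s)).
  by rewrite oppr_gt0 subr_gt0 => /(_ t0 s1); lra.
have : expR t * expR t <= expR t.
  by rewrite ler_piMr ?expR_ge0// -expR0 ler_expR ltW.
lra.
Qed.

Lemma bB_gt0 : 0 < bB. Proof. exact: lt_le_trans bB_ge1. Qed.

Definition bw t := bdens s t / bB.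

Lemma bw_ge0 t : 0 <= bw t.
Proof. by rewrite divr_ge0 ?bdens_ge0// ltW// bB_gt0. Qed.

Lemma bw_integrable : integrable bw.
Proof. exact: (integrableZr measurableT bB^-1 bdens_integrable). Qed.

Lemma bw_integral : \int[mu]_t bw t = 1.
Proof.
rewrite RintegralZr//; last exact: bdens_integrable.
by rewrite divff// gt_eqF// bB_gt0.
Qed.

Lemma powRN_shift (x t b : R) : 0 <= x ->
  expR (b * (t + ln (1 + x))) = (1 + x) `^ b * expR (b * t).
Proof.
by move=> x0; rewrite mulrDr expRD mulrC /powR gt_eqF// ltr_wpDr.
Qed.

Lemma logis_frac (x t : R) : 0 <= x ->
  1 + x * logis t = (1 + expR (t + ln (1 + x))) / (1 + expR t).
Proof.
move=> x0; rewrite expRD lnK ?posrE ?ltr_wpDr// /logis.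
by field; rewrite gt_eqF// expR_add1_gt0.
Qed.

(** The mean of [1 / (1 + x v)] under the Beta law is [(1 + x) ^ -s]: in the variable
    [t] the additional factor amounts to a translation by [ln (1 + x)]. *)
Lemma bw_frac (x : R) : 0 <= x ->
  \int[mu]_t (bw t * (1 + x * logis t)^-1) = (1 + x) `^ (- s).
Proof.
move=> x0; have [_] := Rintegral_shift (ln (1 + x)) continuous_bdens bdens_integrable.
rewrite -/bB => E.
have -> : (fun t => bw t * (1 + x * logis t)^-1) =
    (fun t => ((1 + x) `^ (- s) / bB) * bdens s (t + ln (1 + x))).
  apply/funext => t; rewrite logis_frac// /bw /bdens powRN_shift// powRN.
  field; rewrite !gt_eqF ?bB_gt0 ?expR_add1_gt0 ?powR_gt0 ?ltr_wpDr//.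
rewrite RintegralZl//; last first.
  by have [] := Rintegral_shift (ln (1 + x)) continuous_bdens bdens_integrable.
by rewrite E divfK// gt_eqF// bB_gt0.
Qed.

(** The same translation as for [bw_frac], with the integrand bounded instead of
    computed. *)
Lemma bw_powR (b : R) : s < b < 1 -> exists2 C, 0 <= C &
  forall x, 0 <= x -> \int[mu]_t (bw t * (1 + x * logis t) `^ (- b)) <= C * (1 + x) `^ (- s).
Proof.
move=> /andP[sb b1]; have [s0 s1] := andP s01.
have hi : integrable (fun t => expR (s * t) * (1 + expR t) `^ (- b)).
  by apply: logistic_integrable; rewrite s0.
exists (bB^-1 * \int[mu]_t (expR (s * t) * (1 + expR t) `^ (- b))).
  apply: mulr_ge0; first by rewrite invr_ge0 ltW// bB_gt0.
  by apply: Rintegral_ge0 => t _; rewrite mulr_ge0 ?expR_ge0 ?powR_ge0.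
move=> x x0.
have ch : continuous (fun t => expR (s * t) * (1 + expR t) `^ (- b)).
  by move=> t; apply: cvgM; [exact: continuous_expRM|exact: continuous_expR_add1_powR].
have [hxi hxE] := Rintegral_shift (ln (1 + x)) ch hi.
rewrite [leRHS]mulrC [leRHS]mulrA -hxE.
rewrite -(RintegralZl _ measurableT hxi).
apply: (le_Rintegral measurableT).
- apply: (integrable_mul_bounded (K := 1)); [exact: bw_integrable| |].
    apply: continuous_measurable_fun; apply: continuous_powR_pos => t.
      apply: cvgD; first exact: cvg_cst.
      by apply: cvgM; [exact: cvg_cst|exact: continuous_logis].
    exact: add1_mul_logis_gt0.
  move=> t; have h0 := add1_mul_logis_gt0 t x0.
  rewrite (ger0_norm (powR_ge0 _ _)) powRN (invf_le1 (powR_gt0 _ h0)).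
  rewrite -[X in X <= _](one_powR b); apply: ge0_ler_powR; rewrite ?nnegrE.
  + exact: ltW (lt_trans s0 sb).
  + exact: ler01.
  + exact: ltW.
  + exact: add1_mul_logis_ge1.
- exact: (integrableZl measurableT _ hxi).
move=> t _; clear hi ch hxi hxE; rewrite /bw /bdens (logis_frac _ x0).
have h1 := expR_add1_gt0 t; have h2 := expR_add1_gt0 (t + ln (1 + x)).
rewrite powRM ?invr_ge0 ?(ltW h1) ?(ltW h2)// powRN_shift//.
have x1 : 0 < 1 + x by rewrite ltr_wpDr.
have -> : (1 + x) `^ (- s) / bB * ((1 + x) `^ s * expR (s * t) *
   (1 + expR (t + ln (1 + x))) `^ (- b)) =
   expR (s * t) / bB * (1 + expR (t + ln (1 + x))) `^ (- b).
  by rewrite powRN; field; rewrite !gt_eqF ?bB_gt0 ?powR_gt0.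
set p := 1 + expR t in h1 *; set q := 1 + expR (t + _) in h2 *.
rewrite [leLHS](_ : _ = expR (s * t) / bB * q `^ (- b) * (p^-1 * p^-1 `^ (- b))); last by ring.
apply: ler_piMr.
  by apply: mulr_ge0; [rewrite divr_ge0 ?expR_ge0// ltW// bB_gt0|exact: powR_ge0].
rewrite -{2}(powR_inv1 (ltW h1)) -powRrM mulN1r opprK mulrC ler_pdivrMr// mul1r.
by apply: ler1_powR; [rewrite lerDl expR_ge0|exact: ltW].
Qed.

End beta_mixtures.

(** Mixture of the functionals [L v] under the Beta law of [v]. *)
HB.lock Definition bmix {R : realType} (s : R) (L : R -> (R -> R) -> R) (f : R -> R) : R :=
  \int[@lebesgue_measure R]_t (bw s t * L (logis t) f).

Section beta_functionals.
Context {R : realType}.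
Local Notation mu := (@lebesgue_measure R).
Implicit Types (f g : R -> R) (L : (R -> R) -> R).
Local Notation integrable f := (mu.-integrable setT (EFin \o f)).

Lemma bmixE s (L : R -> (R -> R) -> R) f : bmix s L f = \int[mu]_t (bw s t * L (logis t) f).
Proof. by rewrite bmix.unlock. Qed.

Lemma pfun_bmix s (L : R -> (R -> R) -> R) : 0 < s < 1 -> (forall v, 0 < v < 1 -> pfun (L v)) ->
  (forall f, bcont f -> continuous (fun t => L (logis t) f)) -> pfun (bmix s L).
Proof.
move=> s01 pL cL; rewrite (_ : bmix s L = fun f => \int[mu]_t (bw s t * L (logis t) f)); last first.
  by apply/funext => f; exact: bmixE.
apply: pfun_mixture.
- exact: bw_ge0.
- exact: bw_integrable.
- by rewrite bw_integral.
- by move=> t; apply: pL; exact: logis_bounds.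
- by move=> f fb; apply: continuous_measurable_fun; exact: cL.
Qed.

End beta_functionals.

(** * Bessel potentials and bounded fractional powers of scalar functions *)

Section bessel_functionals.
Context {R : realType}.
Local Notation mu := (@lebesgue_measure R).
Implicit Types (f g : R -> R) (L : (R -> R) -> R) (s N M w x h : R).
Local Notation integrable f := (mu.-integrable setT (EFin \o f)).

Lemma pfun_scale c L : 0 <= c <= 1 -> pfun L -> pfun (fun f => c * L f).
Proof.
move=> /andP[c0 c1] pL; have bL := pfun_bp pL; split; first split.
- by move=> f g fb gb; rewrite (bplinD bL)// mulrDr.
- by move=> a f fb; rewrite (bplinZ bL)// mulrCA.
- move=> u f K ub fb uK uf; apply: cvgM; first exact: cvg_cst.
  exact: (bplin_cvg bL ub fb uK uf).
- by move=> f fb f0; rewrite mulr_ge0// pfun_ge0.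
- by move=> f fb; rewrite pfun_even.
- by rewrite mulr_ile1// ?pfun_mass// pfun_mass_ge0.
Qed.

(** The resolvent [N (N + 1 - d^2/dx^2)^-1]. *)
Definition resF N f := N / (1 + N) * dil (Num.sqrt (1 + N))^-1 lapF f.

(** The Bessel potential of order [2 s], a Beta mixture of Laplace laws because
    [(1 + x) ^ -s] is the mean of [1 / (1 + x v)]. *)
Definition bes1 s := bmix s (fun v => dil (Num.sqrt v) lapF).
Definition besF s th := dil th (bes1 s).

(** With [mu = 1 - d^2/dx^2], the operator [N ^ s (1 - kapF s N)] is the bounded
    approximation [(N mu / (N + mu)) ^ s] of the fractional power [mu ^ s]. *)
Definition kapF s N := bmix s (fun v => resF (N * v)).

Lemma mass_bounds N : 0 <= N -> 0 <= N / (1 + N) <= 1.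
Proof.
move=> N0; have N1 : 0 < 1 + N by rewrite ltr_pwDl.
by rewrite divr_ge0 ?(ltW N1)//= ler_pdivrMr// mul1r lerDr.
Qed.

Lemma pfun_resF N : 0 <= N -> pfun (resF N).
Proof. by move=> N0; apply: pfun_scale; [exact: mass_bounds|apply: pfun_dil; exact: pfun_lapF]. Qed.

Lemma symb_resF N w : 0 <= N -> symb (resF N) w = N / (N + 1 + w ^+ 2).
Proof.
move=> N0; have N1 : 0 < 1 + N by rewrite ltr_pwDl.
have w0 := sqr_ge0 w.
rewrite /symb /resF -/(symb _ w) symb_dil symb_lapF exprMn exprVn sqr_sqrtr ?(ltW N1)//.
by field; rewrite !gt_eqF//; lra.
Qed.

Lemma continuous_resF_logis N f : 0 <= N -> bcont f ->
  continuous (fun t => resF (N * logis t) f).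
Proof.
move=> N0 fb t; have [/ltW l0 l1] := andP (@logis_bounds R t).
have c1 : 1 + N * logis u @[u --> t] --> 1 + N * logis t.
  by apply: cvgD; [exact: cvg_cst|apply: cvgM; [exact: cvg_cst|exact: continuous_logis]].
have h1 := add1_mul_logis_gt0 t N0.
have c2 : {for t, continuous (fun u => (Num.sqrt (1 + N * logis u))^-1)}.
  apply: cvgV; first by rewrite gt_eqF// sqrtr_gt0.
  exact: (continuous_cvg _ (@sqrt_continuous R _) c1).
have c3 := continuous_comp c2 (@continuous_dil R _ _ (pfun_lapF) fb _).
apply: cvgM; last exact: c3.
apply: cvgM; first by apply: cvgM; [exact: cvg_cst|exact: continuous_logis].
by apply: cvgV => //; rewrite gt_eqF.
Qed.

Section fixed_order.
Variable s : R.
Hypothesis s01 : 0 < s < 1.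

Lemma pfun_kapF N : 0 <= N -> pfun (kapF s N).
Proof.
move=> N0; apply: pfun_bmix => // [v /andP[/ltW v0 _]|f fb]; last exact: continuous_resF_logis.
by apply: pfun_resF; rewrite mulr_ge0.
Qed.

Lemma pfun_bes1 : pfun (bes1 s).
Proof.
apply: pfun_bmix => // [v _|f fb]; first by apply: pfun_dil; exact: pfun_lapF.
move=> t; have c1 : {for t, continuous (fun u => Num.sqrt (logis u))}.
  exact: (continuous_cvg _ (@sqrt_continuous R _) (@continuous_logis R t)).
exact: (continuous_comp c1 (@continuous_dil R _ _ (pfun_lapF) fb _)).
Qed.

Lemma pfun_besF th : pfun (besF s th).
Proof. by apply: pfun_dil; exact: pfun_bes1. Qed.

Lemma symb_besF th w : symb (besF s th) w = (1 + (w * th) ^+ 2) `^ (- s).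
Proof.
rewrite symb_dil -bw_frac ?sqr_ge0// /symb /bes1 bmixE; apply: eq_Rintegral => t _; congr (_ * _).
have [/ltW l0 l1] := andP (@logis_bounds R t).
by rewrite -/(symb _ _) symb_dil symb_lapF [(_ * Num.sqrt _) ^+ 2]exprMn sqr_sqrtr.
Qed.

Lemma bw_frac_integrable x : 0 <= x -> integrable (fun t => bw s t * (1 + x * logis t)^-1).
Proof.
move=> x0; apply: (integrable_mul_bounded (K := 1)); first exact: bw_integrable.
  apply: continuous_measurable_fun => t; have [/ltW l0 l1] := andP (@logis_bounds R t).
  apply: cvgV; first by rewrite gt_eqF// add1_mul_logis_gt0.
  by apply: cvgD; [exact: cvg_cst|apply: cvgM; [exact: cvg_cst|exact: continuous_logis]].
move=> t; have [/ltW l0 l1] := andP (@logis_bounds R t).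
have h0 := mul_logis_ge0 t x0.
by rewrite ger0_norm ?invr_ge0 ?invf_le1 ?lerDl ?addr_ge0// ltr_pwDl.
Qed.

Lemma symb_kapF N w : 0 <= N -> symb (kapF s N) w = 1 - (1 + N / (1 + w ^+ 2)) `^ (- s).
Proof.
move=> N0; have w0 := sqr_ge0 w; have w1 : 0 < 1 + w ^+ 2 by rewrite ltr_pwDl.
have x0 : 0 <= N / (1 + w ^+ 2) by rewrite divr_ge0// ltW.
rewrite /symb /kapF bmixE -bw_frac// -[X in _ = X - _](bw_integral s01) -RintegralB//; [|exact: bw_integrable|exact: bw_frac_integrable].
apply: eq_Rintegral => t _; have [/ltW l0 l1] := andP (@logis_bounds R t).
have h0 := mul_logis_ge0 t N0.
rewrite -/(symb _ _) symb_resF//.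
have h1 : 0 < N * logis t + 1 + w ^+ 2 by lra.
field.
by rewrite !gt_eqF//; lra.
Qed.

Lemma kapF_mass N : 0 <= N -> kapF s N (fun=> 1) = 1 - (1 + N) `^ (- s).
Proof.
move=> N0; have := symb_kapF 0 N0; rewrite expr0n/= addr0 divr1 => <-.
by rewrite /symb; congr kapF; apply/funext => x; rewrite mul0r cos0.
Qed.

(** The Beta mixture of the hypothesis, by [bw_frac]. *)
Lemma kapF_defect_le g N c : 0 <= N -> bcont g ->
  (forall M, 0 < M -> `|g 0 - resF M g| <= c / (1 + M)) ->
  0 < N -> `|g 0 - kapF s N g| <= c * (1 + N) `^ (- s).
Proof.
move=> N0 gb gc Npos.
have ib : integrable (fun t => bw s t * resF (N * logis t) g).
  have [_ [K gK]] := gb.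
  apply: (integrable_mul_bounded (K := K)); first exact: bw_integrable.
    by apply: continuous_measurable_fun; exact: continuous_resF_logis.
  move=> t; apply: pfun_bound => //; apply: pfun_resF.
  exact: mul_logis_ge0.
have ig : integrable (fun t => bw s t * g 0).
  exact: (integrableZr measurableT _ (bw_integrable s01)).
rewrite /kapF bmixE (_ : g 0 = \int[mu]_t (bw s t * g 0)); last first.
  by rewrite RintegralZr ?bw_integral ?mul1r//; exact: bw_integrable.
rewrite -RintegralB//.
apply: le_trans (le_normr_Rintegral measurableT (integrable_sub ig ib)) _.
rewrite -bw_frac// -RintegralZl//; last exact: bw_frac_integrable.
apply: le_Rintegral => //.
- by apply: integrable_norm; exact: integrable_sub.
- by apply: (integrableZl measurableT _ (bw_frac_integrable N0)).
move=> t _; rewrite -mulrBr normrM (ger0_norm (bw_ge0 s01 t)) [leRHS]mulrCA.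
apply: ler_wpM2l; first exact: bw_ge0.
by apply: gc; rewrite mulr_gt0//; case/andP: (@logis_bounds R t).
Qed.

(** Moments of order above [2 s]: the scale [(1 + N v) ^ -1/2] of the resolvents in the
    mixture is averaged by [bw_powR]. *)
Lemma kapF_tmod b : s < b -> 2 * b <= 1 -> exists2 C, 0 <= C &
  forall N n, 0 <= N -> 0 <= n -> kapF s N (tmod (2 * b) n) <= C * (1 + N) `^ (- s).
Proof.
move=> sb b1; have [s0 s1] := andP s01; have [|C C0 HC] := @bw_powR R s s01 b.
  by apply/andP; split => //; lra.
exists (4 * C); first by rewrite mulr_ge0.
move=> N n N0 n0; rewrite -mulrA.
have p01 : 0 < 2 * b <= 1 by apply/andP; split => //; lra.
have tb : bcont (tmod (2 * b) n) by apply: bcont_tmod => //; lra.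
rewrite /kapF bmixE; apply: le_trans (_ : _ <= 4 * \int[mu]_t (bw s t * (1 + N * logis t) `^ (- b))) _; last first.
  by rewrite ler_wpM2l// HC.
have h1 t : 1 <= 1 + N * logis t.
  exact: add1_mul_logis_ge1.
have mlog : measurable_fun setT (fun t : R => (1 + N * logis t) `^ (- b)).
  apply: continuous_measurable_fun; apply: continuous_powR_pos => t.
    apply: cvgD; first exact: cvg_cst.
    by apply: cvgM; [exact: cvg_cst|exact: continuous_logis].
  exact: lt_le_trans (h1 t).
have il : integrable (fun t => bw s t * (1 + N * logis t) `^ (- b)).
  apply: (integrable_mul_bounded (K := 1)) => //; first exact: bw_integrable.
  move=> t; rewrite (ger0_norm (powR_ge0 _ _)) powRN.
  rewrite (invf_le1 (powR_gt0 _ (lt_le_trans ltr01 (h1 t)))).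
  rewrite -[X in X <= _](one_powR b); apply: ge0_ler_powR; rewrite ?nnegrE//; first lra.
  exact: le_trans (h1 t).
rewrite -RintegralZl//; apply: le_Rintegral => //.
- have [_ [K gK]] := tb.
  apply: (integrable_mul_bounded (K := K)); first exact: bw_integrable.
    by apply: continuous_measurable_fun; exact: continuous_resF_logis.
  move=> t; apply: pfun_bound => //; apply: pfun_resF.
  exact: mul_logis_ge0.
- exact: (integrableZl measurableT _ il).
move=> t _; rewrite [leRHS]mulrCA; apply: ler_wpM2l; first exact: bw_ge0.
have Nl := mul_logis_ge0 t N0.
have [m0 m1] := andP (mass_bounds Nl).
apply: le_trans (_ : _ <= dil (Num.sqrt (1 + N * logis t))^-1 lapF (tmod (2 * b) n)) _.
  rewrite /resF ler_piMl//; apply: pfun_ge0 => //.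
    by apply: pfun_dil; exact: pfun_lapF.
  by move=> x; rewrite /tmod le_min powR_ge0.
apply: le_trans (lap_tmod p01 n0 _) _; first by rewrite invr_ge0 sqrtr_ge0.
rewrite ler_wpM2l// -powR12_sqrt ?(le_trans _ (h1 t))//.
rewrite -(powR_inv1 (powR_ge0 _ _)) -!powRrM le_eqVlt; apply/orP; left; apply/eqP.
by congr (_ `^ _); field.
Qed.

End fixed_order.


(** The sine transforms vanish by evenness. *)
Lemma pfun_unique L1 L2 : pfun L1 -> pfun L2 ->
  (forall w, symb L1 w = symb L2 w) -> forall f, bcont f -> L1 f = L2 f.
Proof.
move=> p1 p2 H; apply: bplin_unique => //; [exact: pfun_bp|exact: pfun_bp|].
by move=> w; rewrite !pfun_sin.
Qed.

Lemma comp_comm L1 L2 f : pfun L1 -> pfun L2 -> bcont f -> comp L1 L2 f = comp L2 L1 f.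
Proof.
move=> p1 p2; apply: pfun_unique; [exact: pfun_comp|exact: pfun_comp|].
by move=> w; rewrite !symb_comp// mulrC.
Qed.

Lemma conv_comm L1 L2 f : pfun L1 -> pfun L2 -> bcont f ->
  conv L1 (conv L2 f) = conv L2 (conv L1 f).
Proof.
move=> p1 p2 fb; rewrite -!conv_comp; apply/funext => x.
by apply: comp_comm => //; exact: bcont_shift.
Qed.

(** An identity between functionals of the form [a1 L1 + a2 L2 + a3 L3 + a4 L4 = 0]
    is an identity between symbols. *)
Lemma symb_relation L1 L2 L3 L4 a1 a2 a3 a4 (m1 m2 m3 m4 : R -> R) :
  pfun L1 -> pfun L2 -> pfun L3 -> pfun L4 ->
  symb L1 =1 m1 -> symb L2 =1 m2 -> symb L3 =1 m3 -> symb L4 =1 m4 ->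
  (forall w, a1 * m1 w + a2 * m2 w + (a3 * m3 w + a4 * m4 w) = 0) ->
  forall f, bcont f -> a1 * L1 f + a2 * L2 f + (a3 * L3 f + a4 * L4 f) = 0.
Proof.
move=> p1 p2 p3 p4 s1 s2 s3 s4 H f fb.
have b12 := bplin_comb a1 a2 (pfun_bp p1) (pfun_bp p2).
have b34 := bplin_comb a3 a4 (pfun_bp p3) (pfun_bp p4).
have := @bplin_eq0 _ _ (bplin_comb 1 1 b12 b34) _ _ f fb; rewrite /= !mul1r; apply.
  by move=> w; rewrite !mul1r -(H w) -s1 -s2 -s3 -s4.
by move=> w; rewrite !pfun_sin// !mulr0 !addr0 !mulr0 addr0.
Qed.

Lemma symb_comp_eq L1 L2 (m1 m2 : R -> R) : pfun L1 -> pfun L2 ->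
  symb L1 =1 m1 -> symb L2 =1 m2 -> symb (comp L1 L2) =1 fun w => m1 w * m2 w.
Proof. by move=> p1 p2 s1 s2 w; rewrite symb_comp// s1 s2. Qed.

Lemma powR_frac x y s : 0 < x -> 0 < y -> (x / y) `^ (- s) = x `^ (- s) * y `^ s.
Proof.
move=> x0 y0; rewrite powRM ?invr_ge0 ?ltW//; congr (_ * _).
by rewrite -{1}(powR_inv1 (ltW y0)) -powRrM mulrNN mul1r.
Qed.

(** [1 - resF N] factors as [(1 - kapF (1 - s) N) (1 - kapF s N)], the exponents
    [1 - s] and [s] adding up to one. *)
Lemma kapF_complement s N f : 0 < s < 1 -> 0 <= N -> bcont f ->
  resF N f = kapF (1 - s) N f + kapF s N f - comp (kapF (1 - s) N) (kapF s N) f.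
Proof.
move=> s01 N0; have [s0 s1] := andP s01.
have s01' : 0 < 1 - s < 1 by apply/andP; split; lra.
have p1 := pfun_resF N0; have p2 := pfun_kapF s01' N0; have p3 := pfun_kapF s01 N0.
have t1 w := symb_resF w N0.
have t2 w := symb_kapF s01' w N0.
have t3 w := symb_kapF s01 w N0.
move=> fb.
have := symb_relation (a1 := 1) (a2 := -1) (a3 := -1) (a4 := 1) p1 p2 p3 (pfun_comp p2 p3)
  t1 t2 t3 (symb_comp_eq p2 p3 t2 t3) _ fb.
move: (resF N f) (kapF _ N f) (kapF s N f) (comp _ _ f) => a b c d H.
suff : 1 * a + -1 * b + (-1 * c + 1 * d) = 0 by lra.
apply: H => w.
have w0 := sqr_ge0 w; have w1 : 0 < 1 + w ^+ 2 by rewrite ltr_pwDl.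
set q := 1 + N / _; have q0 : 0 < q by rewrite ltr_pwDl// divr_ge0// ltW.
have E : q `^ (- (1 - s)) * q `^ (- s) = q^-1.
  rewrite -powRD; last by apply/implyP => _; rewrite gt_eqF.
  by rewrite -[RHS](powR_inv1 (ltW q0)); congr (_ `^ _); ring.
have -> : N / (N + 1 + w ^+ 2) = 1 - q^-1.
  by rewrite /q; field; rewrite !gt_eqF//; lra.
rewrite -E; ring.
Qed.

(** The resolvent identity. *)
Lemma resF_resolvent M K f : 0 < M -> 0 <= K -> bcont f ->
  resF K f - comp (resF M) (resF K) f = K / M * (resF M f - comp (resF M) (resF K) f).
Proof.
move=> M0 K0 fb; have pM := pfun_resF (ltW M0); have pK := pfun_resF K0.
have pc := pfun_comp pM pK.
have sM w := symb_resF w (ltW M0).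
have sK w := symb_resF w K0.
have sc := symb_comp_eq pM pK sM sK.
have H := symb_relation (a1 := 1) (a2 := -1) (a3 := - (K / M)) (a4 := K / M)
  pK pc pM pc sK sc sM sc _ fb.
have {}H : 1 * resF K f + (-1) * comp (resF M) (resF K) f +
    ((- (K / M)) * resF M f + (K / M) * comp (resF M) (resF K) f) = 0.
  apply: H => w; have w0 := sqr_ge0 w; field; rewrite !gt_eqF//; lra.
move: H; move: (resF K f) (resF M f) (comp _ _ f) => a b c H.
by apply/eqP; rewrite -subr_eq0; apply/eqP; rewrite -[RHS]H; ring.
Qed.

(** Up to the factor [N ^ s], this is [(N mu / (N + mu)) ^ s] applied to [mu ^ -s]: a
    Bessel potential at the frequency scale [sqrt (1 + N)]. *)
Lemma kapF_besF s N f : 0 < s < 1 -> 0 <= N -> bcont f ->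
  besF s 1 f - comp (kapF s N) (besF s 1) f =
  (1 + N) `^ (- s) * besF s (Num.sqrt (1 + N))^-1 f.
Proof.
move=> s01 N0 fb; have pk := pfun_kapF s01 N0; have p1 := pfun_besF s01 1.
have pN := pfun_besF s01 (Num.sqrt (1 + N))^-1.
have s1 w := symb_besF s01 1 w.
have sN w := symb_besF s01 (Num.sqrt (1 + N))^-1 w.
have sk w := symb_kapF s01 w N0.
have H := symb_relation (a1 := 1) (a2 := -1) (a3 := - (1 + N) `^ (- s)) (a4 := 0)
  p1 (pfun_comp pk p1) pN p1 s1 (symb_comp_eq pk p1 sk s1) sN s1 _ fb.
have {}H : 1 * besF s 1 f + (-1) * comp (kapF s N) (besF s 1) f +
    ((- (1 + N) `^ (- s)) * besF s (Num.sqrt (1 + N))^-1 f + 0 * besF s 1 f) = 0.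
  apply: H => w.
  have w0 := sqr_ge0 w; have w1 : 0 < 1 + w ^+ 2 by rewrite ltr_pwDl.
  have N1 : 0 < 1 + N by rewrite ltr_pwDl.
  rewrite mulr1 exprMn exprVn sqr_sqrtr ?(ltW N1)//.
  rewrite (_ : 1 + N / (1 + w ^+ 2) = (1 + N + w ^+ 2) / (1 + w ^+ 2)); last first.
    by field; rewrite gt_eqF.
  rewrite (_ : 1 + w ^+ 2 / (1 + N) = (1 + N + w ^+ 2) / (1 + N)); last first.
    by field; rewrite gt_eqF.
  have h : 0 < 1 + N + w ^+ 2 by rewrite ltr_pwDl// -?addrA ?addr_gt0.
  rewrite !powR_frac// !powRN; field.
  by rewrite !gt_eqF ?powR_gt0.
move: H; move: (besF s 1 f) (besF s _ f) (comp _ _ f) (_ `^ _) => a b c p H.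
by apply/eqP; rewrite -subr_eq0; apply/eqP; rewrite -[RHS]H; ring.
Qed.

Lemma resF_lipschitz N g K : 0 <= N -> bcont g -> (forall x, `|g x| <= K) ->
  forall x h, `|conv (resF N) g (x + h) - conv (resF N) g x| <= 4 * `|h| * Num.sqrt (1 + N) * K.
Proof.
move=> N0 gb gK x h; have N1 : 0 < 1 + N by rewrite ltr_pwDl.
have K0 : 0 <= K by apply: le_trans (gK 0).
have [m0 m1] := andP (mass_bounds N0).
rewrite /conv /resF -mulrBr normrM (ger0_norm m0).
set th := (Num.sqrt (1 + N))^-1.
have th0 : 0 < th by rewrite invr_gt0 sqrtr_gt0.
apply: le_trans (ler_piMl (normr_ge0 _) m1) _.
have gb' : bcont (fun u => g (x + th * u)) by apply: (bcont_scale (f := fun u => g (x + u))); exact: bcont_shift.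
have := lapF_lipschitz (h / th) gb' (fun u => gK _).
rewrite normrM normfV (gtr0_norm th0) invrK mulrA; apply: le_trans.
rewrite /dil le_eqVlt; apply/orP; left; apply/eqP; congr (`|lapF _ - _|).
apply/funext => u; congr g; rewrite mulrDr.
have -> : th * (h * Num.sqrt (1 + N)) = h.
  by rewrite mulrCA mulVf ?mulr1// gt_eqF// sqrtr_gt0.
by ring.
Qed.

(** Split [g] into its resolvent, which is Lipschitz, and the rest, which is small
    because [1 - resF N] is [N ^ -s] times a bounded operator times the
    approximate fractional power. *)
Lemma fractional_modulus s g X0 X1 : 0 < s < 1 -> bcont g -> (forall x, `|g x| <= X0) ->
  (forall N x, 0 < N -> `|N `^ s * (g x - conv (kapF s N) g x)| <= X1) ->
  forall N x h, 0 < N ->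
  `|g (x + h) - g x| <= 4 * N `^ (- s) * X1 + 4 * `|h| * Num.sqrt (1 + N) * X0.
Proof.
move=> s01 gb gX0 gX1 N x h N0; have N0' := ltW N0.
have s01' : 0 < 1 - s < 1 by move/andP: s01 => [s0 s1]; apply/andP; split; lra.
have pY := pfun_resF N0'; have pk := pfun_kapF s01 N0'; have pk' := pfun_kapF s01' N0'.
pose u x := g x - conv (kapF s N) g x.
have ub : bcont u by apply: bcontB => //; exact: bcont_conv.
have uX x' : `|u x'| <= N `^ (- s) * X1.
  have := gX1 N x' N0; rewrite normrM ger0_norm ?powR_ge0// -/(u x') powRN.
  by rewrite ler_pdivlMl// powR_gt0.
have res x' : `|g x' - conv (resF N) g x'| <= 2 * (N `^ (- s) * X1).
  have -> : g x' - conv (resF N) g x' = u x' - conv (kapF (1 - s) N) u x'.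
    have -> : conv (resF N) g x' = conv (kapF (1 - s) N) g x' + conv (kapF s N) g x' -
        conv (comp (kapF (1 - s) N) (kapF s N)) g x'.
      exact: (kapF_complement s01 N0' (bcont_shift x' gb)).
    rewrite [in RHS]/u (convB (pfun_bp pk') gb (bcont_conv pk gb)) -conv_comp.
    move: (g x') (conv (kapF (1 - s) N) g x') (conv (kapF s N) g x') (conv (comp _ _) g x').
    by move=> a b c d; ring.
  rewrite (le_trans (ler_normB _ _))//; have := uX x'.
  have := conv_bound pk' ub uX x'.
  move: `|u x'| `|conv _ u x'| => a b; lra.
have := resF_lipschitz N0' gb gX0 x h; have := res x; have := res (x + h).
move: (conv _ _ (x + h)) (conv _ _ x) => a b h1 h2 h3.
have -> : g (x + h) - g x = (g (x + h) - a) + (a - b) - (g x - b) by ring.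
have := ler_normB ((g (x + h) - a) + (a - b)) (g x - b).
have := ler_normD (g (x + h) - a) (a - b).
lra.
Qed.

(** The exponent that balances the two terms of [fractional_modulus]. *)
Definition hexp s := 2 * s / (1 + 2 * s).

(** For [s < 1/2] the exponent exceeds [s] and does not exceed one half, which are the
    conditions of [kapF_tmod]. *)
Lemma hexp_gt s : 0 < s < 2^-1 -> s < hexp s /\ 2 * hexp s <= 1.
Proof.
move=> /andP[s0 s1]; have h : 0 < 1 + 2 * s by lra.
split.
  rewrite /hexp ltr_pdivlMr//; have : 0 < s * (1 - 2 * s) by apply: mulr_gt0 => //; lra.
  lra.
by rewrite /hexp mulrA ler_pdivrMr//; lra.
Qed.

(** Optimizing [N] in the preceding bound; taking [N] a large multiple of the
    optimal value makes the first term small at the expense of the second. *)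
Lemma holder_optimize s : 0 < s < 1 -> forall e, 0 < e -> exists2 C, 0 <= C &
  forall D X0 X1 h, 0 <= X0 -> 0 <= X1 -> h != 0 -> D <= 2 * X0 ->
  (forall N, 0 < N -> D <= 4 * N `^ (- s) * X1 + 4 * `|h| * Num.sqrt (1 + N) * X0) ->
  D <= `|h| `^ hexp s * (e * X1 + C * X0).
Proof.
move=> /andP[s0 s1] e e0; have s2 : 0 < 1 + 2 * s by lra.
pose K := Num.max 1 ((4 / e) `^ s^-1).
have K1 : 1 <= K by rewrite le_max lexx.
have K0 : 0 < K by exact: lt_le_trans K1.
have Ke : 4 * K `^ (- s) <= e.
  rewrite powRN ler_pdivrMr ?powR_gt0// mulrC -ler_pdivrMr//.
  have -> : 4 / e = ((4 / e) `^ s^-1) `^ s.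
    by rewrite -powRrM mulVf ?gt_eqF// powRr1// divr_ge0// ltW.
  apply: ge0_ler_powR; rewrite ?nnegrE ?powR_ge0 ?(ltW s0) ?(ltW K0)//.
  by rewrite le_max lexx orbT.
exists (8 * Num.sqrt K + 2); first by rewrite addr_ge0// mulr_ge0// sqrtr_ge0.
move=> D X0 X1 h X00 X10 h0 D2 DN.
have nh : 0 < `|h| by rewrite normr_gt0.
set b := hexp s; have b0 : 0 <= b by rewrite divr_ge0//; lra.
have hb := powR_ge0 `|h| b.
have sK := sqrtr_ge0 K.
have [h1|h1] := leP `|h| 1; last first.
  apply: le_trans D2 _; apply: (@le_trans _ _ (2 * X0 * `|h| `^ b)).
    rewrite ler_peMr ?mulr_ge0// -[X in X <= _](one_powR b).
    by apply: ge0_ler_powR; rewrite ?nnegrE// ltW.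
  rewrite mulrC ler_wpM2l//; have := mulr_ge0 sK X00; have := mulr_ge0 (ltW e0) X10; lra.
pose N := K * `|h| `^ (- (2 / (1 + 2 * s))).
have hp0 : 0 < `|h| `^ (- (2 / (1 + 2 * s))) by rewrite powR_gt0.
have N0 : 0 < N by rewrite mulr_gt0.
have N1 : 1 <= N.
  rewrite (le_trans K1)// /N ler_pMr// -[X in X <= _](powRr0 `|h|).
  apply: ger_powR; first by rewrite nh.
  by rewrite oppr_le0 divr_ge0// ltW.
apply: le_trans (DN N N0) _.
have E1 : N `^ (- s) = K `^ (- s) * `|h| `^ b.
  rewrite /N powRM ?(ltW K0) ?powR_ge0//; congr (_ * _); rewrite -powRrM; congr (_ `^ _).
  by rewrite /b /hexp; field; rewrite gt_eqF.
have E2 : `|h| * Num.sqrt N = Num.sqrt K * `|h| `^ b.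
  rewrite /N sqrtrM ?(ltW K0)// mulrCA; congr (_ * _).
  rewrite -powR12_sqrt ?powR_ge0// -powRrM -{1}(powRr1 (ltW nh)) -powRD; last by apply/implyP => _; rewrite gt_eqF.
  by congr (_ `^ _); rewrite /b /hexp; field; rewrite gt_eqF.
have E3 : Num.sqrt (1 + N) <= 2 * Num.sqrt N.
  have -> : 2 * Num.sqrt N = Num.sqrt (2 ^+ 2 * N).
    have h4 : (0 : R) <= 2 ^+ 2 by exact: sqr_ge0.
    by rewrite (sqrtrM N h4) sqrtr_sqr ger0_norm.
  by apply: ler_wsqrtr; rewrite expr2; lra.
rewrite E1.
have F1 : 4 * (K `^ (- s) * `|h| `^ b) * X1 <= `|h| `^ b * (e * X1).
  have := ler_wpM2r (mulr_ge0 hb X10) Ke; lra.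
have F2 : 4 * `|h| * Num.sqrt (1 + N) * X0 <= 8 * (Num.sqrt K * `|h| `^ b) * X0.
  rewrite -E2; have := ler_wpM2l (mulr_ge0 (ltW nh) X00) E3; lra.
have : 0 <= `|h| `^ b * (2 * X0) by rewrite !mulr_ge0.
lra.
Qed.

End bessel_functionals.

(** * Real norms over the complex numbers, and the weak topology *)

Section real_norm.
Context {R : realType}.
Local Open Scope complex_scope.

Lemma nrmE (V : normedModType R[i]) (x : V) : `|x| = (nrm x)%:C.
Proof. by rewrite /nrm RRe_real// normr_real. Qed.

Lemma nrm_ge0 (V : normedModType R[i]) (x : V) : 0 <= nrm x.
Proof. by rewrite -ler0c -nrmE. Qed.

Lemma nrmD (V : normedModType R[i]) (x y : V) : nrm (x + y) <= nrm x + nrm y.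
Proof. by rewrite -lecR rmorphD/= -!nrmE ler_normD. Qed.

Lemma nrmN (V : normedModType R[i]) (x : V) : nrm (- x) = nrm x.
Proof. by rewrite /nrm normrN. Qed.

Lemma nrm0 (V : normedModType R[i]) : nrm (0 : V) = 0.
Proof. by rewrite /nrm normr0. Qed.

Lemma nrm_eq0 (V : normedModType R[i]) (x : V) : nrm x = 0 -> x = 0.
Proof. by move=> x0; apply: normr0_eq0; rewrite nrmE x0. Qed.

Definition cabs (c : R[i]) : R := complex.Re `|c|.

Lemma cabsE c : `|c| = (cabs c)%:C.
Proof. by rewrite /cabs RRe_real// normr_real. Qed.

Lemma nrmZ (V : normedModType R[i]) c (x : V) : nrm (c *: x) = cabs c * nrm x.
Proof. by apply: complexI; rewrite rmorphM/= -!nrmE -cabsE normrZ. Qed.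

Lemma cabsC (a : R) : cabs a%:C = `|a|.
Proof. by rewrite /cabs normc_def/= expr0n/= addr0 sqrtr_sqr. Qed.

Lemma nrmZr (V : normedModType R[i]) (a : R) (x : V) : nrm (a%:C *: x) = `|a| * nrm x.
Proof. by rewrite nrmZ cabsC. Qed.

Lemma nrm_scalar (c : R[i]^o) : nrm c = cabs c.
Proof. by []. Qed.

Lemma normRe_le (c : R[i]^o) : `|complex.Re c| <= nrm c.
Proof. by rewrite -lecR -nrmE; exact: normc_ge_Re. Qed.

Lemma real_pos (e : R[i]) : 0 < e -> exists2 d : R, 0 < d & e = d%:C.
Proof.
move=> e0; have er : e \is Num.real by rewrite gtr0_real.
by exists (complex.Re e); [rewrite -ltcR RRe_real|rewrite RRe_real].
Qed.

Lemma cvg_nrmP (V : normedModType R[i]) (T : Type) (F : set_system T) (f : T -> V) (l : V) :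
  Filter F ->
  (f @ F --> l <-> forall e : R, 0 < e -> \forall t \near F, nrm (l - f t) < e).
Proof.
move=> FF; split => [/cvgrPdist_lt H e e0|H].
  have /H : 0 < e%:C by rewrite ltcR.
  by apply: filterS => t; rewrite nrmE ltcR.
apply/cvgrPdist_lt => e /real_pos[d d0 ->].
by apply: filterS (H d d0) => t; rewrite nrmE ltcR.
Qed.

(** Completeness, in the form in which limits are produced below. *)
Lemma nrm_complete (V : completeNormedModType R[i]) (u : nat -> V) :
  (forall e : R, 0 < e -> exists N, forall n m, (N <= n)%N -> (N <= m)%N ->
     nrm (u n - u m) <= e) ->
  exists l, forall e : R, 0 < e -> exists N, forall n, (N <= n)%N -> nrm (l - u n) <= e.
Proof.
move=> H; have cu : cauchy (u @ \oo).
  apply/cauchy_ballP => e /real_pos[d d0 ->].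
  have [N HN] := H _ (divr_gt0 d0 (ltr0n _ 2)).
  near_simpl; near=> n m => /=; rewrite -ball_normE /ball_/= nrmE ltcR.
  apply: le_lt_trans (HN _ _ _ _) _.
  - by near: n; exists N.
  - by near: m; exists N.
  - by rewrite ltr_pdivrMr// ltr_pMr// ltr1n.
have ul : u @ \oo --> lim (u @ \oo) by apply: (cauchy_cvg (u @ \oo)); exact: cu.
exists (lim (u @ \oo)) => e e0; have /cvg_nrmP/(_ e e0)[N _ HN] := ul.
by exists N => n Nn; apply/ltW/HN.
Unshelve. all: by end_near. Qed.

Lemma Re_continuous : continuous (@complex.Re R : R[i]^o -> R).
Proof.
move=> z; apply/(@cvgrPdist_lt _ _ _ _ (nbhs_filter (z : R[i]^o))) => e e0.
have nb : nbhs (z : R[i]^o) (ball (z : R[i]^o) e%:C) by apply: nbhsx_ballx; rewrite ltcR.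
apply: (@filterS _ _ (nbhs_filter (z : R[i]^o)) _ _ _ nb) => w.
rewrite -ball_normE /ball_/= (@nrmE R[i]^o) ltcR; apply: le_lt_trans.
by have := normRe_le (z - w); rewrite raddfB.
Qed.

End real_norm.

(** Pointwise convergence on a bare index type. *)
Lemma ptws_cvgP (I : eqType) (V : topologicalType) (G : set_system (I -> V)) (f : I -> V) :
  Filter G -> {ptws, G --> f} <-> forall i, (fun g => g i) @ G --> f i.
Proof.
move=> FG; split => [Gf i|H].
  by move=> W /(@proj_continuous I (fun=> V) i f); exact: Gf.
apply/cvg_sup => i; rewrite cvg_image; last first.
  by rewrite eqEsubset; split => v // _; exists (cst v).
move=> W /= /(H i) GW; exists (@^~ i @^-1` W) => //.
by rewrite eqEsubset; split => [j [? + <-//]|j Wj]; exists (fun _ => j).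
Qed.

Section continuous_functionals.
Context {R : realType} (A : normedModType R[i]).
Variable F : set (A -> R[i]^o).
Hypothesis nF : norm_closed_subspace F.

Lemma F_linear phi : F phi -> linear phi.
Proof. by case: nF => sub _ _ _ /sub[]. Qed.

Lemma F_comb c phi ps : F phi -> F ps -> F (fun a => c * phi a + ps a).
Proof. by case: nF => _ _ cF _; exact: cF. Qed.

Lemma sigma_cvg (H : set_system A) (x : A) : Filter H ->
  (forall phi, F phi -> phi a @[a --> H] --> phi x) -> H --> (x : sigma_top F).
Proof.
move=> FH Hphi B [_ [[C oC <-] Cx] sub].
pose ev := fun a (phi : set_type F) => (set_val phi a : R[i]^o).
have evx : {ptws, ev @ H --> ev x}.
  by apply/ptws_cvgP => p; apply: Hphi; exact: set_valP.
have : nbhs (ev x : {ptws set_type F -> R[i]^o}) C by apply: open_nbhs_nbhs.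
by move=> /evx HC; exact: (@filterS _ H FH _ _ sub HC).
Qed.

Lemma sigma_continuous phi : F phi -> continuous (phi : sigma_top F -> R[i]^o).
Proof.
move=> Fphi a.
pose ev := fun a (phi : set_type F) => (set_val phi a : R[i]^o).
have : continuous (ev : sigma_top F -> {ptws set_type F -> R[i]^o}).
  exact: initial_continuous.
move=> /(_ a) cev; have {}cev : {ptws, ev @ nbhs (a : sigma_top F) --> ev a} by exact: cev.
pose p : set_type F := SigSub (mem_set Fphi).
have pE : set_val p = phi by rewrite set_valE.
have := (ptws_cvgP _ _).1 cev p.
rewrite /ev /= -[in X in _ -> X]pE; exact.
Qed.

(** A linear map that vanishes on the common kernel of finitely many elements of
    [F] is a combination of them. *)
Lemma F_finite_kernel (s : seq (A -> R[i]^o)) (g : A -> R[i]^o) :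
  (forall phi, phi \in s -> F phi) -> linear g ->
  (forall a, (forall phi, phi \in s -> phi a = 0) -> g a = 0) -> F g.
Proof.
elim: s g => [|phi s IH] g sF lg g0.
  rewrite (_ : g = fun=> 0); first by case: nF.
  by apply/funext => a; apply: g0.
have Fphi : F phi by apply: sF; rewrite mem_head.
have sF' ps : ps \in s -> F ps by move=> sps; apply: sF; rewrite inE sps orbT.
have lphi := F_linear Fphi.
have [[a0 [sa0 pa0]]|na] := pselect (exists a, (forall ps, ps \in s -> ps a = 0) /\ phi a <> 0); last first.
  apply: IH => // a sa; apply: g0 => ps; rewrite inE => /predU1P[->|]; last exact: sa.
  by apply: contrapT => pa; apply: na; exists a.
have {}pa0 : phi a0 != 0 by apply/eqP.
pose c := g a0 / phi a0.
have -> : g = fun a => c * phi a + (fun a => (- c) * phi a + g a) a.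
  by apply/funext => a; rewrite mulNr addrA addrN add0r.
apply: F_comb => //; apply: IH => //.
  move=> k x y; rewrite lg lphi /GRing.scale/=; ring.
move=> a sa; pose t : R[i] := - (phi a / phi a0).
have : g (t *: a0 + a) = 0.
  apply: g0 => ps; rewrite inE => /predU1P[->|sps].
    by rewrite lphi /t /GRing.scale/= mulNr divfK// addNr.
  by rewrite (F_linear (sF' _ sps)) (sa0 _ sps) (sa _ sps) scaler0 addr0.
rewrite lg /GRing.scale/= /t => <-; rewrite /c; field.
exact: pa0.
Qed.

(** The dual of [A] with its [F]-weak topology is [F]: test continuity along the
    filter generated by the common kernels of finite families. *)
Lemma sigma_dual (g : A -> R[i]^o) : linear g ->
  {for 0, continuous (g : sigma_top F -> R[i]^o)} -> F g.
Proof.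
move=> lg cg.
pose ker (s : seq (A -> R[i]^o)) := [set a : A | forall phi, phi \in s -> phi a = 0].
pose D := [set s : seq (A -> R[i]^o) | forall phi, phi \in s -> F phi].
pose H : set_system A := filter_from D ker.
have FH : Filter H.
  apply: filter_from_filter; first by exists [::].
  move=> s s' Ds Ds'; exists (s ++ s').
    by move=> phi; rewrite mem_cat => /orP[]; [exact: Ds|exact: Ds'].
  by move=> a ha; split => phi hphi; apply: ha; rewrite mem_cat hphi ?orbT.
have H0 : H --> (0 : sigma_top F).
  apply: sigma_cvg => phi Fphi; apply/cvg_nrmP => e e0.
  have phi0 : phi 0 = 0 by have := F_linear Fphi 1 0 0; rewrite scaler0 addr0 scale1r => /eqP; rewrite -subr_eq subrr => /eqP <-.
  exists [:: phi] => [ps|a /(_ phi)]; first by rewrite inE => /eqP ->.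
  by rewrite inE eqxx => /(_ isT) /= ->; rewrite phi0 subrr nrm0.
have g0 : g 0 = 0 by have := lg 1 0 0; rewrite scaler0 addr0 scale1r => /eqP; rewrite -subr_eq subrr => /eqP <-.
have : g @ H --> g 0 by apply: cvg_comp H0 _; exact: cg.
move=> /cvg_nrmP/(_ 1 ltr01)[s Ds sg].
apply: (F_finite_kernel Ds lg) => a sa; apply: contrapT => /eqP ga.
have gk k : g (k *: a) = k * g a by have := lg k a 0; rewrite addr0 g0 addr0.
have /= := sg ((g a)^-1 *: a) => h.
have : ker s ((g a)^-1 *: a).
  move=> phi sphi; have lphi := F_linear (Ds _ sphi).
  have phi0 : phi 0 = 0 by have := lphi 1 0 0; rewrite scaler0 addr0 scale1r => /eqP; rewrite -subr_eq subrr => /eqP <-.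
  have := lphi (g a)^-1 a 0; rewrite addr0 phi0 addr0 (sa _ sphi) => ->.
  exact: scaler0.
move=> /h; rewrite gk mulVf// g0 sub0r nrmN nrm_scalar.
by rewrite /cabs normr1 ltxx.
Qed.

End continuous_functionals.

(** * Fine partitions of unity *)

Section partition.
Context {R : realType}.
Implicit Types (L : (R -> R) -> R).

Definition ramp (u : R) : R := Num.min 1 (Num.max 0 u).

Lemma ramp_ge0 u : 0 <= ramp u. Proof. by rewrite le_min ler01 le_max lexx. Qed.
Lemma ramp_le1 u : ramp u <= 1. Proof. by rewrite ge_min lexx. Qed.
Lemma ramp_id0 u : u <= 0 -> ramp u = 0.
Proof. by move=> u0; rewrite /ramp (max_idPl u0) (min_idPr _). Qed.
Lemma ramp_id1 u : 1 <= u -> ramp u = 1.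
Proof. by move=> u1; rewrite /ramp (min_idPl _)// le_max u1 orbT. Qed.
Lemma ramp_homo u v : u <= v -> ramp u <= ramp v.
Proof.
move=> uv; rewrite le_min ramp_le1/= /ramp ge_min; apply/orP; right.
by rewrite ge_max !le_max lexx/= uv orbT.
Qed.

Lemma continuous_ramp : continuous ramp.
Proof.
have cmax : continuous (fun u : R => Num.max 0 u).
  move=> u; apply: (@continuous_max _ _ (fun=> 0 : R) (fun u : R => u) u); first exact: cvg_cst.
  exact: cvg_id.
move=> u; apply: (@continuous_min _ _ (fun=> 1 : R) (fun u : R => Num.max 0 u) u).
  exact: cvg_cst.
exact: cmax.
Qed.

Lemma bcont_ramp (a b : R) : bcont (fun t => ramp (a * t + b)).
Proof.
apply: (@bcont_comp R ramp); first split; first exact: continuous_ramp.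
  by exists 1 => u; rewrite ger0_norm ?ramp_ge0 ?ramp_le1.
move=> t; apply: cvgD; last exact: cvg_cst.
by apply: cvgM; [exact: cvg_cst|exact: cvg_id].
Qed.

Lemma bcont_sum (n : nat) (c : nat -> R) (g : nat -> R -> R) : (forall j, bcont (g j)) ->
  bcont (fun t => \sum_(j < n) c j * g j t).
Proof.
move=> gb; elim: n => [|n IH].
  by rewrite (_ : (fun t => _) = fun=> 0); [exact: bcont_cst|apply/funext => t; rewrite big_ord0].
rewrite (_ : (fun t => _) = fun t => \sum_(j < n) c j * g j t + c n * g n t); last first.
  by apply/funext => t; rewrite big_ord_recr.
by apply: bcontD => //; exact: bcontZ.
Qed.

Lemma bplin_sum L (n : nat) (c : nat -> R) (g : nat -> R -> R) : bplin L ->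
  (forall j, bcont (g j)) ->
  L (fun t => \sum_(j < n) c j * g j t) = \sum_(j < n) c j * L (g j).
Proof.
move=> bL gb; elim: n => [|n IH].
  rewrite big_ord0 (_ : (fun t => _) = fun=> 0); first by rewrite bplin_cst// mul0r.
  by apply/funext => t; rewrite big_ord0.
rewrite (_ : (fun t => _) = fun t => \sum_(j < n) c j * g j t + c n * g n t); last first.
  by apply/funext => t; rewrite big_ord_recr.
rewrite bplinD ?bplinZ//; [by rewrite IH big_ord_recr|exact: bcont_sum|exact: bcontZ].
Qed.

(** A fine partition of unity by tent functions, up to a remainder of small
    mass; the tents are differences of consecutive translates of a ramp, so that
    their sum telescopes. *)
Lemma fine_partition L (d e : R) : pfun L -> 0 < d -> 0 < e ->
  exists n (g : nat -> R -> R) (p : nat -> R),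
    [/\ forall j, bcont (g j), forall j t, 0 <= g j t,
      forall j t, d < `|t - p j| -> g j t = 0,
      forall t, \sum_(j < n) g j t <= 1 &
      L (fun t => 1 - \sum_(j < n) g j t) <= e].
Proof.
move=> pL d0 e0.
pose g (K j : nat) (t : R) : R :=
  ramp (d^-1 * t + (K%:R + 1 - j%:R)) - ramp (d^-1 * t + (K%:R - j%:R)).
have tele K n t : \sum_(j < n) g K j t =
    ramp (d^-1 * t + (K%:R + 1)) - ramp (d^-1 * t + (K%:R + 1 - n%:R)).
  elim: n => [|n IH]; first by rewrite big_ord0 subr0 subrr.
  rewrite big_ord_recr/= IH /g addrA subrK (_ : K%:R + 1 - n.+1%:R = K%:R - n%:R)//.
  by rewrite -natr1; ring.
have gb K j : bcont (g K j) by apply: bcontB; exact: bcont_ramp.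
have sb K n : bcont (fun t => \sum_(j < n) g K j t).
  have -> : (fun t => \sum_(j < n) g K j t) = fun t => \sum_(j < n) 1 * g K j t.
    by apply/funext => t; apply: eq_bigr => j _; rewrite mul1r.
  exact: (@bcont_sum n (fun=> 1) (g K) (gb K)).
have sle1 K n t : \sum_(j < n) g K j t <= 1.
  by rewrite tele lerBlDr; apply: le_trans (ramp_le1 _) _; rewrite lerDl ramp_ge0.
have sge0 K n t : 0 <= \sum_(j < n) g K j t.
  by rewrite tele subr_ge0 ramp_homo// lerD2l lerBlDr lerDl.
pose rem K t := 1 - \sum_(j < K + K.+1) g K j t.
have remb K : bcont (rem K) by apply: bcontB => //; exact: bcont_cst.
have rem0 : L (rem n) @[n --> \oo] --> L (fun=> 0).
  apply: (bplin_cvg (pfun_bp pL) (K := 1)) => //; first exact: bcont_cst.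
    move=> n t; rewrite ger0_norm /rem ?subr_ge0 ?sle1//.
    by rewrite lerBlDr lerDl.
  move=> t; apply/cvgrPdist_le => e' e'0; near=> n.
  have nt : `|d^-1 * t| <= n%:R by near: n; exact: nbhs_infty_ger.
  move: nt; rewrite ler_norml => /andP[n1 n2].
  rewrite /rem tele (ramp_id1 (u := _ + (_ + 1))) ?(ramp_id0 (u := _ + (_ + 1 - _))).
  - by rewrite subr0 subrr subrr normr0 ltW.
  - by rewrite addnS -natr1 natrD; lra.
  - by lra.
have L0 : L (fun=> 0) = 0 by rewrite bplin_cst ?mul0r//; exact: pfun_bp.
rewrite L0 in rem0; move/cvgrPdist_le : rem0 => /(_ e e0)[K _ /(_ K (leqnn K))].
rewrite /= sub0r normrN => remK.
(* The points [(j - K) d] with [j <= 2 K] are symmetric about the origin. *)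
exists (K + K.+1)%N, (g K), (fun j => (j%:R - K%:R) * d); split => //.
- by move=> j t; rewrite subr_ge0 ramp_homo// lerD2l lerD2r lerDl.
- move=> j t dt.
  have {}dt : 1 < `|d^-1 * t + (K%:R - j%:R)|.
    have -> : d^-1 * t + (K%:R - j%:R) = d^-1 * (t - (j%:R - K%:R) * d).
      by rewrite mulrBr mulrCA mulVf ?gt_eqF// mulr1 opprB.
    by rewrite normrM gtr0_norm ?invr_gt0// ltr_pdivlMl// mulr1.
  move: dt; rewrite /g (_ : d^-1 * t + (K%:R + 1 - j%:R) = d^-1 * t + (K%:R - j%:R) + 1); last by ring.
  move: (_ + (_ - _)) => u; rewrite lter_normr => /orP[u1|u1].
    by rewrite !ramp_id1 ?subrr//; lra.
  by rewrite !ramp_id0 ?subrr//; lra.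
- exact: sle1.
- apply: le_trans remK; exact: ler_norm.
Unshelve. all: by end_near. Qed.

End partition.

(** * The functional of a Bessel kernel *)

Section bessel_functional.
Context {R : realType}.
Local Notation mu := (@lebesgue_measure R).
Implicit Types (f g : R -> R).
Local Notation integrable f := (mu.-integrable setT (EFin \o f)).

(** Convolution with a density at the origin. *)
Definition densF g f : R := \int[mu]_t (f (- t) * g t).

Lemma densF_integrable g f : integrable g -> bcont f -> integrable (fun t => f (- t) * g t).
Proof.
move=> gi fb; have [cf [K fK]] := bcont_opp fb.
rewrite (_ : (fun t => f (- t) * g t) = fun t => g t * f (- t)); last first.
  by apply/funext => t; rewrite mulrC.
by apply: (integrable_mul_bounded (K := K) gi) => //; exact: continuous_measurable_fun.
Qed.

Lemma bplin_densF g : integrable g -> bplin (densF g).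
Proof.
move=> gi; split.
- move=> f1 f2 b1 b2; rewrite /densF -RintegralD//; try exact: densF_integrable.
  by apply: eq_Rintegral => t _; rewrite mulrDl.
- move=> a f fb; rewrite /densF -RintegralZl//; last exact: densF_integrable.
  by apply: eq_Rintegral => t _; rewrite mulrA.
- move=> u f K ub fb uK uf.
  apply: (@Rintegral_dominated_cvg _ (fun n t => u n (- t) * g t) _ (fun t => `|g t| * K)).
  + move=> n; have := measurable_int mu (densF_integrable gi (ub n)).
    by move/measurable_EFinP.
  + exact: (integrableZr measurableT K (integrable_norm gi)).
  + by move=> n t; rewrite normrM mulrC ler_wpM2l.
  + by move=> t; apply: cvgM; [exact: uf|exact: cvg_cst].
Qed.

Definition bpot s (m : nat) : (R -> R) -> R := iter m (comp (besF s 1)) (@dirac0 R).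

Lemma pfun_bpot s m : 0 < s < 1 -> pfun (bpot s m).
Proof.
move=> s01; elim: m => [|m IH]; first exact: pfun_dirac0.
by apply: pfun_comp => //; exact: pfun_besF.
Qed.

Lemma conv_bpotS s m f : conv (bpot s m.+1) f = conv (besF s 1) (conv (bpot s m) f).
Proof. by rewrite /bpot iterS conv_comp. Qed.

Lemma symb_bpot s m w : 0 < s < 1 -> symb (bpot s m) w = (1 + w ^+ 2) `^ (- (s * m%:R)).
Proof.
move=> s01; elim: m => [|m IH].
  by rewrite symb_dirac0 mulr0 oppr0 powRr0.
have w1 : 0 < 1 + w ^+ 2 by rewrite ltr_pwDl// sqr_ge0.
rewrite [bpot s m.+1]/(comp (besF s 1) (bpot s m)) symb_comp//; [|exact: pfun_besF|exact: pfun_bpot].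
rewrite IH symb_besF// mulr1 -powRD; last by apply/implyP => _; rewrite gt_eqF.
by congr (_ `^ _); rewrite -natr1; ring.
Qed.

End bessel_functional.

Section bessel_kernel.
Context {R : realType}.
Local Notation mu := (@lebesgue_measure R).
Local Notation integrable f := (mu.-integrable setT (EFin \o f)).
Variables (r s : R) (m : nat) (G : R -> R[i]).
Hypothesis s01 : 0 < s < 1.
Hypothesis rsm : r = 2 * s * m%:R.
Hypothesis hG : is_bessel_kernel r G.

Let G1 t := complex.Re (G t).
Let G2 t := complex.Im (G t).

Let i1 : integrable G1. Proof. by case: hG => -[]. Qed.
Let i2 : integrable G2. Proof. by case: hG => -[]. Qed.

Let fourier_parts (a : R) : 
  densF G1 (fun t => cos (a * t)) - densF G2 (fun t => sin (a * t)) =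
    (1 + a ^+ 2) `^ (- (s * m%:R)) /\
  densF G1 (fun t => sin (a * t)) + densF G2 (fun t => cos (a * t)) = 0.
Proof.
pose w := a / (2 * pi); have p0 : 2 * pi != 0 :> R by rewrite mulf_neq0// gt_eqF ?pi_gt0.
have wa : 2 * pi * w = a by rewrite /w mulrC divfK.
case: hG => _ /(_ w); rewrite /fourier /cintegral => -[]; rewrite wa.
rewrite (_ : r / 2 = s * m%:R); last by rewrite rsm; field.
rewrite real_normK ?num_real// => hre him; split.
  rewrite -hre /densF -RintegralB//; [|exact: (densF_integrable i1 (bcont_cos a))|exact: (densF_integrable i2 (bcont_sin a))].
  apply: eq_Rintegral => t _; rewrite /expi /G1 /G2; case: (G t) => x y /=.
  by rewrite mulrN cosN sinN; ring.
rewrite -him /densF -RintegralD//; [|exact: (densF_integrable i1 (bcont_sin a))|exact: (densF_integrable i2 (bcont_cos a))].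
apply: eq_Rintegral => t _; rewrite /expi /G1 /G2; case: (G t) => x y /=.
by rewrite mulrN cosN sinN; ring.
Qed.

Let densF_cosN (a : R) (g : R -> R) :
  densF g (fun t => cos (- a * t)) = densF g (fun t => cos (a * t)).
Proof. by congr densF; apply/funext => t; rewrite mulNr cosN. Qed.

Let densF_sinN (a : R) (g : R -> R) : integrable g ->
  densF g (fun t => sin (- a * t)) = - densF g (fun t => sin (a * t)).
Proof.
move=> gi; rewrite -(bplinN (bplin_densF gi) (bcont_sin a)).
by congr densF; apply/funext => t; rewrite mulNr sinN.
Qed.

Let cos_sin_parts (a : R) :
  [/\ densF G1 (fun t => cos (a * t)) = (1 + a ^+ 2) `^ (- (s * m%:R)),
      densF G1 (fun t => sin (a * t)) = 0,
      densF G2 (fun t => cos (a * t)) = 0 & densF G2 (fun t => sin (a * t)) = 0].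
Proof.
have [e1 e2] := fourier_parts a; have := fourier_parts (- a).
rewrite !densF_cosN (densF_sinN a i1) (densF_sinN a i2) sqrrN.
move: e1 e2; move: (densF _ _) (densF _ _) (densF _ _) (densF _ _) (_ `^ _) => a1 a2 a3 a4 M e1 e2 [e3 e4].
by split; lra.
Qed.

Lemma densF_kernel_Re f : bcont f -> densF G1 f = bpot s m f.
Proof.
have pb := pfun_bpot m s01.
apply: bplin_unique; [exact: bplin_densF|exact: pfun_bp| |].
  by move=> w; have [-> _ _ _] := cos_sin_parts w; rewrite -symb_bpot.
by move=> w; have [_ -> _ _] := cos_sin_parts w; rewrite pfun_sin.
Qed.

Lemma densF_kernel_Im f : bcont f -> densF G2 f = 0.
Proof.
move=> fb; apply: (@bplin_eq0 R _ (bplin_densF i2)) => // w.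
  by have [_ _ -> _] := cos_sin_parts w.
by have [_ _ _ ->] := cos_sin_parts w.
Qed.

(** The transforms at [w] and [- w] separate the parts of the kernel: the real part acts
    as [bpot s m] and the imaginary part as zero. *)
Lemma cintegral_kernel (p : R -> R[i]) :
  bcont (fun t => complex.Re (p t)) -> bcont (fun t => complex.Im (p t)) ->
  cintegral (fun t => p (- t) * G t) =
  (bpot s m (fun t => complex.Re (p t)) +i* bpot s m (fun t => complex.Im (p t)))%C.
Proof.
move=> b1 b2; rewrite /cintegral; congr (_ +i* _)%C.
  rewrite -(densF_kernel_Re b1).
  rewrite (_ : (fun t => complex.Re (p (- t) * G t)) =
    fun t => complex.Re (p (- t)) * G1 t - complex.Im (p (- t)) * G2 t); last first.
    by apply/funext => t; rewrite /G1 /G2; case: (G t) (p (- t)) => x y [x' y'].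
  rewrite (RintegralB measurableT (densF_integrable i1 b1) (densF_integrable i2 b2)).
  by have := densF_kernel_Im b2; rewrite /densF => ->; rewrite subr0.
rewrite -(densF_kernel_Re b2).
rewrite (_ : (fun t => complex.Im (p (- t) * G t)) =
  fun t => complex.Im (p (- t)) * G1 t + complex.Re (p (- t)) * G2 t); last first.
  apply/funext => t; rewrite /G1 /G2; case: (G t) (p (- t)) => x y [x' y'] /=.
  by rewrite addrC.
rewrite (RintegralD measurableT (densF_integrable i1 b2) (densF_integrable i2 b1)).
by have := densF_kernel_Im b1; rewrite /densF => ->; rewrite addr0.
Qed.

End bessel_kernel.

(** * Orbits, and the isometric norm *)

Section group_action.
Context {R : realType} {A : banachAlgType R[i]}.
Variables (F : set (A -> R[i]^o)) (psi : R -> {lrmorphism alg A -> alg A}).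
Hypothesis hpsi : Cw_group F psi.
Local Open Scope complex_scope.
Implicit Types (x y z : alg A) (phi : A -> R[i]^o) (s t h : R).

Lemma opnorm_bound (V W : normedModType R[i]) (f : V -> W) (K : R) :
  (forall (a : R) v, f (a%:C *: v) = a%:C *: f v) -> (opnorm f <= K%:E)%E ->
  forall v, nrm (f v) <= K * nrm v.
Proof.
move=> fZ fK v.
have le1 w : nrm w <= 1 -> nrm (f w) <= K.
  move=> w1; rewrite -lee_fin; apply: le_trans fK; apply: ereal_sup_ubound.
  by exists w.
have [v0|v0] := eqVneq (nrm v) 0.
  have f0 : f 0 = 0 by have := fZ 0 0; rewrite scaler0 => ->; exact: scale0r.
  by rewrite v0 mulr0 (nrm_eq0 v0) f0 nrm0.
have vp : 0 < nrm v by rewrite lt_neqAle eq_sym v0 nrm_ge0.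
have /le1 : nrm ((nrm v)^-1%:C *: v) <= 1.
  by rewrite nrmZr ger0_norm ?invr_ge0 ?nrm_ge0// mulVf.
by rewrite fZ nrmZr ger0_norm ?invr_ge0 ?nrm_ge0// ler_pdivrMl// mulrC.
Qed.

(** The norm of [A], read on the ring [alg A]. *)
Definition an (x : alg A) : R := nrm (x : A).
(** Multiplication by real scalars, which commutes with taking real orbits. *)
Definition rs (a : R) (x : alg A) : alg A := (a%:C : R[i]) *: x.

Lemma an_ge0 x : 0 <= an x. Proof. exact: (@nrm_ge0 R A). Qed.
Lemma anD x y : an (x + y) <= an x + an y. Proof. exact: (@nrmD R A x y). Qed.
Lemma anN x : an (- x) = an x. Proof. exact: (@nrmN R A x). Qed.
Lemma an0 : an 0 = 0. Proof. exact: (@nrm0 R A). Qed.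
Lemma anZ a x : an (rs a x) = `|a| * an x. Proof. exact: (@nrmZr R A a x). Qed.
Lemma an_eq0 x : an x = 0 -> x = 0. Proof. exact: (@nrm_eq0 R A x). Qed.
Lemma anM x y : an (x * y) <= an x * an y.
Proof. by rewrite -lecR rmorphM/= -!(@nrmE R A); exact: (@bnormM_le _ A x y). Qed.

Lemma rsDr a x y : rs a (x + y) = rs a x + rs a y. Proof. exact: scalerDr. Qed.
Lemma rsDl a b x : rs (a + b) x = rs a x + rs b x.
Proof. by rewrite /rs rmorphD/= scalerDl. Qed.
Lemma rsA a b x : rs a (rs b x) = rs (a * b) x.
Proof. by rewrite /rs rmorphM/= scalerA. Qed.
Lemma rs1 x : rs 1 x = x. Proof. exact: scale1r. Qed.
Lemma rs0 x : rs 0 x = 0. Proof. exact: scale0r. Qed.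
Lemma rsN x : rs (-1) x = - x. Proof. by rewrite /rs rmorphN/= scaleNr scale1r. Qed.
Lemma rsAl a x y : rs a x * y = rs a (x * y). Proof. by rewrite /rs -scalerAl. Qed.
Lemma rsAr a x y : x * rs a y = rs a (x * y). Proof. by rewrite /rs -scalerAr. Qed.

Lemma psiD t x y : psi t (x + y) = psi t x + psi t y. Proof. exact: raddfD. Qed.
Lemma psiB t x y : psi t (x - y) = psi t x - psi t y. Proof. exact: raddfB. Qed.
Lemma psiM t x y : psi t (x * y) = psi t x * psi t y. Proof. exact: rmorphM. Qed.
Lemma psi1 t : psi t 1 = 1. Proof. exact: rmorph1. Qed.
Lemma psi_rs t a x : psi t (rs a x) = rs a (psi t x). Proof. exact: linearZ. Qed.

Let psiG : automorphism_group psi. Proof. by case: hpsi. Qed.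
Let nF : norm_closed_subspace F. Proof. by case: hpsi => _ []. Qed.

Lemma psi_psi s t x : psi s (psi t x) = psi (s + t) x.
Proof. by case: psiG. Qed.

Lemma psi0 x : psi 0 x = x.
Proof.
case: psiG => /(_ 0) /bij_inj inj pp _; apply: inj.
by rewrite pp addr0.
Qed.

Lemma psi_bound : exists M : R, 0 <= M /\ forall t x, an (psi t x) <= M * an x.
Proof.
case: psiG => _ _ Soo; set S := ereal_sup _ in Soo.
have Sle t : (opnorm (psi t : A -> A) <= S)%E by apply: ereal_sup_ubound; exists t.
have S0 : (0 <= S)%E.
  apply: le_trans (Sle 0); apply: ereal_sup_ubound; exists 0 => /=.
    by rewrite nrm0.
  by congr (_%:E); have := @raddf0 _ _ (psi 0) => ->; exact: an0.
have Sfin : S \is a fin_num by rewrite ge0_fin_numE.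
exists (fine S); split; first exact: fine_ge0.
move=> t x; apply: (@opnorm_bound A A (psi t)); last by rewrite fineK.
by move=> a v; exact: psi_rs.
Qed.

Definition F1 phi := F phi /\ forall x, nrm (phi x) <= an x.

Lemma FD phi x y : F phi -> phi (x + y) = phi x + phi y.
Proof. by move=> Fp; have := F_linear nF Fp 1 x y; rewrite !scale1r. Qed.

Lemma F0 phi : F phi -> phi 0 = 0.
Proof. by move=> Fp; have := FD 0 0 Fp; rewrite addr0 => /eqP; rewrite -subr_eq subrr => /eqP <-. Qed.

Lemma FZ phi (c : R[i]) x : F phi -> phi (c *: x) = c * phi x.
Proof. by move=> Fp; have := F_linear nF Fp c x 0; rewrite addr0 F0// addr0. Qed.

Lemma FN phi x : F phi -> phi (- x) = - phi x.
Proof. by move=> Fp; rewrite -scaleN1r FZ// mulN1r. Qed.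

Lemma norming_le x (c : R) : (forall phi, F1 phi -> complex.Re (phi x) <= c) -> an x <= c.
Proof.
move=> H; case: hpsi => _ [_ nrmF _ _ _]; rewrite -lee_fin (nrmF x).
apply: ge_ereal_sup => _ [phi [Fp p1] <-]; rewrite lee_fin.
have pb v : nrm (phi v) <= an v.
  by rewrite -[an v]mul1r; apply: opnorm_bound => // a w; rewrite FZ.
have [p0|p0] := eqVneq (phi x) 0.
  by rewrite p0 nrm0; have := H phi (conj Fp pb); rewrite p0.
pose u : R[i] := `|phi x : R[i]| / phi x.
have u1 : cabs u = 1.
  rewrite /cabs /u normrM normr_id normfV mulfV ?normr_eq0//.
pose ps a : R[i]^o := u * phi a + 0.
have Fps : F ps by apply: (F_comb nF) => //; case: nF.
have /H : F1 ps.
  split => // v; rewrite /ps addr0; apply: le_trans (pb v).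
  by rewrite (_ : u * phi v = u *: phi v)// nrmZ u1 mul1r.
by rewrite /ps addr0 /u divfK.
Qed.

(** Each [psi t] is continuous for the weak topology, whose dual is [F]. *)
Lemma F_psi phi t : F phi -> F (fun x => phi (psi t x)).
Proof.
move=> Fp; apply: (sigma_dual nF).
  move=> k x y; rewrite (_ : psi t (k *: x + y) = k *: psi t x + psi t y); first exact: (F_linear nF Fp).
  exact: linearP.
case: hpsi => _ [_ _ _ ct _].
apply: (continuous_comp (f := psi t : sigma_top F -> sigma_top F)); first exact: ct.
exact: sigma_continuous.
Qed.

(** Scalar orbits: all the analysis takes place on these functions. *)
Definition fn phi x t : R := complex.Re (phi (psi t x)).

Lemma continuous_F_orbit phi x : F phi -> continuous (fun t : R => phi (psi t x)).
Proof.
move=> Fp t; case: hpsi => _ [_ _ _ _ co].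
apply: (continuous_comp (f := fun t : R => psi t x : sigma_top F)); first exact: co.
exact: sigma_continuous.
Qed.

Lemma fnD phi x y : F phi -> fn phi (x + y) = fun t => fn phi x t + fn phi y t.
Proof. by move=> Fp; apply/funext => t; rewrite /fn psiD FD// raddfD. Qed.

Lemma fnB phi x y : F phi -> fn phi (x - y) = fun t => fn phi x t - fn phi y t.
Proof. by move=> Fp; apply/funext => t; rewrite /fn psiB FD// FN// raddfB. Qed.

Lemma fnZ phi a x : F phi -> fn phi (rs a x) = fun t => a * fn phi x t.
Proof.
by move=> Fp; apply/funext => t; rewrite /fn psi_rs FZ//; case: (phi _) => c d /=; rewrite mul0r subr0.
Qed.

Lemma fn_psi phi x s : fn phi (psi s x) = fun t => fn phi x (s + t).
Proof. by apply/funext => t; rewrite /fn psi_psi addrC. Qed.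

(** An equivalent algebra norm for which the group is isometric; isometry is what makes
    averages over the group contractions. *)
Definition pn x : R := sup [set an (psi t x) | t in [set: R]].

Let pn_has_sup x : has_sup [set an (psi t x) | t in [set: R]].
Proof.
split; first by exists (an (psi 0 x)), 0.
by have [M [M0 HM]] := psi_bound; exists (M * an x) => _ [t _ <-].
Qed.

Lemma pn_ub x t : an (psi t x) <= pn x.
Proof. by apply: ub_le_sup; [case: (pn_has_sup x)|exists t]. Qed.

Lemma pn_le x c : (forall t, an (psi t x) <= c) -> pn x <= c.
Proof. by move=> H; apply: ge_sup; [case: (pn_has_sup x)|move=> _ [t _ <-]]. Qed.

Lemma an_le_pn x : an x <= pn x. Proof. by rewrite -{1}(psi0 x) pn_ub. Qed.
Lemma pn_ge0 x : 0 <= pn x. Proof. exact: le_trans (an_ge0 x) (an_le_pn x). Qed.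

Lemma pn_psi x t : pn (psi t x) = pn x.
Proof.
apply/eqP; rewrite eq_le; apply/andP; split; apply: pn_le => s.
  by rewrite psi_psi pn_ub.
by rewrite -(subrK t s) -psi_psi pn_ub.
Qed.

Lemma pnD x y : pn (x + y) <= pn x + pn y.
Proof. by apply: pn_le => t; rewrite psiD (le_trans (anD _ _))// lerD// pn_ub. Qed.
Lemma pnN x : pn (- x) = pn x.
Proof. by congr sup; apply: eq_imagel => t _; rewrite raddfN anN. Qed.
Lemma pnB x y : pn (x - y) <= pn x + pn y.
Proof. by rewrite -[pn y]pnN pnD. Qed.
Lemma pnBC x y : pn (x - y) = pn (y - x). Proof. by rewrite -pnN opprB. Qed.
Lemma pn0 : pn 0 = 0.
Proof.
apply/eqP; rewrite eq_le pn_ge0 andbT; apply: pn_le => t.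
by rewrite raddf0 an0.
Qed.
Lemma pnM x y : pn (x * y) <= pn x * pn y.
Proof.
apply: pn_le => t; rewrite psiM (le_trans (anM _ _))//.
by apply: ler_pM; rewrite ?an_ge0 ?pn_ub.
Qed.
Lemma pnZ a x : pn (rs a x) <= `|a| * pn x.
Proof. by apply: pn_le => t; rewrite psi_rs anZ ler_wpM2l// pn_ub. Qed.

Lemma pn_eq0 x : pn x <= 0 -> x = 0.
Proof.
move=> x0; apply: an_eq0; apply/eqP; rewrite eq_le an_ge0 andbT.
exact: le_trans (an_le_pn x) x0.
Qed.

Lemma fn_le phi x t : F1 phi -> `|fn phi x t| <= pn x.
Proof.
by move=> [_ p1]; rewrite (le_trans (normRe_le _))// (le_trans (p1 _))// pn_ub.
Qed.

Lemma fn_bcont phi x : F1 phi -> bcont (fn phi x).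
Proof.
move=> p1; split; last by exists (pn x) => t; exact: fn_le.
move=> t; apply: (continuous_comp (f := fun t : R => phi (psi t x))).
  by apply: continuous_F_orbit; case: p1.
exact: Re_continuous.
Qed.

Lemma pn_dual x c : (forall phi t, F1 phi -> fn phi x t <= c) -> pn x <= c.
Proof. by move=> H; apply: pn_le => t; apply: norming_le => phi p1; exact: H. Qed.

Lemma pn_inj x y : (forall phi, F1 phi -> fn phi x =1 fn phi y) -> x = y.
Proof.
move=> H; apply/eqP; rewrite -subr_eq0; apply/eqP/pn_eq0; apply: pn_dual => phi t p1.
by rewrite fnB ?H ?subrr//; case: p1.
Qed.

(** Norm-continuous vectors: for these, integrals of orbits are limits in norm of
    Riemann sums. *)
Definition ncont x := forall e, 0 < e -> exists2 d, 0 < d &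
  forall t, `|t| <= d -> pn (psi t x - x) <= e.

Lemma ncontD x y : ncont x -> ncont y -> ncont (x + y).
Proof.
move=> cx cy e e0; have e2 : 0 < e / 2 by rewrite divr_gt0.
have [d d0 dx] := cx _ e2; have [d' d'0 dy] := cy _ e2.
exists (Num.min d d'); first by rewrite lt_min d0.
move=> t; rewrite le_min => /andP[td td']; rewrite psiD opprD addrACA [leRHS]splitr.
by rewrite (le_trans (pnD _ _))// lerD ?dx ?dy.
Qed.

Lemma ncontZ a x : ncont x -> ncont (rs a x).
Proof.
move=> cx e e0; have a0 : 0 < `|a| + 1 by rewrite ltr_wpDl.
have [d d0 dx] := cx _ (divr_gt0 e0 a0); exists d => // t td.
rewrite psi_rs -rsN rsA [-1 * a]mulrC -rsA rsN -rsDr (le_trans (pnZ _ _))//.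
apply: (@le_trans _ _ ((`|a| + 1) * (e / (`|a| + 1)))).
  by apply: ler_pM => //; [exact: pn_ge0|rewrite lerDl|exact: dx].
by rewrite mulrC divfK// gt_eqF.
Qed.

Lemma ncontN x : ncont x -> ncont (- x). Proof. by rewrite -rsN; exact: ncontZ. Qed.

Lemma ncontB x y : ncont x -> ncont y -> ncont (x - y).
Proof. by move=> cx cy; apply: ncontD => //; exact: ncontN. Qed.

Lemma ncont_psi x t : ncont x -> ncont (psi t x).
Proof.
move=> cx e /cx[d d0 dx]; exists d => // s sd.
by rewrite psi_psi [s + t]addrC -psi_psi -psiB pn_psi dx.
Qed.

Lemma ncontM x y : ncont x -> ncont y -> ncont (x * y).
Proof.
move=> cx cy e e0; pose K := pn x + pn y + 1.
have K0 : 0 < K by rewrite ltr_wpDl// addr_ge0// pn_ge0.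
have eK : 0 < e / K by rewrite divr_gt0.
have [d d0 dx] := cx _ eK; have [d' d'0 dy] := cy _ eK.
exists (Num.min d d'); first by rewrite lt_min d0.
move=> t; rewrite le_min => /andP[td td'].
have -> : psi t (x * y) - x * y = psi t x * (psi t y - y) + (psi t x - x) * y.
  by rewrite psiM mulrBr mulrBl addrA subrK.
rewrite (le_trans (pnD _ _))//.
have h1 : pn (psi t x * (psi t y - y)) <= pn x * (e / K).
  by rewrite (le_trans (pnM _ _))// pn_psi ler_wpM2l ?pn_ge0 ?dy.
have h2 : pn ((psi t x - x) * y) <= pn y * (e / K).
  by rewrite (le_trans (pnM _ _))// mulrC ler_wpM2l ?pn_ge0 ?dx.
apply: le_trans (lerD h1 h2) _; rewrite -mulrDl.
apply: (@le_trans _ _ (K * (e / K))); last by rewrite mulrC divfK// gt_eqF.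
by apply: ler_wpM2r; [exact: ltW|rewrite lerDl].
Qed.

Lemma ncont_lim x : (forall e, 0 < e -> exists2 y, ncont y & pn (x - y) <= e) -> ncont x.
Proof.
move=> H e e0; have e3 : 0 < e / 3 by rewrite divr_gt0.
have [y cy xy] := H _ e3; have [d d0 dy] := cy _ e3; exists d => // t /dy yt.
have -> : psi t x - x = psi t (x - y) + (psi t y - y) - (x - y).
  by rewrite psiB opprB addrA -[_ + _ + y]addrA !subrK.
have h1 := pnB (psi t (x - y) + (psi t y - y)) (x - y).
have h2 := pnD (psi t (x - y)) (psi t y - y); rewrite pn_psi in h2.
move: (pn _) (pn _) (pn _) (pn _) h1 h2 xy yt => a b c d'; lra.
Qed.

Lemma ncont0 : ncont 0.
Proof. by move=> e e0; exists 1 => // t _; rewrite raddf0 subrr pn0 ltW. Qed.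

Lemma ncont1 : ncont 1.
Proof. by move=> e e0; exists 1 => // t _; rewrite psi1 subrr pn0 ltW. Qed.

(** Bounded real functionals on the norm-continuous vectors. Besides the real
    parts of elements of the dual they comprise composites with multiplications and with
    [frac N], which need not be weakly continuous. *)
Record cfun (l : alg A -> R) (K : R) : Prop := CFun {
  cfunD : forall x y, ncont x -> ncont y -> l (x + y) = l x + l y;
  cfunZ : forall a x, ncont x -> l (rs a x) = a * l x;
  cfun_le : forall x, ncont x -> `|l x| <= K * pn x }.

Lemma cfun_fn phi t : F1 phi -> cfun (fun x => fn phi x t) 1.
Proof.
move=> p1; have Fp : F phi by case: p1.
split; [by move=> x y _ _; rewrite fnD|by move=> a x _; rewrite fnZ|].
by move=> x _; rewrite mul1r fn_le.
Qed.

Lemma cfunB l K x y : cfun l K -> ncont x -> ncont y -> l (x - y) = l x - l y.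
Proof.
move=> cl cx cy; rewrite -rsN (cfunD cl)//; last exact: ncontZ.
by rewrite (cfunZ cl)// mulN1r.
Qed.

Lemma cfun_mulr l K y : 0 <= K -> cfun l K -> ncont y -> cfun (fun x => l (x * y)) (K * pn y).
Proof.
move=> K0 cl cy; split.
- by move=> x x' cx cx'; rewrite mulrDl (cfunD cl)//; exact: ncontM.
- by move=> a x cx; rewrite rsAl (cfunZ cl)//; exact: ncontM.
- move=> x cx; apply: le_trans (cfun_le cl (ncontM cx cy)) _.
  by rewrite -mulrA ler_wpM2l// (le_trans (pnM _ _))// mulrC.
Qed.

Lemma cfun_mull l K y : 0 <= K -> cfun l K -> ncont y -> cfun (fun x => l (y * x)) (K * pn y).
Proof.
move=> K0 cl cy; split.
- by move=> x x' cx cx'; rewrite mulrDr (cfunD cl)//; exact: ncontM.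
- by move=> a x cx; rewrite rsAr (cfunZ cl)//; exact: ncontM.
- move=> x cx; apply: le_trans (cfun_le cl (ncontM cy cx)) _.
  by rewrite -mulrA ler_wpM2l// pnM.
Qed.

Lemma cfun_orbit_bcont l K x : 0 <= K -> cfun l K -> ncont x -> bcont (fun h => l (psi h x)).
Proof.
move=> K0 cl cx; split; last first.
  by exists (K * pn x) => h; rewrite -(pn_psi x h); apply: cfun_le => //; exact: ncont_psi.
move=> h; apply/cvgrPdist_le => e e0.
have K1 : 0 < K + 1 by rewrite ltr_wpDl.
have [d d0 dx] := cx _ (divr_gt0 e0 K1).
apply/nbhs_ballP; exists d => //= h' hh'.
have ch := ncont_psi h cx; have ch' := ncont_psi h' cx.
rewrite -(cfunB cl)// (le_trans (cfun_le cl _))//; first exact: ncontB.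
have -> : psi h x - psi h' x = psi h' (psi (h - h') x - x).
  by rewrite psiB psi_psi [h' + _]addrC subrK.
rewrite pn_psi; apply: (@le_trans _ _ ((K + 1) * (e / (K + 1)))).
  apply: ler_pM => //; [exact: pn_ge0|by rewrite lerDl|].
  by apply: dx; rewrite ltW.
by rewrite mulrC divfK// gt_eqF.
Qed.

Implicit Types (L : (R -> R) -> R) (f g : R -> R) (l : alg A -> R) (K : R).

(** * Integrals of orbits *)

Lemma pn_complete (u : nat -> alg A) :
  (forall e : R, 0 < e -> exists N, forall n m, (N <= n)%N -> (N <= m)%N ->
     pn (u n - u m) <= e) ->
  exists z : alg A, forall e : R, 0 < e -> exists N, forall n, (N <= n)%N -> pn (z - u n) <= e.
Proof.
move=> H; have [|z Hz] := @nrm_complete R A u.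
  move=> e /H[N HN]; exists N => n m Nn Nm; apply: le_trans (HN _ _ Nn Nm).
  exact: an_le_pn.
have [M [M0 HM]] := psi_bound.
exists z => e e0; have M1 : 0 < M + 1 by rewrite ltr_wpDl.
have [N HN] := Hz _ (divr_gt0 e0 M1); exists N => n /HN zn.
apply: pn_le => t; apply: le_trans (HM t _) _.
apply: (@le_trans _ _ ((M + 1) * (e / (M + 1)))); last by rewrite mulrC divfK// gt_eqF.
by apply: ler_pM => //; [exact: an_ge0|rewrite lerDl].
Qed.

Lemma ncont_sum (n : nat) (c : nat -> R) (v : nat -> alg A) : (forall j, ncont (v j)) ->
  ncont (\sum_(j < n) rs (c j) (v j)).
Proof.
move=> cv; elim/big_ind: _ => [|x y|j _]; [exact: ncont0|exact: ncontD|exact: ncontZ].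
Qed.

Lemma cfun_sum l K (n : nat) (c : nat -> R) (v : nat -> alg A) : cfun l K ->
  (forall j, ncont (v j)) ->
  l (\sum_(j < n) rs (c j) (v j)) = \sum_(j < n) c j * l (v j).
Proof.
move=> cl cv; elim: n => [|n IH].
  by rewrite !big_ord0 -(rs0 0) (cfunZ cl) ?mul0r//; exact: ncont0.
by rewrite !big_ord_recr/= (cfunD cl) ?(cfunZ cl) ?IH//; [exact: ncont_sum|exact: ncontZ].
Qed.

(** Riemann sums over a fine partition of unity; the error is uniform in [l] since the
    orbit is continuous in norm. *)
Lemma act_approx L x e : pfun L -> ncont x -> 0 < e ->
  exists2 z, ncont z & forall l K, 0 <= K -> cfun l K ->
    `|l z - L (fun h => l (psi h x))| <= K * e.
Proof.
move=> pL cx e0; pose P := pn x + 1; have P0 : 0 < P by rewrite ltr_wpDl// pn_ge0.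
have e2 : 0 < e / 2 by rewrite divr_gt0.
have [d d0 dx] := cx _ e2.
have [n [g [p [gb g0 gp g1 gL]]]] := fine_partition pL d0 (divr_gt0 e2 P0).
have cp j : ncont (psi (p j) x) by exact: ncont_psi.
exists (\sum_(j < n) rs (L (g j)) (psi (p j) x)); first exact: (ncont_sum n (fun j => L (g j)) cp).
move=> l K K0 cl; rewrite (cfun_sum n (fun j => L (g j)) cl cp).
have lb : bcont (fun h => l (psi h x)) by exact: (cfun_orbit_bcont K0 cl cx).
pose S h := \sum_(j < n) l (psi (p j) x) * g j h.
have Sb : bcont S by exact: (@bcont_sum _ n (fun j => l (psi (p j) x))).
have -> : \sum_(j < n) L (g j) * l (psi (p j) x) = L S.
  by rewrite /S (@bplin_sum _ L n (fun j => l (psi (p j) x)) g (pfun_bp pL) gb); apply: eq_bigr => j _; rewrite mulrC.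
pose T h := \sum_(j < n) g j h.
have Tb : bcont T.
  rewrite (_ : T = fun t => \sum_(j < n) 1 * g j t); first exact: (@bcont_sum _ n (fun=> 1)).
  by apply/funext => t; apply: eq_bigr => j _; rewrite mul1r.
have rb : bcont (fun h => 1 - T h) by apply: bcontB => //; exact: bcont_cst.
have key h : `|S h - l (psi h x)| <= K * P * (1 - T h) + K * (e / 2).
  have -> : S h - l (psi h x) =
      \sum_(j < n) (l (psi (p j) x) - l (psi h x)) * g j h - l (psi h x) * (1 - T h).
    rewrite (eq_bigr (fun j : 'I_n => l (psi (p j) x) * g j h - l (psi h x) * g j h)); last first.
      by move=> j _; rewrite mulrBl.
    by rewrite sumrB -mulr_sumr -/(T h) -/(S h); ring.
  rewrite (le_trans (ler_normB _ _))// addrC; apply: lerD.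
    rewrite normrM (ger0_norm (x := 1 - T h)) ?subr_ge0//; last exact: g1.
    apply: ler_wpM2r; first by rewrite subr_ge0; exact: g1.
    apply: le_trans (cfun_le cl (ncont_psi h cx)) _; apply: ler_wpM2l => //.
    by rewrite pn_psi lerDl.
  apply: (@le_trans _ _ (\sum_(j < n) K * (e / 2) * g j h)); last first.
    by rewrite -mulr_sumr; apply: ler_piMr; [rewrite mulr_ge0// ltW|exact: g1].
  apply: le_trans (ler_norm_sum _ _ _) _; apply: ler_sum => j _.
  have [hd|hd] := leP `|h - p j| d; last by rewrite !gp// !mulr0 normr0.
  rewrite normrM (ger0_norm (g0 _ _)); apply: ler_wpM2r => //.
  rewrite -(cfunB cl)//; last exact: ncont_psi.
  apply: le_trans (cfun_le cl _) _; first by apply: ncontB => //; exact: ncont_psi.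
  apply: ler_wpM2l => //; rewrite (pnBC).
  have -> : psi h x - psi (p j) x = psi (p j) (psi (h - p j) x - x).
    by rewrite psiB psi_psi [p j + _]addrC subrK.
  by rewrite pn_psi// dx.
rewrite -bplinB//; last exact: pfun_bp.
have fb : bcont (fun h => K * P * (1 - T h) + K * (e / 2)).
  by apply: bcontD; [exact: bcontZ|exact: bcont_cst].
apply: le_trans (pfun_norm_le pL _ fb key) _; first exact: bcontB.
rewrite (bplinD pL)//; [|exact: bcontZ|exact: bcont_cst].
rewrite (bplinZ pL)// (bplin_cst _ pL).
have KP : 0 <= K * P by rewrite mulr_ge0// ltW.
have h1 := ler_wpM2l KP gL.
have h2 : K * (e / 2) * L (fun=> 1) <= K * (e / 2).
  by rewrite ler_piMr ?(pfun_mass pL)// mulr_ge0// ltW.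
apply: le_trans (lerD h1 h2) _.
by rewrite -mulrA (mulrC P) divfK ?gt_eqF// -mulrDr -splitr.
Qed.

Lemma act_ex L x : pfun L -> ncont x ->
  exists2 z, ncont z & forall l K, 0 <= K -> cfun l K -> l z = L (fun h => l (psi h x)).
Proof.
move=> pL cx; pose e (n : nat) : R := n.+1%:R^-1.
have e0 n : 0 < e n by rewrite invr_gt0.
have [u /all_and2[uc uE]] := choice (fun n => let: ex_intro2 z a b := act_approx pL cx (e0 n) in
  ex_intro (fun z => ncont z /\ forall l K, 0 <= K -> cfun l K ->
    `|l z - L (fun h => l (psi h x))| <= K * e n) z (conj a b)).
have small d : 0 < d -> exists N, forall n, (N <= n)%N -> e n <= d.
  move=> d0; exists (Num.truncn d^-1) => n Nn; rewrite /e invf_ple ?posrE// ltW//.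
  by apply: lt_le_trans (truncnS_gt _) _; rewrite ler_nat.
have [|z Hz] := @pn_complete u.
  move=> d d0; have [N HN] := small _ (divr_gt0 d0 (ltr0n R 2)).
  exists N => n m /HN en /HN em; apply: pn_dual => phi t p1.
  have cl := cfun_fn t p1.
  rewrite (cfunB cl)//; have := uE n _ _ ler01 cl; have := uE m _ _ ler01 cl.
  move: (fn phi (u n) t) (fn phi (u m) t) (L _) => a b c.
  by rewrite !ler_norml !mul1r => /andP[? ?] /andP[? ?]; lra.
have cz : ncont z.
  apply: ncont_lim => d /Hz[N HN]; exists (u N) => //; exact: HN.
exists z => // l K K0 cl; apply/eqP; rewrite -subr_eq0 -normr_le0; apply/ler_addgt0Pl => d d0.
rewrite addr0; have K1 : 0 < 2 * (K + 1) by rewrite mulr_gt0// ltr_wpDl.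
have [N HN] := small _ (divr_gt0 d0 K1); have [N' HN'] := Hz _ (divr_gt0 d0 K1).
pose n := maxn N N'; have {}HN := HN n (leq_maxl _ _); have {}HN' := HN' n (leq_maxr _ _).
have h1 := uE n _ _ K0 cl; have h2 := cfun_le cl (ncontB cz (uc n)).
rewrite (cfunB cl)// in h2.
rewrite -(subrK (l (u n)) (l z)) -addrA; apply: le_trans (ler_normD _ _) _.
apply: le_trans (lerD h2 h1) _; rewrite -mulrDr.
apply: (@le_trans _ _ (K * (d / (2 * (K + 1)) + d / (2 * (K + 1))))).
  by rewrite ler_wpM2l// lerD.
apply: (@le_trans _ _ ((K + 1) * (d / (2 * (K + 1)) + d / (2 * (K + 1))))).
  by rewrite ler_wpM2r ?lerDl// addr_ge0// ltW// divr_gt0.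
by rewrite le_eqVlt; apply/orP; left; apply/eqP; field; rewrite gt_eqF// ltr_wpDl.
Qed.

(** The integral of the orbit of [x] against [L]. It is unique, since [cfun] contains a
    norming set. *)
Definition act L x : alg A := xget 0 [set z | ncont z /\
  forall l K, 0 <= K -> cfun l K -> l z = L (fun h => l (psi h x))].

Let act_spec L x : pfun L -> ncont x -> ncont (act L x) /\
  forall l K, 0 <= K -> cfun l K -> l (act L x) = L (fun h => l (psi h x)).
Proof.
move=> pL cx; rewrite /act; case: xgetP => [z _ //|none].
by have [z cz zE] := act_ex pL cx; case: (none z).
Qed.

Lemma ncont_act L x : pfun L -> ncont x -> ncont (act L x).
Proof. by move=> pL cx; case: (act_spec pL cx). Qed.

Lemma cfun_act l K L x : 0 <= K -> cfun l K -> pfun L -> ncont x ->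
  l (act L x) = L (fun h => l (psi h x)).
Proof. by move=> K0 cl pL cx; case: (act_spec pL cx) => _ H; exact: (H l K). Qed.

Lemma fn_act phi L x : F1 phi -> pfun L -> ncont x ->
  fn phi (act L x) = conv L (fn phi x).
Proof.
move=> p1 pL cx; apply/funext => t.
rewrite (cfun_act ler01 (cfun_fn t p1))//; congr L; apply/funext => h.
by rewrite fn_psi addrC.
Qed.

Lemma pn_act L x : pfun L -> ncont x -> pn (act L x) <= pn x.
Proof.
move=> pL cx; apply: pn_dual => phi t p1; rewrite fn_act//.
apply: le_trans (ler_norm _) _; apply: conv_bound => //; first exact: fn_bcont.
by move=> s; exact: fn_le.
Qed.

Lemma actD L x y : pfun L -> ncont x -> ncont y -> act L (x + y) = act L x + act L y.
Proof.
move=> pL cx cy; apply: pn_inj => phi p1 t; have Fp : F phi by case: p1.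
rewrite fn_act//; last exact: ncontD.
by rewrite !fnD// !fn_act// (convD (pfun_bp pL))//; exact: fn_bcont.
Qed.

Lemma act_rs L a x : pfun L -> ncont x -> act L (rs a x) = rs a (act L x).
Proof.
move=> pL cx; apply: pn_inj => phi p1 t; have Fp : F phi by case: p1.
rewrite fn_act//; last exact: ncontZ.
by rewrite !fnZ// !fn_act// (convZ _ (pfun_bp pL))//; exact: fn_bcont.
Qed.

Lemma actB L x y : pfun L -> ncont x -> ncont y -> act L (x - y) = act L x - act L y.
Proof.
by move=> pL cx cy; rewrite -!rsN actD ?act_rs//; exact: ncontZ.
Qed.

Lemma act_psi L t x : pfun L -> ncont x -> act L (psi t x) = psi t (act L x).
Proof.
move=> pL cx; apply: pn_inj => phi p1 s.
rewrite fn_act//; last exact: ncont_psi.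
by rewrite !fn_psi conv_shift fn_act.
Qed.

Lemma act_comm L1 L2 x : pfun L1 -> pfun L2 -> ncont x ->
  act L1 (act L2 x) = act L2 (act L1 x).
Proof.
move=> p1 p2 cx; apply: pn_inj => phi pp s.
rewrite !fn_act//; try exact: ncont_act.
by rewrite conv_comm//; exact: fn_bcont.
Qed.

(** * The scale of fractional orders *)

Implicit Types (N e : R).

Variable s : R.
Hypothesis s12 : 0 < s < 2^-1.

Let s01 : 0 < s < 1.
Proof. by move/andP: s12 => [s0 s1]; apply/andP; split => //; lra. Qed.

Let pk N : 0 < N -> pfun (kapF s N).
Proof. by move=> /ltW; exact: pfun_kapF. Qed.

(** The bounded approximation [(N mu / (N + mu)) ^ s] of [mu ^ s], where [- mu + 1] is the
    square of the generator of the group. *)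
Definition frac N x : alg A := rs (N `^ s) (x - act (kapF s N) x).

Lemma ncont_frac N x : 0 < N -> ncont x -> ncont (frac N x).
Proof. by move=> /pk pN cx; apply: ncontZ; apply: ncontB => //; exact: ncont_act. Qed.

Lemma rsB a x y : rs a (x - y) = rs a x - rs a y. Proof. exact: scalerBr. Qed.

Lemma fracD N x y : 0 < N -> ncont x -> ncont y -> frac N (x + y) = frac N x + frac N y.
Proof. by move=> /pk pN cx cy; rewrite /frac actD// -rsDr opprD addrACA. Qed.

Lemma frac_rs N a x : 0 < N -> ncont x -> frac N (rs a x) = rs a (frac N x).
Proof. by move=> /pk pN cx; rewrite /frac act_rs// -rsB !rsA mulrC. Qed.

Lemma fracB N x y : 0 < N -> ncont x -> ncont y -> frac N (x - y) = frac N x - frac N y.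
Proof. by move=> N0 cx cy; rewrite -!rsN fracD ?frac_rs//; exact: ncontZ. Qed.

Lemma frac_psi N t x : 0 < N -> ncont x -> frac N (psi t x) = psi t (frac N x).
Proof. by move=> /pk pN cx; rewrite /frac act_psi// psi_rs psiB. Qed.

Lemma frac_act N L x : 0 < N -> pfun L -> ncont x -> frac N (act L x) = act L (frac N x).
Proof.
move=> /pk pN pL cx; have ck := ncont_act pN cx.
by rewrite /frac (act_rs _ pL) ?(actB pL cx ck) ?(act_comm pN pL cx)//; exact: ncontB.
Qed.

Lemma pn_frac_le N x : 0 < N -> ncont x -> pn (frac N x) <= N `^ s * (2 * pn x).
Proof.
move=> N0 cx; apply: le_trans (pnZ _ _) _; rewrite ger0_norm ?powR_ge0//.
rewrite ler_wpM2l ?powR_ge0// (le_trans (pnB _ _))// mulr_natl mulr2n lerD2l.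
by apply: pn_act => //; exact: pk.
Qed.

Lemma cfun_frac l K N : 0 < N -> 0 <= K -> cfun l K ->
  cfun (fun x => l (frac N x)) (K * (N `^ s * 2)).
Proof.
move=> N0 K0 cl; split.
- by move=> x y cx cy; rewrite fracD// (cfunD cl)//; exact: ncont_frac.
- by move=> a x cx; rewrite frac_rs// (cfunZ cl)//; exact: ncont_frac.
- move=> x cx; apply: le_trans (cfun_le cl (ncont_frac N0 cx)) _.
  by rewrite -!mulrA ler_wpM2l// pn_frac_le.
Qed.

(** A seminorm, the supremum over [N1, .., Ni > 0] of the norm of
    [frac N1 (.. (frac Ni x))], in the form of its upper bounds, so that it may be
    infinite. *)
Fixpoint bnd (i : nat) x K : Prop :=
  if i is i'.+1 then forall N, 0 < N -> bnd i' (frac N x) K else pn x <= K.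

Lemma bnd_mono i x K K' : K <= K' -> bnd i x K -> bnd i x K'.
Proof.
move=> KK; elim: i x => [|i IH] x /=; first by move=> h; exact: le_trans KK.
by move=> H N N0; apply/IH/H.
Qed.

Lemma bnd_ge0 i x K : bnd i x K -> 0 <= K.
Proof.
elim: i x => [|i IH] x /=; first by apply: le_trans; exact: pn_ge0.
by move=> /(_ 1 ltr01) /IH.
Qed.

Lemma bndD i x y K K' : ncont x -> ncont y -> bnd i x K -> bnd i y K' ->
  bnd i (x + y) (K + K').
Proof.
elim: i x y => [|i IH] x y cx cy /= xK yK.
  by apply: le_trans (pnD _ _) _; exact: lerD.
by move=> N N0; rewrite fracD//; apply: IH; [exact: ncont_frac|exact: ncont_frac|exact: xK|exact: yK].
Qed.

Lemma bnd_rs i a x K : ncont x -> bnd i x K -> bnd i (rs a x) (`|a| * K).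
Proof.
elim: i x => [|i IH] x cx /= xK; first by apply: le_trans (pnZ _ _) _; rewrite ler_wpM2l.
by move=> N N0; rewrite frac_rs//; apply: IH; [exact: ncont_frac|exact: xK].
Qed.

Lemma bndB i x y K K' : ncont x -> ncont y -> bnd i x K -> bnd i y K' ->
  bnd i (x - y) (K + K').
Proof.
move=> cx cy xK yK; rewrite -rsN; apply: bndD => //; first exact: ncontZ.
by have := bnd_rs (-1) cy yK; rewrite normrN1 mul1r.
Qed.

Lemma bnd_psi i t x K : ncont x -> bnd i x K -> bnd i (psi t x) K.
Proof.
elim: i x => [|i IH] x cx /= xK; first by rewrite pn_psi.
by move=> N N0; rewrite frac_psi//; apply: IH; [exact: ncont_frac|exact: xK].
Qed.

(** An integral of vectors that is defined weakly, by its values under [cfun], satisfies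
    the triangle inequality in each of the seminorms: [frac N] is absorbed by [l]. *)
Lemma bnd_integral i L c z (v : R -> alg A) (r : R -> R) : pfun L -> 0 <= c -> ncont z ->
  (forall h, ncont (v h)) ->
  (forall l K, 0 <= K -> cfun l K ->
     bcont (fun h => l (v h)) /\ l z = c * L (fun h => l (v h))) ->
  bcont r -> (forall h, bnd i (v h) (r h)) -> bnd i z (c * L r).
Proof.
move=> pL c0 cz cv zE rb; elim: i z v cz cv zE => [|i IH] z v cz cv zE /= vr.
  apply: pn_dual => phi t p1; have cl := cfun_fn t p1.
  have [vb ->] := zE _ _ ler01 cl; rewrite ler_wpM2l//; apply: pfun_le => // h.
  by apply: le_trans (vr h); apply: le_trans (ler_norm _) _; exact: fn_le.
move=> N N0; apply: (IH _ (fun h => frac N (v h))).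
- exact: ncont_frac.
- by move=> h; exact: ncont_frac.
- move=> l K K0 cl; apply: zE (cfun_frac N0 K0 cl).
  by rewrite mulr_ge0// mulr_ge0// powR_ge0.
- by move=> h; exact: vr.
Qed.

Lemma bnd_inf i x (S : set R) : S !=set0 -> (forall K, S K -> bnd i x K) -> bnd i x (inf S).
Proof.
move=> S0; elim: i x => [|i IH] x /= H; first exact: lb_le_inf.
by move=> N N0; apply: IH => K SK; exact: H.
Qed.

(** Norm continuity is part of finite order, since [frac] is meaningful only then. *)
Definition fin i x := ncont x /\ exists K, bnd i x K.
(** The least bound; it is attained by [bnd_inf]. *)
Definition sn i x : R := inf [set K | bnd i x K].

Lemma snP i x : fin i x -> bnd i x (sn i x).
Proof. by move=> [_ [K xK]]; apply: bnd_inf => //; exists K. Qed.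

Lemma sn_le i x K : bnd i x K -> sn i x <= K.
Proof.
by move=> xK; apply: ge_inf => //; exists 0 => K' /=; exact: bnd_ge0.
Qed.

Lemma sn_ge0 i x : fin i x -> 0 <= sn i x.
Proof. by move=> /snP; exact: bnd_ge0. Qed.

Lemma sn0 x : ncont x -> sn 0 x = pn x.
Proof.
move=> cx; apply/eqP; rewrite eq_le sn_le//=.
have : bnd 0 x (sn 0 x) by apply: snP; split => //; exists (pn x) => /=.
exact.
Qed.

Lemma fin_of_bnd i x K : ncont x -> bnd i x K -> fin i x.
Proof. by move=> cx xK; split => //; exists K. Qed.

Lemma fin_frac i N x : 0 < N -> fin i.+1 x -> fin i (frac N x).
Proof.
by move=> N0 [cx [K xK]]; split; [exact: ncont_frac|exists K; exact: xK].
Qed.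

Lemma sn_frac i N x : 0 < N -> fin i.+1 x -> sn i (frac N x) <= sn i.+1 x.
Proof. by move=> N0 /snP /(_ N N0) /sn_le. Qed.

Lemma pn_act_mass L x : pfun L -> ncont x -> pn (act L x) <= pn x * L (fun=> 1).
Proof.
move=> pL cx; apply: pn_dual => phi t p1; rewrite fn_act//.
rewrite -(bplin_cst _ (pfun_bp pL)); apply: le_trans (ler_norm _) _.
apply: pfun_norm_le => //; [|exact: bcont_cst|by move=> h; exact: fn_le].
by apply: bcont_shift; exact: fn_bcont.
Qed.

(** The mass of [kapF s 1] is less than one, so that [frac 1] is bounded below. *)
Lemma bnd_lower i x K : ncont x -> bnd i.+1 x K -> bnd i x (2 * K).
Proof.
elim: i x => [|i IH] x cx xK; last first.
  by move=> N N0; apply: IH; [exact: ncont_frac|exact: xK].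
have {xK} := xK 1 ltr01; rewrite /= /frac one_powR rs1.
have := pn_act_mass (pk ltr01) cx; rewrite (kapF_mass s01 ler01).
have := pnD (x - act (kapF s 1) x) (act (kapF s 1) x); rewrite subrK.
have h : 1 <= 2 * (1 + 1 : R) `^ (- s).
  have : (1 + 1 : R) `^ (- 1) <= (1 + 1) `^ (- s).
    by apply: ler_powR; case/andP: s01 => *; lra.
  rewrite powR_inv1 ?addr_ge0// -[_^-1]mul1r ler_pdivrMr ?addr_gt0//.
  by move: (_ `^ _) => u; lra.
have := pn_ge0 x.
move: (pn _) (pn _) (pn _) => a b c a0 h1 h2 h3.
have := ler_wpM2l a0 h; move: (_ `^ _) (h1) => u _; nra.
Qed.

(** * Interpolation and Hoelder continuity *)

Lemma powR_ratio_le1 N : 0 < N -> N `^ s * (1 + N) `^ (- s) <= 1.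
Proof.
move=> N0; have N1 : 0 < 1 + N by rewrite addr_gt0.
rewrite powRN ler_pdivrMr ?powR_gt0// mul1r.
by apply: ge0_ler_powR; rewrite ?nnegrE; case/andP: s01 => *; lra.
Qed.

Lemma fin_lower i x : fin i.+1 x -> fin i x /\ sn i x <= 2 * sn i.+1 x.
Proof.
move=> fx; have [cx _] := fx; have b := bnd_lower cx (snP fx).
by split; [exact: fin_of_bnd b|exact: sn_le].
Qed.

Lemma fin_le i j x : (i <= j)%N -> fin j x -> fin i x /\ sn i x <= 2 ^+ j * sn j x.
Proof.
elim: j => [|j IH]; first by rewrite leqn0 => /eqP -> fx; rewrite expr0 mul1r.
rewrite leq_eqVlt => /predU1P[-> fx|ij /[dup] fx /fin_lower[fx' h]].
  split => //; rewrite -[X in X <= _]mul1r ler_wpM2r ?sn_ge0//.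
  by rewrite exprn_ege1// ler1n.
have [fi ile] := IH ij fx'; split => //; apply: le_trans ile _.
by rewrite exprSr -mulrA ler_wpM2l ?exprn_ge0.
Qed.

(** [1 - resF K] is small on vectors of order one: by [kapF_complement] it factors
    through [1 - kapF s K]. *)
Lemma resF_small K x : 0 < K -> fin 1 x ->
  pn (x - act (resF K) x) <= 2 * K `^ (- s) * sn 1 x.
Proof.
move=> K0 fx; have [cx _] := fx; have K0' := ltW K0.
have pK := pk K0; have pR := pfun_resF K0'.
have s01' : 0 < 1 - s < 1 by move/andP: s01 => [a b]; apply/andP; split; lra.
have pK' := pfun_kapF s01' K0'; have cz := ncontB cx (ncont_act pK cx).
set z := x - act (kapF s K) x in cz.
have -> : x - act (resF K) x = z - act (kapF (1 - s) K) z.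
  apply: pn_inj => phi p1 t; have Fp : F phi by case: p1.
  have fb := fn_bcont x p1; have fzb := fn_bcont z p1.
  have zE : fn phi z = fun t => fn phi x t - conv (kapF s K) (fn phi x) t.
    by rewrite fnB// fn_act.
  rewrite !fnB// !fn_act// zE (convB (pfun_bp pK') fb (bcont_conv pK fb)).
  have := @kapF_complement _ s K (fun h => fn phi x (t + h)) s01 K0' (bcont_shift t fb).
  rewrite /comp conv_shift -/(conv _ (fn phi x) t) -/(conv _ (fn phi x) t) -/(conv _ (fn phi x) t).
  rewrite -/(conv _ (conv (kapF s K) (fn phi x)) t) => ->.
  by move: (fn phi x t) (conv _ _ t) (conv _ _ t) (conv _ _ t) => a b c d; ring.
apply: le_trans (pnB _ _) _.
have h1 := pn_act pK' cz.
have h2 : pn z <= K `^ (- s) * sn 1 x.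
  have : pn (frac K x) <= sn 1 x by exact: (snP fx).
  have -> : z = rs (K `^ (- s)) (frac K x).
    by rewrite /frac rsA -powRD ?addNr ?powRr0 ?rs1//; apply/implyP => _; rewrite gt_eqF.
  move=> h; apply: le_trans (pnZ _ _) _; rewrite ger0_norm ?powR_ge0//.
  by rewrite ler_wpM2l ?powR_ge0.
rewrite -mulrA; move: (pn _) (pn _) (_ * _) h1 h2 => a b c; lra.
Qed.

(** [resF K] maps into the domain of [mu], where [1 - resF M] is of order [1 / M] by the
    resolvent identity. *)
Lemma frac_resF_le K N x : 0 < K -> 0 < N -> ncont x ->
  pn (frac N (act (resF K) x)) <= 4 * (K + 1) * pn x.
Proof.
move=> K0 N0 cx; have K0' := ltW K0; have pR := pfun_resF K0'; have pN := pk N0.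
apply: pn_dual => phi t p1; have Fp : F phi by case: p1.
have fb := fn_bcont x p1; have P0 := pn_ge0 x.
have cr := ncont_act pR cx.
rewrite /frac fnZ// fnB// !fn_act//.
pose f h := fn phi x (t + h); have fb' : bcont f by exact: bcont_shift.
have fX h : `|f h| <= pn x by exact: fn_le.
pose g := conv (resF K) f; have gb : bcont g by exact: bcont_conv.
have gX h : `|g h| <= pn x by apply: conv_bound.
have g0 : conv (resF K) (fn phi x) t = g 0 by rewrite /g /conv; congr resF; apply/funext => h; rewrite /f add0r.
have gk : conv (kapF s N) (conv (resF K) (fn phi x)) t = kapF s N g.
  by rewrite /g /f conv_shift.
rewrite g0 gk; have dl : forall M, 0 < M -> `|g 0 - resF M g| <= 4 * (K + 1) * pn x / (1 + M).
  move=> M M0; have M1 : 0 < 1 + M by rewrite addr_gt0.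
  have pM := pfun_resF (ltW M0).
  have := resF_resolvent M0 K0' fb'; rewrite /comp -/g.
  have -> : resF K f = g 0 by rewrite /g /conv; congr resF; apply/funext => h; rewrite add0r.
  move=> E.
  have h1 : `|resF M f| <= pn x by exact: pfun_bound.
  have h2 : `|resF M g| <= pn x by exact: pfun_bound.
  have h3 := gX 0.
  (* The resolvent identity gives decay in [M] only for [M > 1]; below, the trivial bound
     is of the required form. *)
  rewrite ler_pdivlMr//; have [M1'|M1'] := leP M 1.
    apply: (@le_trans _ _ (2 * pn x * (1 + M))).
      rewrite ler_pM2r//; apply: le_trans (ler_normB _ _) _.
      by move: h2 h3; move: `|_| `|_| (pn x) => a b c; lra.
    by rewrite -[X in X <= _]mulrA [X in X <= _]mulrC -[X in X <= _]mulrA (mulrC (4 * _)) ler_wpM2l//; lra.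
  have {}E : `|g 0 - resF M g| <= K / M * (2 * pn x).
    rewrite E normrM (ger0_norm (x := K / M)) ?divr_ge0 ?(ltW M0)//.
    rewrite ler_wpM2l ?divr_ge0 ?(ltW M0)//; apply: le_trans (ler_normB _ _) _.
    by move: h1 h2; move: `|_| `|_| (pn x) => a b c; lra.
  apply: (@le_trans _ _ (K / M * (2 * pn x) * (M + M))).
    apply: ler_pM => //; [exact: ltW|by rewrite lerD2r ltW].
  have -> : K / M * (2 * pn x) * (M + M) = 4 * K * pn x by field; rewrite gt_eqF.
  by rewrite ler_wpM2r// ler_wpM2l// lerDl.
have c0 : 0 <= 4 * (K + 1) * pn x by rewrite !mulr_ge0// addr_ge0.
have h := kapF_defect_le s01 (ltW N0) gb dl N0.
apply: le_trans (ler_norm _) _; rewrite normrM ger0_norm ?powR_ge0//.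
apply: le_trans (ler_wpM2l (powR_ge0 _ _) h) _; rewrite mulrCA ler_piMr//.
exact: powR_ratio_le1.
Qed.

(** Ehrling's inequality between consecutive orders: [x] is split at frequency [K]. *)
Lemma bnd_ehrling i K x X0 X2 : 0 < K -> ncont x -> bnd i x X0 -> bnd i.+2 x X2 ->
  bnd i.+1 x (2 * K `^ (- s) * X2 + 4 * (K + 1) * X0).
Proof.
move=> K0; elim: i x => [|i IH] x cx b0 b2; last first.
  by move=> N N0; apply: IH; [exact: ncont_frac|exact: b0|exact: b2].
move=> N N0 /=; have pR := pfun_resF (ltW K0).
have cr := ncont_act pR cx; have cf := ncont_frac N0 cx.
have -> : frac N x = (frac N x - act (resF K) (frac N x)) + frac N (act (resF K) x).
  by rewrite frac_act// subrK.
have b1 : bnd 1 (frac N x) X2 by exact: b2.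
have h1 := resF_small K0 (fin_of_bnd cf b1).
have h2 := frac_resF_le K0 N0 cx.
apply: le_trans (pnD _ _) _; apply: lerD.
  by apply: le_trans h1 _; rewrite ler_wpM2l ?sn_le// mulr_ge0// powR_ge0.
by apply: le_trans h2 _; rewrite ler_wpM2l// mulr_ge0// addr_ge0// ltW.
Qed.

(** Ehrling's inequality, with the lower seminorm interpolated again and half of the
    left side absorbed. *)
Lemma interpolation i e : 0 < e -> exists2 C, 0 <= C &
  forall x, fin i.+1 x -> sn i x <= e * sn i.+1 x + C * pn x.
Proof.
elim: i e => [|i IH] e e0.
  exists 1 => // x fx; have [cx _] := fx; rewrite sn0// mul1r lerDr.
  by apply: mulr_ge0; [exact: ltW|exact: sn_ge0].
have [s0 _] := andP s01.
pose K := (4 / e) `^ s^-1; have e4 : 0 < 4 / e by rewrite divr_gt0.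
have K0 : 0 < K by rewrite powR_gt0.
have Ks : 2 * K `^ (- s) = e / 2.
  by rewrite -powRrM mulrN mulVf ?gt_eqF// powR_inv1 ?ltW//; field; rewrite gt_eqF.
pose C1 := 4 * (K + 1); have C10 : 0 < C1 by rewrite mulr_gt0// addr_gt0.
have [|C2 C20 HC] := IH (2 * C1)^-1; first by rewrite invr_gt0 mulr_gt0.
exists (2 * (C1 * C2)); first by apply: mulr_ge0 => //; apply: mulr_ge0 => //; exact: ltW.
move=> x fx; have [cx _] := fx; have [f1 _] := fin_lower fx; have [f0 _] := fin_lower f1.
have h1 := sn_le (bnd_ehrling K0 cx (snP f0) (snP fx)); rewrite Ks -/C1 in h1.
have h2 := ler_wpM2l (ltW C10) (HC _ f1).
have E : C1 * ((2 * C1)^-1 * sn i.+1 x + C2 * pn x) = 2^-1 * sn i.+1 x + C1 * C2 * pn x.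
  by field; rewrite gt_eqF.
rewrite E in h2; move: h1 h2.
have -> : 2 * (C1 * C2) * pn x = C1 * C2 * pn x + C1 * C2 * pn x by ring.
move: (C1 * sn i x) (C1 * C2 * pn x) (sn i.+1 x) (sn i.+2 x) => a b c d; lra.
Qed.

(** Vectors of order [i + 1] are Hoelder continuous in the norm of order [i], with
    an exponent greater than [s]. *)
Lemma bnd_hoelder e : 0 < e -> exists2 C, 0 <= C & forall i x h X0 X1,
  ncont x -> bnd i x X0 -> bnd i.+1 x X1 ->
  bnd i (psi h x - x) (`|h| `^ hexp s * (e * X1 + C * X0)).
Proof.
move=> e0; have [C C0 HC] := holder_optimize s01 e0; exists C => // i x h X0 X1.
elim: i x => [|i IH] x cx b0 b1; last first.
  move=> N N0; rewrite fracB ?frac_psi//; last exact: ncont_psi.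
  by apply: IH; [exact: ncont_frac|exact: b0|exact: b1].
have X00 := bnd_ge0 b0; have X10 := bnd_ge0 b1.
have [->|h0] := eqVneq h 0.
  rewrite /= psi0 subrr pn0; apply: mulr_ge0; first exact: powR_ge0.
  by apply: addr_ge0; apply: mulr_ge0 => //; exact: ltW.
apply: pn_dual => phi t p1; have Fp : F phi by case: p1.
rewrite fnB// fn_psi (addrC h); apply: le_trans (ler_norm _) _.
have gX u : `|fn phi x u| <= X0 by apply: le_trans b0; exact: fn_le.
apply: HC => //.
  by apply: le_trans (ler_normB _ _) _; rewrite mulr_natl mulr2n lerD.
move=> N N0; apply: (fractional_modulus s01) => //; first exact: fn_bcont.
move=> M u M0; have /= := b1 M M0; apply: le_trans.
have -> : M `^ s * (fn phi x u - conv (kapF s M) (fn phi x) u) = fn phi (frac M x) u.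
  by rewrite /frac fnZ// fnB// fn_act//; exact: pk.
exact: fn_le.
Qed.

(** * The Leibniz rule *)

Lemma interpolation_scaled p i k e : (p <= i)%N -> 0 <= k -> 0 < e -> exists2 C, 0 <= C &
  forall x, fin i.+1 x -> k * sn p x <= e * sn i.+1 x + C * pn x.
Proof.
move=> pi k0 e0; pose q := (k + 1) * 2 ^+ i.+1.
have k1 : 0 < k + 1 by rewrite ltr_wpDl.
have q0 : 0 < q by rewrite mulr_gt0// exprn_gt0.
have [C C0 HC] := interpolation p (divr_gt0 e0 q0).
exists ((k + 1) * C); first by rewrite mulr_ge0// ltW.
move=> x fx; have [f1 h1] := fin_le (pi : (p.+1 <= i.+1)%N) fx.
have [f0 _] := fin_lower f1.
have h2 := HC _ f1; have S0 := sn_ge0 f0.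
apply: (@le_trans _ _ ((k + 1) * sn p x)); first by rewrite ler_wpM2r// lerDl.
apply: le_trans (ler_wpM2l (ltW k1) h2) _; rewrite mulrDr mulrA lerD//; last by rewrite mulrA.
have eq0 : 0 <= (k + 1) * (e / q) by rewrite mulr_ge0 ?ltW// divr_gt0.
apply: le_trans (ler_wpM2l eq0 h1) _.
rewrite mulrA (_ : _ * 2 ^+ i.+1 = e)//.
by rewrite /q; field; rewrite !gt_eqF//= exprn_gt0.
Qed.

(** The form in which Hoelder continuity is used: of lower order in [x], up to an
    arbitrarily small constant. *)
Lemma bnd_hoelder_small i e : 0 < e -> exists2 C, 0 <= C & forall x h, fin i.+1 x ->
  bnd i (psi h x - x) (`|h| `^ hexp s * (e * sn i.+1 x + C * pn x)).
Proof.
move=> e0; have e2 : 0 < e / 2 by rewrite divr_gt0.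
have [C C0 HC] := bnd_hoelder e2.
have [C' C'0 HC'] := interpolation_scaled (leqnn i) C0 e2.
exists C' => // x h fx; have [cx _] := fx; have [f0 _] := fin_lower fx.
apply: bnd_mono (HC i x h _ _ cx (snP f0) (snP fx)); rewrite ler_wpM2l ?powR_ge0//.
have := HC' _ fx; move: (C * sn i x) (C' * pn x) (sn i.+1 x) => a b c; lra.
Qed.

(** The defect of the Leibniz rule. The third term compensates for the mass of
    [kapF s N] being less than one. *)
Definition leib_defect N x y : alg A :=
  frac N x * y + x * frac N y - rs (N `^ s * (1 + N) `^ (- s)) (x * y) - frac N (x * y).

(** The defect is the average of the products of increments,
    [(psi h x - x) (psi h y - y)], under [N ^ s kapF s N]. *)
Lemma leib_defect_fun N x y l K : 0 < N -> ncont x -> ncont y -> 0 <= K -> cfun l K ->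
  bcont (fun h => l ((psi h x - x) * (psi h y - y))) /\
  l (leib_defect N x y) = N `^ s * kapF s N (fun h => l ((psi h x - x) * (psi h y - y))).
Proof.
move=> N0 cx cy K0 cl; have pN := pk N0; have bN := pfun_bp pN.
have cxy := ncontM cx cy.
have cly := cfun_mulr K0 cl cy; have clx := cfun_mull K0 cl cx.
have Ky : 0 <= K * pn y by rewrite mulr_ge0// pn_ge0.
have Kx : 0 <= K * pn x by rewrite mulr_ge0// pn_ge0.
have b1 := cfun_orbit_bcont K0 cl cxy.
have b2 := cfun_orbit_bcont Ky cly cx; have b3 := cfun_orbit_bcont Kx clx cy.
have ax := ncont_act pN cx; have ay := ncont_act pN cy; have axy := ncont_act pN cxy.
have E : (fun h => l ((psi h x - x) * (psi h y - y))) =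
    fun h => (l (psi h (x * y)) - l (psi h x * y)) - (l (x * psi h y) - l (x * y)).
  apply/funext => h; have px := ncont_psi h cx; have py := ncont_psi h cy.
  have c1 := ncontM px py; have c2 := ncontM px cy; have c3 := ncontM cx py.
  rewrite psiM -(cfunB cl c1 c2) -(cfunB cl c3 cxy) -(cfunB cl (ncontB c1 c2) (ncontB c3 cxy)).
  by congr l; rewrite mulrBl !mulrBr.
have b12 := bcontB b1 b2; have b34 := bcontB b3 (bcont_cst (l (x * y))).
rewrite E; split; first exact: bcontB.
rewrite (bplinB bN b12 b34) (bplinB bN b1 b2) (bplinB bN b3 (bcont_cst _)) (bplin_cst _ bN).
rewrite (kapF_mass s01 (ltW N0)).
rewrite -(cfun_act K0 cl pN cxy) -(cfun_act Ky cly pN cx) -(cfun_act Kx clx pN cy).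
have cfx := ncont_frac N0 cx; have cfy := ncont_frac N0 cy; have cfxy := ncont_frac N0 cxy.
have E1 : l (frac N x * y) = N `^ s * (l (x * y) - l (act (kapF s N) x * y)).
  by have /= <- := cfunB cly cx ax; exact: (cfunZ cly _ (ncontB cx ax)).
have E2 : l (x * frac N y) = N `^ s * (l (x * y) - l (x * act (kapF s N) y)).
  by have /= <- := cfunB clx cy ay; exact: (cfunZ clx _ (ncontB cy ay)).
have E3 : l (frac N (x * y)) = N `^ s * (l (x * y) - l (act (kapF s N) (x * y))).
  by rewrite -(cfunB cl cxy axy); exact: (cfunZ cl _ (ncontB cxy axy)).
have c1 := ncontM cfx cy; have c2 := ncontM cx cfy; have c12 := ncontD c1 c2.
have c3 := ncontZ (N `^ s * (1 + N) `^ (- s)) cxy.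
rewrite /leib_defect (cfunB cl (ncontB c12 c3) cfxy) (cfunB cl c12 c3) (cfunD cl c1 c2).
rewrite (cfunZ cl _ cxy) E1 E2 E3.
move: (l (x * y)) (l (_ * y)) (l (x * _)) (l _) (N `^ s) (_ `^ _) => a b c d u v; ring.
Qed.

Definition submult i := exists2 C, 0 <= C & forall x y X Y, ncont x -> ncont y ->
  bnd i x X -> bnd i y Y -> bnd i (x * y) (C * (X * Y)).

Lemma ncont_leib_defect N x y : 0 < N -> ncont x -> ncont y -> ncont (leib_defect N x y).
Proof.
move=> N0 cx cy; have cxy := ncontM cx cy.
apply: ncontB; last exact: ncont_frac.
apply: ncontB; last exact: ncontZ.
by apply: ncontD; apply: ncontM => //; exact: ncont_frac.
Qed.

(** The defect is of lower order in [x]: both increments are Hoelder of exponent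
    greater than [s], and the kernels [N ^ s kapF s N] have bounded moments of
    order greater than [2 s]. *)
Lemma bnd_leib_defect i e : submult i -> 0 < e -> exists2 C, 0 <= C & forall N x y, 0 < N ->
  fin i.+1 x -> fin i.+1 y ->
  bnd i (leib_defect N x y) ((e * sn i.+1 x + C * pn x) * sn i.+1 y).
Proof.
move=> [C0 C00 HC0] e0; set b := hexp s.
have [sb b1] := hexp_gt s12; rewrite -/b in sb b1.
have [Ct Ct0 HCt] := kapF_tmod s01 sb b1.
have [C2 C20 HC2] := bnd_hoelder_small i ltr01.
pose k := Ct * C0 * (1 + C2 * 2 ^+ i.+1).
have cB0 : 0 <= 1 + C2 * 2 ^+ i.+1 by rewrite addr_ge0// mulr_ge0// exprn_ge0.
have k0 : 0 <= k by apply: mulr_ge0 => //; exact: mulr_ge0.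
have k1 : 0 < k + 1 by rewrite ltr_wpDl.
have [C1 C10 HC1] := bnd_hoelder_small i (divr_gt0 e0 k1).
exists (k * C1); first by rewrite mulr_ge0.
move=> N x y N0 fx fy; have [cx _] := fx; have [cy _] := fy; have pN := pk N0.
have Sx := sn_ge0 fx; have Sy := sn_ge0 fy; have P0 := pn_ge0 x.
have [f0x _] := fin_lower fx; have [f0y _] := fin_lower fy.
set A1 := e / (k + 1) * sn i.+1 x + C1 * pn x.
have A0 : 0 <= A1 by rewrite addr_ge0// mulr_ge0// divr_ge0 ?ltW.
pose B := (1 + C2 * 2 ^+ i.+1) * sn i.+1 y; have B0 : 0 <= B by rewrite mulr_ge0.
have pxh h : ncont (psi h x - x) by apply: ncontB => //; exact: ncont_psi.
have pyh h : ncont (psi h y - y) by apply: ncontB => //; exact: ncont_psi.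
have hy h : bnd i (psi h y - y) (`|h| `^ b * B).
  apply: bnd_mono (HC2 _ h fy); rewrite ler_wpM2l ?powR_ge0// /B mulrDl !mul1r lerD2l.
  rewrite -mulrA ler_wpM2l//; have [_] := fin_le (leq0n i.+1) fy.
  by rewrite sn0.
have crude z h : fin i z -> bnd i (psi h z - z) (2 * sn i z).
  move=> fz; have [cz _] := fz; rewrite mulr_natl mulr2n.
  by apply: bndB => //; [exact: ncont_psi|apply: bnd_psi => //; exact: snP|exact: snP].
pose Z := C0 * (A1 * B); have Z0 : 0 <= Z by apply: mulr_ge0 => //; exact: mulr_ge0.
pose T := C0 * (2 * sn i x * (2 * sn i y)).
have T0 : 0 <= T.
  by apply: mulr_ge0 => //; apply: mulr_ge0; apply: mulr_ge0 => //; exact: sn_ge0.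
have [s0 _] := andP s01; have bpos : 0 < 2 * b by rewrite mulr_gt0// (lt_trans s0).
(* The Hoelder bound and the crude bound for the product of increments cross at this
   level of [`|h| ^ (2 b)]. *)
pose n := T / Z; have n0 : 0 <= n by rewrite divr_ge0.
pose r h := Z * tmod (2 * b) n h.
have rb : bcont r by apply: bcontZ; exact: bcont_tmod.
have vr h : bnd i ((psi h x - x) * (psi h y - y)) (r h).
  have v1 : bnd i ((psi h x - x) * (psi h y - y)) (Z * `|h| `^ (2 * b)).
    have -> : Z * `|h| `^ (2 * b) = C0 * (`|h| `^ b * A1 * (`|h| `^ b * B)).
      rewrite (_ : 2 * b = b + b); last by rewrite mulr_natl mulr2n.
      rewrite powRD; last by apply/implyP; rewrite gt_eqF// -mulr2n -mulr_natl.
      by rewrite /Z; move: (_ `^ b) => u; ring.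
    by apply: HC0 => //; exact: HC1.
  have [hn|hn] := leP (`|h| `^ (2 * b)) n; first by rewrite /r /tmod (min_idPl hn).
  rewrite /r /tmod (min_idPr (ltW hn)).
  have [Z00|Znz] := eqVneq Z 0; first by move: v1; rewrite Z00 !mul0r.
  rewrite /n mulrC divfK//; apply: HC0 => //; exact: crude.
apply: bnd_mono (_ : N `^ s * kapF s N r <= _) _; last first.
  apply: (@bnd_integral i (kapF s N) (N `^ s) _ (fun h => (psi h x - x) * (psi h y - y))) => //.
  - exact: powR_ge0.
  - exact: ncont_leib_defect.
  - by move=> h; exact: ncontM.
  - by move=> l K K0 cl; apply: (leib_defect_fun N0 cx cy K0 cl).
have h1 := HCt N n (ltW N0) n0.
rewrite /r (bplinZ (pfun_bp pN)); last exact: bcont_tmod.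
have h2 : N `^ s * kapF s N (tmod (2 * b) n) <= Ct.
  apply: le_trans (ler_wpM2l (powR_ge0 _ _) h1) _; rewrite mulrCA ler_piMr//.
  exact: powR_ratio_le1.
rewrite mulrCA; apply: le_trans (ler_wpM2l Z0 h2) _.
have -> : Z * Ct = k * A1 * sn i.+1 y by rewrite /Z /B /k; ring.
apply: ler_wpM2r => //; rewrite /A1.
rewrite (_ : k * _ = k * (e / (k + 1)) * sn i.+1 x + k * C1 * pn x) ?lerD2r; last by ring.
by rewrite ler_wpM2r// mulrCA ler_piMr ?ltW// ltr_pdivrMr// mul1r ltrDl.
Qed.

(** At order zero the second term is absent: submultiplicativity has constant one. *)
Definition leib_bound i e C x y : R :=
  sn i x * pn y + (if i is 0 then 0 else (e * sn i x + C * pn x) * sn i y).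

Definition leibniz i := forall e, 0 < e -> exists2 C, 0 <= C & forall x y,
  fin i x -> fin i y -> bnd i (x * y) (leib_bound i e C x y).

Lemma leibniz_submult i : leibniz i -> submult i.
Proof.
move=> /(_ 1 ltr01)[C C0 HC]; exists (2 ^+ i + (1 + C * 2 ^+ i)).
  by rewrite !addr_ge0// ?mulr_ge0// exprn_ge0.
move=> x y X Y cx cy bx by_; have fx := fin_of_bnd cx bx; have fy := fin_of_bnd cy by_.
apply: bnd_mono (HC x y fx fy); rewrite /leib_bound.
have X0 := sn_ge0 fx; have Y0 := sn_ge0 fy; have XX := sn_le bx; have YY := sn_le by_.
have [_ px] := fin_le (leq0n i) fx; have [_ py] := fin_le (leq0n i) fy.
rewrite !sn0// in px py; have p0 := pn_ge0 x; have q0 := pn_ge0 y.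
have k0 : 1 <= 2 ^+ i :> R by rewrite exprn_ege1// ler1n.
apply: (@le_trans _ _ (sn i x * (2 ^+ i * sn i y) + (1 * sn i x + C * (2 ^+ i * sn i x)) * sn i y)).
  apply: lerD; first by rewrite ler_wpM2l.
  case: i {HC bx by_ XX YY k0} fx fy X0 Y0 px py => [|i] fx fy X0 Y0 px py.
    by apply: mulr_ge0 => //; apply: addr_ge0; apply: mulr_ge0 => //; apply: mulr_ge0.
  by rewrite ler_wpM2r// lerD2l ler_wpM2l.
have XY : sn i x * sn i y <= X * Y by exact: ler_pM.
have -> : sn i x * (2 ^+ i * sn i y) + (1 * sn i x + C * (2 ^+ i * sn i x)) * sn i y =
  (2 ^+ i + (1 + C * 2 ^+ i)) * (sn i x * sn i y) by ring.
by rewrite ler_wpM2l// !addr_ge0// ?mulr_ge0// exprn_ge0.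
Qed.

(** The term [frac N x * y] is the main one; beyond order zero its second part is small by
    interpolation, as [frac N x] has norm at most [sn 1 x]. *)
Lemma leibniz_frac_l i e : leibniz i -> 0 < e -> exists2 C, 0 <= C & forall N x y, 0 < N ->
  fin i.+1 x -> fin i.+1 y ->
  bnd i (frac N x * y) (sn i.+1 x * pn y + (e * sn i.+1 x + C * pn x) * sn i.+1 y).
Proof.
move=> lei e0; have e4 : 0 < e / 4 by rewrite divr_gt0.
have [C C0 HC] := lei _ e4.
case: i => [|i] in lei HC *.
  exists 0 => // N x y N0 fx fy; have [cx _] := fx; have [cy _] := fy.
  have [fy0 _] := fin_lower fy; have fN := fin_frac N0 fx.
  apply: bnd_mono (HC _ _ fN fy0); rewrite /leib_bound.
  apply: lerD; first by rewrite ler_wpM2r ?pn_ge0// sn_frac.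
  by rewrite mul0r addr0; apply: mulr_ge0; [apply: mulr_ge0; [exact: ltW|exact: sn_ge0]|exact: sn_ge0].
have C2 : 0 <= 2 * C by rewrite mulr_ge0.
have [C' C'0 HC'] := @interpolation_scaled 1 i.+1 _ _ (ltn0Sn i) C2 (divr_gt0 e0 (ltr0n R 2)).
exists C' => // N x y N0 fx fy; have [cx _] := fx; have [cy _] := fy.
have [fy0 hy] := fin_lower fy; have fN := fin_frac N0 fx.
apply: bnd_mono (HC _ _ fN fy0); rewrite /leib_bound.
have h1 := sn_frac N0 fx.
apply: lerD; first by rewrite ler_wpM2r ?pn_ge0.
have P1 : pn (frac N x) <= sn 1 x.
  by have [f1 _] := @fin_le 1 i.+2 x (ltn0Sn _) fx; exact: (snP f1).
have h2 := HC' _ fx; have S0 := sn_ge0 fx; have Y0 := sn_ge0 fy; have Y1 := sn_ge0 fy0.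
have N1 := sn_ge0 fN; have P0 := pn_ge0 (frac N x).
apply: (@le_trans _ _ ((e / 4 * sn i.+2 x + C * sn 1 x) * (2 * sn i.+2 y))).
  apply: ler_pM => //.
  - by apply: addr_ge0; apply: mulr_ge0 => //; exact: ltW.
  - by apply: lerD; [rewrite ler_wpM2l// ltW|rewrite ler_wpM2l].
rewrite mulrA; apply: ler_wpM2r => //.
by move: (sn i.+2 x) (sn 1 x) (C' * pn x) h2 => a b c; lra.
Qed.

(** A Leibniz rule in which the derivative falls on the left factor only, up to terms
    that are of lower order in [x] or carry a small constant. The coefficient one of the
    main term survives the induction. *)
Lemma leibnizP i : leibniz i.
Proof.
elim: i => [|i IH] e e0.
  exists 0 => // x y fx fy; have [cx _] := fx; have [cy _] := fy.
  by rewrite /leib_bound /= addr0 sn0// pnM.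
have sub := leibniz_submult IH; have [C0 C00 HC0] := sub.
have e4 : 0 < e / 4 by rewrite divr_gt0.
have [C1 C10 HC1] := leibniz_frac_l IH e4.
have [C2 C20 HC2] := bnd_leib_defect sub e4.
have [C3 C30 HC3] := IH _ ltr01.
pose k := 2 ^+ i.+1 + 1 + 2 * C0.
have k0 : 0 <= k by rewrite /k !addr_ge0// ?mulr_ge0// exprn_ge0.
have [C4 C40 HC4] := interpolation_scaled (leqnn i) k0 e4.
exists (C1 + C2 + C3 + C4); first by rewrite !addr_ge0.
move=> x y fx fy N N0; have [cx _] := fx; have [cy _] := fy.
have [f0x _] := fin_lower fx; have [f0y hy] := fin_lower fy; have cxy := ncontM cx cy.
have fNy := fin_frac N0 fy; have hNy := sn_frac N0 fy.
have b1 := HC1 N x y N0 fx fy; have b4 := HC2 N x y N0 fx fy.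
have b2 := HC3 _ _ f0x fNy.
have Sx := sn_ge0 f0x; have Sy := sn_ge0 fy; have P0 := pn_ge0 x; have Sy0 := sn_ge0 f0y.
have b3 : bnd i (rs (N `^ s * (1 + N) `^ (- s)) (x * y)) (C0 * (sn i x * sn i y)).
  have bxy := HC0 _ _ _ _ cx cy (snP f0x) (snP f0y).
  apply: bnd_mono (bnd_rs (N `^ s * (1 + N) `^ (- s)) cxy bxy).
  rewrite ger0_norm ?mulr_ge0 ?powR_ge0// ler_piMl ?powR_ratio_le1//.
  by apply: mulr_ge0 => //; exact: mulr_ge0.
have [c1 [c2 [c3 c4]]] : ncont (frac N x * y) /\ ncont (x * frac N y) /\
  ncont (rs (N `^ s * (1 + N) `^ (- s)) (x * y)) /\ ncont (leib_defect N x y).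
  split; first by apply: ncontM => //; exact: ncont_frac.
  split; first by apply: ncontM => //; exact: ncont_frac.
  by split; [exact: ncontZ|exact: ncont_leib_defect].
have -> : frac N (x * y) = frac N x * y + x * frac N y -
    rs (N `^ s * (1 + N) `^ (- s)) (x * y) - leib_defect N x y.
  by rewrite /leib_defect opprB addrC subrK.
have b := bndB (ncontB (ncontD c1 c2) c3) c4 (bndB (ncontD c1 c2) c3 (bndD c1 c2 b1 b2) b3) b4.
apply: bnd_mono b; rewrite /leib_bound.
have g2 : sn i x * pn (frac N y) + (if i is 0 then 0 else
    (1 * sn i x + C3 * pn x) * sn i (frac N y)) <=
    (2 ^+ i.+1 + 1) * sn i x * sn i.+1 y + C3 * pn x * sn i.+1 y.
  have [f1 h1] := @fin_le 1 i.+1 y (ltn0Sn _) fy.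
  have p1 : pn (frac N y) <= 2 ^+ i.+1 * sn i.+1 y by apply: le_trans h1; exact: (snP f1).
  have -> : (2 ^+ i.+1 + 1) * sn i x * sn i.+1 y + C3 * pn x * sn i.+1 y =
    sn i x * (2 ^+ i.+1 * sn i.+1 y) + (1 * sn i x + C3 * pn x) * sn i.+1 y by ring.
  have q0 : 0 <= 1 * sn i x + C3 * pn x by rewrite mul1r addr_ge0// mulr_ge0.
  apply: lerD; first by rewrite ler_wpM2l.
  by case: (i) fNy hNy q0 Sy => [|j] *; [exact: mulr_ge0|exact: ler_wpM2l].
have g3 : C0 * (sn i x * sn i y) <= 2 * C0 * sn i x * sn i.+1 y.
  have -> : 2 * C0 * sn i x * sn i.+1 y = C0 * (sn i x * (2 * sn i.+1 y)) by ring.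
  by rewrite ler_wpM2l// ler_wpM2l.
have g4 := ler_wpM2r Sy (HC4 _ fx).
apply: le_trans (lerD (lerD (lerD (lexx _) g2) g3) (lexx _)) _.
move: g4; rewrite /k !mulrDl.
move: (sn i.+1 x * pn y) (C1 * pn x * _) (C2 * pn x * _) (C3 * pn x * _) (C4 * pn x * _) => u1 u2 u3 u4 u5.
have -> : e * sn i.+1 x * sn i.+1 y = 4 * (e / 4 * sn i.+1 x * sn i.+1 y) by field.
have : 0 <= e / 4 * sn i.+1 x * sn i.+1 y.
  by apply: mulr_ge0 => //; apply: mulr_ge0; [exact: ltW|exact: sn_ge0].
rewrite mul1r.
move: (e / 4 * sn i.+1 x * sn i.+1 y) (2 ^+ i.+1 * sn i x * sn i.+1 y) (2 * C0 * sn i x * sn i.+1 y).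
move: (sn i x * sn i.+1 y) => v1 v2 v3 v4; lra.
Qed.

Lemma sn_mul_le i e : 0 < e -> exists2 C, 0 <= C & forall x y, fin i.+1 x -> fin i.+1 y ->
  sn i.+1 (x * y) <= sn i.+1 x * pn y + (e * sn i.+1 x + C * pn x) * sn i.+1 y.
Proof.
by move=> e0; have [C C0 HC] := leibnizP i.+1 e0; exists C => // x y fx fy; exact: sn_le (HC x y fx fy).
Qed.

(** * Bessel potentials and the scale *)

(** Continuity at zero bounds [phi]; after rescaling it lies in the unit ball. *)
Lemma F_bounded phi : F phi -> exists2 K, 0 < K & F1 (fun a => (K^-1)%:C * phi a + 0).
Proof.
move=> Fp; have cphi : continuous phi by case: nF => /(_ _ Fp)[].
have /cvg_nrmP/(_ 1 ltr01) := cphi 0.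
move=> /nbhs_ballP[_ /real_pos[d d0 ->]] H.
have Hd v : nrm v < d -> nrm (phi v) <= 1.
  move=> vd; have := H v; rewrite -ball_normE /ball_/= sub0r normrN nrmE ltcR F0// sub0r nrmN.
  by move=> /(_ vd)/ltW.
have d2 : 0 < d / 2 by rewrite divr_gt0.
exists (d / 2)^-1; first by rewrite invr_gt0.
split; first by apply: (F_comb nF) => //; case: nF.
move=> v; rewrite addr0 invrK (_ : _ * phi v = phi ((d / 2)%:C *: v)); last by rewrite FZ.
have [v0|v0] := eqVneq (an v) 0.
  by rewrite (an_eq0 v0) scaler0 F0// nrm0 an0.
have vp : 0 < an v by rewrite lt_neqAle eq_sym v0 an_ge0.
have -> : (d / 2)%:C *: (v : A) = (an v)%:C *: (((d / 2) / an v)%:C *: (v : A)).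
  have ev : an v * (d / 2 / an v) = d / 2 by rewrite mulrC divfK.
  by rewrite scalerA -rmorphM ev.
rewrite FZ//; have := @nrmZr _ R[i]^o (an v) (phi ((d / 2 / an v)%:C *: v)).
rewrite (_ : (an v)%:C *: phi _ = (an v)%:C * phi ((d / 2 / an v)%:C *: v))// => ->.
rewrite ger0_norm ?an_ge0// ler_piMr ?an_ge0// Hd// nrmZr ger0_norm ?divr_ge0 ?an_ge0 ?ltW//.
by rewrite -/(an v) divfK ?gt_eqF// ltr_pdivrMr// ltr_pMr// ltr1n.
Qed.

Lemma fn_scale phi K x : 0 < K ->
  fn phi x = fun t => K * fn (fun a => (K^-1)%:C * phi a + 0) x t.
Proof.
move=> K0; apply/funext => t; rewrite /fn addr0; case: (phi _) => a b /=.
by rewrite mul0r subr0 mulrA mulfV ?gt_eqF// mul1r.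
Qed.

Lemma fn_bcontF phi x : F phi -> bcont (fn phi x).
Proof.
by move=> /F_bounded[K K0 /(fn_bcont x) b]; rewrite (fn_scale _ _ K0); exact: bcontZ.
Qed.

Lemma F_im phi : F phi -> F (fun a => - 'i * phi a + 0).
Proof. by move=> Fp; apply: (F_comb nF) => //; case: nF. Qed.

(** Imaginary parts are real parts of other elements of [F]. *)
Lemma fn_im phi x : (fun t => complex.Im (phi (psi t x))) = fn (fun a => - 'i * phi a + 0) x.
Proof.
apply/funext => t; rewrite /fn addr0; case: (phi _) => a b /=.
by rewrite oppr0 mul0r sub0r mulN1r opprK.
Qed.

(** [x] is the Bessel potential of [y], read on real orbits; [y] need not be
    norm-continuous. *)
Definition is_pot m x y := forall phi, F1 phi -> fn phi x = conv (bpot s m) (fn phi y).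

Lemma is_pot_F m x y : is_pot m x y ->
  forall phi, F phi -> fn phi x = conv (bpot s m) (fn phi y).
Proof.
move=> H phi /F_bounded[K K0 p1]; have pb := pfun_bp (pfun_bpot m s01).
rewrite (fn_scale _ x K0) (fn_scale _ y K0) convZ//; last exact: fn_bcont.
by rewrite (H _ p1).
Qed.

(** The kernel enters only through its Fourier transform, by [cintegral_kernel]. *)
Lemma is_convE r m G x y : r = 2 * s * m%:R -> is_bessel_kernel r G ->
  is_conv F psi G y x <-> is_pot m x y.
Proof.
move=> rsm hG.
have cint phi : F phi -> cintegral (fun t => phi (psi (- t) y) * G t) =
    bpot s m (fn phi y) +i* bpot s m (fn (fun a => - 'i * phi a + 0) y).
  move=> Fp; rewrite -fn_im.
  apply: (cintegral_kernel s01 rsm hG (p := fun t => phi (psi t y))).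
    exact: fn_bcontF.
  by rewrite fn_im; apply: fn_bcontF; exact: F_im.
split=> H phi.
  move=> [Fp _]; apply/funext => t; have Fpt := F_psi t Fp.
  have := H _ Fpt; rewrite (cint _ Fpt) /fn => -> /=; rewrite /conv; congr (bpot s m).
  by apply/funext => h; rewrite psi_psi.
move=> Fp; rewrite (cint _ Fp).
have v0 p : F p -> complex.Re (p x) = bpot s m (fn p y).
  move=> Fp'; have /(congr1 (fun f => f 0)) := is_pot_F H Fp'.
  rewrite /fn psi0 => ->; rewrite /conv; congr (bpot s m).
  by apply/funext => h; rewrite add0r.
rewrite -(v0 _ Fp) -(v0 _ (F_im Fp)) addr0; case: (phi x) => a b /=.
by rewrite oppr0 mul0r sub0r mulN1r opprK.
Qed.

Let pJ : pfun (besF s 1). Proof. exact: pfun_besF. Qed.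

(** [frac N] applied to a potential: a short-range average, which tends to the
    identity as [N] grows. *)
Definition avgF N f := N `^ s * (1 + N) `^ (- s) * besF s (Num.sqrt (1 + N))^-1 f.

Lemma pfun_avgF N : 0 < N -> pfun (avgF N).
Proof.
move=> N0; apply: pfun_scale; last exact: pfun_besF.
by rewrite powR_ratio_le1// mulr_ge0 ?powR_ge0.
Qed.

Lemma frac_besF N g t : 0 < N -> bcont g ->
  N `^ s * (conv (besF s 1) g t - conv (kapF s N) (conv (besF s 1) g) t) = conv (avgF N) g t.
Proof.
move=> N0 gb; have := kapF_besF s01 (ltW N0) (bcont_shift t gb).
rewrite /comp conv_shift -/(conv _ _ _) -/(conv _ _ _) => ->.
by rewrite /conv /avgF mulrA.
Qed.

Lemma fn_frac phi N x : F1 phi -> 0 < N -> ncont x ->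
  fn phi (frac N x) = fun t => N `^ s * (fn phi x t - conv (kapF s N) (fn phi x) t).
Proof.
move=> p1 N0 cx; have Fp : F phi by case: p1.
by rewrite /frac fnZ// fnB// fn_act//; exact: pk.
Qed.

Lemma fn_frac_pot phi N x k g : F1 phi -> 0 < N -> ncont x -> bcont g ->
  fn phi x = conv (bpot s k.+1) g -> fn phi (frac N x) = conv (bpot s k) (conv (avgF N) g).
Proof.
move=> p1 N0 cx gb E; rewrite fn_frac// E conv_bpotS; apply/funext => t.
have pb := pfun_bpot k s01.
rewrite frac_besF//; last exact: bcont_conv.
by rewrite conv_comm//; exact: pfun_avgF.
Qed.

Lemma ncont_hoelder b K x : 0 < b -> (forall h, pn (psi h x - x) <= `|h| `^ b * K) -> ncont x.
Proof.
move=> b0 H e e0; have K1 : 0 < `|K| + 1 by rewrite ltr_wpDl.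
have eK : 0 < e / (`|K| + 1) by rewrite divr_gt0.
exists ((e / (`|K| + 1)) `^ b^-1); first by rewrite powR_gt0.
move=> h hd; apply: le_trans (H h) _.
have h1 : `|h| `^ b <= e / (`|K| + 1).
  have -> : e / (`|K| + 1) = (e / (`|K| + 1)) `^ b^-1 `^ b.
    by rewrite -powRrM mulVf ?gt_eqF// powRr1// ltW.
  by apply: ge0_ler_powR; rewrite ?nnegrE ?powR_ge0// ltW.
apply: (@le_trans _ _ (`|h| `^ b * (`|K| + 1))).
  by rewrite ler_wpM2l ?powR_ge0// (le_trans (ler_norm _))// lerDl.
by rewrite -ler_pdivlMr.
Qed.

(** A potential of order at least one is Hoelder continuous in norm. *)
Lemma ncont_pot m x y : is_pot m.+1 x y -> ncont x.
Proof.
move=> xy; have [s0 _] := andP s01; have [sb _] := hexp_gt s12.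
have [C C0 HC] := holder_optimize s01 ltr01.
apply: (@ncont_hoelder (hexp s) (1 * pn y + C * pn y)); first exact: lt_trans sb.
have P0 := pn_ge0 y; have Q0 : 0 <= 1 * pn y + C * pn y by rewrite mul1r addr_ge0// mulr_ge0.
move=> h; have [->|h0] := eqVneq h 0.
  by rewrite psi0 subrr pn0; apply: mulr_ge0 => //; exact: powR_ge0.
apply: pn_dual => phi t p1; have Fp : F phi by case: p1.
have fb := fn_bcont y p1; have pb := pfun_bpot m s01.
pose g := conv (bpot s m) (fn phi y); have gb : bcont g by exact: bcont_conv.
have gX u : `|g u| <= pn y by apply: conv_bound => // v; exact: fn_le.
have E : fn phi x = conv (besF s 1) g by rewrite (xy _ p1) conv_bpotS.
have fX u : `|fn phi x u| <= pn y by rewrite E; exact: conv_bound.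
rewrite fnB// fn_psi (addrC h); apply: le_trans (ler_norm _) _; apply: HC => //.
  by apply: le_trans (ler_normB _ _) _; rewrite mulr_natl mulr2n lerD.
move=> N N0; apply: (fractional_modulus s01) => //; first exact: fn_bcont.
move=> M u M0; rewrite E frac_besF//; apply: conv_bound => //; exact: pfun_avgF.
Qed.

(** Each [frac N] removes one factor [besF s 1] and leaves a contraction. *)
Lemma bnd_pot k x y L : pfun L -> ncont x ->
  (forall phi, F1 phi -> fn phi x = conv (bpot s k) (conv L (fn phi y))) -> bnd k x (pn y).
Proof.
elim: k x L => [|k IH] x L pL cx H.
  apply: pn_dual => phi t p1; rewrite (H _ p1) conv_dirac0.
  apply: le_trans (ler_norm _) _; apply: conv_bound => //; first exact: fn_bcont.
  by move=> u; exact: fn_le.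
move=> N N0; have pN := pfun_avgF N0.
apply: (IH _ (comp (avgF N) L)); [exact: pfun_comp|exact: ncont_frac|].
move=> phi p1; rewrite conv_comp; apply: fn_frac_pot => //; last exact: H.
by apply: bcont_conv => //; exact: fn_bcont.
Qed.

Lemma fin_pot m x y : is_pot m.+1 x y -> fin m.+1 x /\ sn m.+1 x <= pn y.
Proof.
move=> xy; have cx := ncont_pot xy.
have b : bnd m.+1 x (pn y).
  apply: (bnd_pot (@pfun_dirac0 R) cx) => phi p1; rewrite conv_dirac0; exact: xy.
by split; [exact: fin_of_bnd b|exact: sn_le].
Qed.

Lemma bnd_iter k x K N : 0 < N -> bnd k x K -> pn (iter k (frac N) x) <= K.
Proof. by move=> N0; elim: k x => [//|k IH] x xK; rewrite iterSr; apply/IH/xK. Qed.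

Lemma fn_iter_frac phi N k x g : F1 phi -> 0 < N -> ncont x -> bcont g ->
  fn phi x = conv (bpot s k) g -> fn phi (iter k (frac N) x) = iter k (conv (avgF N)) g.
Proof.
move=> p1 N0; elim: k x g => [|k IH] x g cx gb E; first by rewrite E conv_dirac0.
rewrite !iterSr; apply: IH; [exact: ncont_frac|apply: bcont_conv => //; exact: pfun_avgF|].
exact: fn_frac_pot.
Qed.

Lemma avgF_weight_cvg : (n.+1%:R `^ s * (1 + n.+1%:R : R) `^ (- s)) @[n --> \oo] --> (1 : R).
Proof.
have [s0 _] := andP s01.
have -> : (fun n => n.+1%:R `^ s * (1 + n.+1%:R : R) `^ (- s)) =
    fun n => `|1 - (harmonic n.+1 : R)| `^ s.
  apply/funext => n; have n0 : 0 < 1 + n.+1%:R :> R by rewrite addr_gt0.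
  have -> : 1 - (harmonic n.+1 : R) = n.+1%:R / (1 + n.+1%:R).
    by rewrite /harmonic /= -(natr1 n.+1) addrC; field; rewrite addrC gt_eqF.
  rewrite ger0_norm ?divr_ge0 ?ltW//.
  by have := powR_frac (- s) (ltr0Sn R n) n0; rewrite opprK.
rewrite -[X in _ --> X](one_powR s) -[X in X `^ _]normr1 -[X in `|X|]subr0.
have h : (1 - (harmonic n.+1 : R)) @[n --> \oo] --> (1 - 0 : R).
  by apply: cvgB; [exact: cvg_cst|rewrite (cvg_shiftS (@harmonic R)); exact: cvg_harmonic].
exact: (continuous_cvg _ (@continuous_powR_norm R s s0 _) h).
Qed.

Lemma avgF_radius_cvg : (Num.sqrt (1 + n.+1%:R : R))^-1 @[n --> \oo] --> (0 : R).
Proof.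
have -> : (fun n => (Num.sqrt (1 + n.+1%:R : R))^-1) = fun n => Num.sqrt (harmonic n.+1 : R).
  by apply/funext => n; rewrite /harmonic /= -(natr1 n.+1) addrC sqrtrV.
rewrite -[X in _ --> X]sqrtr0.
have h : (harmonic n.+1 : R) @[n --> \oo] --> (0 : R).
  by rewrite (cvg_shiftS (@harmonic R)); exact: cvg_harmonic.
exact: (continuous_cvg _ (@sqrt_continuous R _) h).
Qed.

Lemma bes1_mass : bes1 s (fun=> 1 : R) = 1.
Proof.
have := symb_besF s01 1 0; rewrite /symb /besF /dil mul0r expr0n/= addr0 one_powR => h.
by rewrite -[RHS]h; congr bes1; apply/funext => x; rewrite mul0r cos0.
Qed.

(** Continuous convergence, unlike pointwise convergence, survives averaging at a
    scale that shrinks to zero. *)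
Lemma avgF_cvg (u : nat -> R -> R) g K : (forall n, bcont (u n)) -> (forall n t, `|u n t| <= K) ->
  (forall (v : nat -> R) t, v n @[n --> \oo] --> t -> u n (v n) @[n --> \oo] --> g t) ->
  forall (v : nat -> R) t, v n @[n --> \oo] --> t ->
    conv (avgF n.+1%:R) (u n) (v n) @[n --> \oo] --> g t.
Proof.
move=> ub uK H v t vt; rewrite -[g t]mul1r /conv /avgF.
apply: cvgM; first exact: avgF_weight_cvg.
have pb := pfun_bes1 s01.
have -> : g t = bes1 s (fun=> g t) by rewrite (bplin_cst _ (pfun_bp pb)) bes1_mass mulr1.
rewrite /besF /dil; apply: (bplin_cvg (pfun_bp pb) (K := K)) => //.
- move=> n; exact: (bcont_scale (Num.sqrt (1 + n.+1%:R))^-1 (bcont_shift (v n) (ub n))).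
- exact: bcont_cst.
- move=> h; apply: (H (fun n => v n + (Num.sqrt (1 + n.+1%:R))^-1 * h)).
  rewrite -[X in _ --> X]addr0; apply: cvgD => //.
  rewrite -(mul0r h); apply: cvgM; [exact: avgF_radius_cvg|exact: cvg_cst].
Qed.

Lemma iter_avgF_cvg k g K : bcont g -> (forall t, `|g t| <= K) ->
  forall (v : nat -> R) t, v n @[n --> \oo] --> t ->
    iter k (conv (avgF n.+1%:R)) g (v n) @[n --> \oo] --> g t.
Proof.
move=> gb gK.
elim: k => [|k IH] v t vt /=; first exact: (continuous_cvg _ (proj1 gb t) vt).
have inv n : bcont (iter k (conv (avgF n.+1%:R)) g) /\
    forall t, `|iter k (conv (avgF n.+1%:R)) g t| <= K.
  have pa := pfun_avgF (ltr0Sn R n).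
  elim: k {IH} => [//|k [IH1 IH2]]; split; first exact: bcont_conv.
  by move=> u; apply: conv_bound.
apply: (@avgF_cvg (fun n => iter k (conv (avgF n.+1%:R)) g) g K) => //.
- by move=> n; case: (inv n).
- by move=> n u; case: (inv n).
Qed.

(** The iterated [frac N] of a potential of [y] tends to [y] weakly as [N] grows; with
    [fin_pot], the Bessel norm is the seminorm [sn]. *)
Lemma pot_norm m x y : is_pot m.+1 x y -> pn y <= sn m.+1 x.
Proof.
move=> xy; have [fx _] := fin_pot xy; have [cx _] := fx; have b := snP fx.
apply: pn_dual => phi t p1; have gb := fn_bcont y p1.
have gK u : `|fn phi y u| <= pn y by exact: fn_le.
have lim := @iter_avgF_cvg m.+1 _ _ gb gK (fun=> t) t (cvg_cst t).
apply: (@cvgr_to_le _ \oo _ _ (fun n => iter m.+1 (conv (avgF n.+1%:R)) (fn phi y) t)).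
  exact: lim.
apply: nearW => n.
rewrite -(fn_iter_frac p1 (ltr0Sn R n) cx gb (xy _ p1)).
apply: le_trans (ler_norm _) _; apply: le_trans (fn_le _ _ p1) _.
exact: (bnd_iter (ltr0Sn R n) b).
Qed.

Let pB m : pfun (bpot s m). Proof. exact: pfun_bpot. Qed.

(** * Construction of potentials *)

Lemma is_potD m x x' y y' : is_pot m x y -> is_pot m x' y' -> is_pot m (x + x') (y + y').
Proof.
move=> H H' phi p1; have Fp : F phi by case: p1.
rewrite !fnD// H// H'// (convD (pfun_bp (pB m)))//; exact: fn_bcont.
Qed.

Lemma is_pot_rs m k x y : is_pot m x y -> is_pot m (rs k x) (rs k y).
Proof.
move=> H phi p1; have Fp : F phi by case: p1.
by rewrite !fnZ// H// (convZ _ (pfun_bp (pB m)))//; exact: fn_bcont.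
Qed.

Lemma is_potB m x x' y y' : is_pot m x y -> is_pot m x' y' -> is_pot m (x - x') (y - y').
Proof. by move=> H H'; rewrite -!rsN; apply: is_potD => //; exact: is_pot_rs. Qed.

Lemma bpot_mass m : bpot s m (fun=> 1) = 1.
Proof.
have := symb_bpot m 0 s01; rewrite /symb expr0n/= addr0 one_powR => h.
by rewrite -[RHS]h; congr (bpot s m); apply/funext => x; rewrite mul0r cos0.
Qed.

Lemma is_pot1 m : is_pot m 1 1.
Proof.
move=> phi p1; apply/funext => t; rewrite /conv.
rewrite (_ : (fun h => _) = fun=> fn phi 1 t); last first.
  by apply/funext => h; rewrite /fn !psi1.
by rewrite (bplin_cst _ (pfun_bp (pB m))) bpot_mass mulr1.
Qed.

Lemma is_pot_lim m x y : (forall e, 0 < e -> exists u w,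
  [/\ is_pot m u w, pn (x - u) <= e & pn (y - w) <= e]) -> is_pot m x y.
Proof.
move=> H phi p1; have Fp : F phi by case: p1.
apply/funext => t; apply/eqP; rewrite -subr_eq0 -normr_le0.
apply/ler_addgt0Pl => e e0; rewrite addr0.
have [u [w [uw xu yw]]] := H _ (divr_gt0 e0 (ltr0n R 2)).
have h1 : `|fn phi x t - fn phi u t| <= e / 2.
  by apply: le_trans xu; have := fn_le (x - u) t p1; rewrite fnB.
have h2 : `|conv (bpot s m) (fn phi y) t - conv (bpot s m) (fn phi w) t| <= e / 2.
  have -> : conv (bpot s m) (fn phi y) t - conv (bpot s m) (fn phi w) t =
      conv (bpot s m) (fn phi (y - w)) t.
    by rewrite fnB// (convB (pfun_bp (pB m)))//; exact: fn_bcont.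
  by apply: conv_bound => // [|v]; [exact: fn_bcont|apply: le_trans yw; exact: fn_le].
move: h1 h2; rewrite (uw _ p1).
move: (fn phi x t) (conv _ _ t) (conv _ _ t) => p q r.
by rewrite !ler_norml => /andP[? ?] /andP[? ?]; apply/andP; split; lra.
Qed.

(** Completeness of the potential space: the series of the [y] converges in norm, and
    its sum is a preimage of [x] because [bpot s m] is a contraction. *)
Lemma is_pot_series m x (z : nat -> alg A) B : 0 <= B ->
  (forall k, exists2 y, is_pot m (z k) y & pn y <= B * 2^-1 ^+ k) ->
  (forall e, 0 < e -> exists n, forall n', (n <= n')%N -> pn (x - \sum_(k < n') z k) <= e) ->
  exists2 y, is_pot m x y & pn y <= 2 * B.
Proof.
move=> B0 Hz Hx; have [y /all_and2[zy yB]] := choice (fun k =>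
  let: ex_intro2 y a b := Hz k in ex_intro (fun y => is_pot m (z k) y /\ pn y <= B * 2^-1 ^+ k) y (conj a b)).
pose u n := \sum_(k < n) z k; pose w n := \sum_(k < n) y k.
have uw n : is_pot m (u n) (w n).
  elim: n => [|n IH]; last by rewrite /u /w !big_ord_recr; exact: is_potD.
  rewrite /u /w !big_ord0 -(rs0 1); apply: is_pot_rs; exact: is_pot1.
have geo n p : pn (w (n + p)%N - w n) <= 2 * B * 2^-1 ^+ n * (1 - 2^-1 ^+ p).
  elim: p => [|p IH]; first by rewrite addn0 subrr pn0 expr0 subrr mulr0.
  have -> : w (n + p.+1)%N - w n = (w (n + p)%N - w n) + y (n + p)%N.
    by rewrite /w addnS big_ord_recr/= addrAC.
  apply: le_trans (pnD _ _) _; apply: le_trans (lerD IH (yB _)) _.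
  rewrite exprD (exprS _ p); move: (2^-1 ^+ n) (2^-1 ^+ p) => q q'.
  by rewrite le_eqVlt; apply/orP; left; apply/eqP; field.
have geo' n p : pn (w (n + p)%N - w n) <= 2 * B * 2^-1 ^+ n.
  apply: le_trans (geo n p) _; apply: ler_piMr.
    by rewrite !mulr_ge0// exprn_ge0// invr_ge0.
  by rewrite lerBlDr lerDl exprn_ge0// invr_ge0.
have small e : 0 < e -> exists n, 2 * B * 2^-1 ^+ n <= e.
  move=> e0; have B1 : 0 < 2 * B + 1 by rewrite ltr_wpDl// mulr_ge0.
  have /cvgrPdist_le/(_ _ (divr_gt0 e0 B1))[n _ /(_ n (leqnn n))] :
      (2^-1 ^+ n : R) @[n --> \oo] --> (0 : R).
    by apply: cvg_expr; rewrite ger0_norm ?invr_ge0// invf_lt1// ltr1n.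
  rewrite /= sub0r normrN ger0_norm ?exprn_ge0 ?invr_ge0// => hn; exists n.
  apply: (@le_trans _ _ ((2 * B + 1) * 2^-1 ^+ n)).
    by rewrite ler_wpM2r ?exprn_ge0 ?invr_ge0// lerDl.
  by rewrite mulrC -ler_pdivlMr.
have [|y0 Hy] := @pn_complete w.
  move=> e /divr_gt0/(_ (ltr0n R 2))/small[n hn]; exists n => p q /subnKC <- /subnKC <-.
  have := pnB (w (n + (p - n))%N - w n) (w (n + (q - n))%N - w n).
  rewrite opprB addrA subrK => h; apply: le_trans h _.
  have := geo' n (p - n)%N; have := geo' n (q - n)%N.
  by move: (pn _) (pn _) hn => p1 p2; lra.
exists y0.
  apply: is_pot_lim => e e0; have [n1 H1] := Hx _ e0; have [n2 H2] := Hy _ e0.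
  exists (u (maxn n1 n2)), (w (maxn n1 n2)); split; [exact: uw|exact/H1/leq_maxl|exact/H2/leq_maxr].
apply/ler_addgt0Pl => e e0; have [n Hn] := Hy _ e0.
have := pnD (y0 - w n) (w n); rewrite subrK.
have := Hn n (leqnn n); have := geo' 0%N n; rewrite add0n [w 0%N]big_ord0 subr0 expr0 mulr1.
move: (pn _) (pn _) (pn _) => p1 p2 p3; lra.
Qed.

Definition avg N x : alg A := act (besF s (Num.sqrt (1 + N))^-1) x.

Let pavg N : pfun (besF s (Num.sqrt (1 + N))^-1). Proof. exact: pfun_besF. Qed.

Lemma ncont_avg N x : ncont x -> ncont (avg N x).
Proof. exact: ncont_act. Qed.

(** The vector whose Bessel potential of order [2 s] is [avg N x]. *)
Definition unpot N x : alg A := rs ((N `^ s * (1 + N) `^ (- s))^-1) (frac N x).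

(** Smoothing at scale [(1 + N) ^ -1/2] factors through the Bessel potential. *)
Lemma avg_pot N phi x : F1 phi -> 0 < N -> ncont x ->
  fn phi (avg N x) = conv (besF s 1) (fn phi (unpot N x)).
Proof.
move=> p1 N0 cx; have Fp : F phi by case: p1.
have N1 : 0 < 1 + N by rewrite addr_gt0.
have c0 : N `^ s * (1 + N) `^ (- s) != 0 by rewrite mulf_neq0// gt_eqF ?powR_gt0.
have fb := fn_bcont x p1; have bk := bcont_conv (pfun_kapF s01 (ltW N0)) fb.
rewrite /avg fn_act// /unpot fnZ// fn_frac//; apply/funext => t.
have bJ := pfun_bp pJ.
rewrite (convZ _ bJ); last by apply: bcontZ; exact: bcontB.
rewrite (convZ _ bJ) ?(convB bJ)//; last exact: bcontB.
rewrite (conv_comm pJ (pfun_kapF s01 (ltW N0)) fb) frac_besF// /avgF /conv -/(avgF _ _).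
by rewrite /avgF mulrA mulVf// mul1r.
Qed.

Lemma ncont_unpot N x : 0 < N -> ncont x -> ncont (unpot N x).
Proof. by move=> N0 cx; apply: ncontZ; exact: ncont_frac. Qed.

Lemma is_pot_avg N x k : 0 < N -> ncont x ->
  is_pot k (iter k (avg N) x) (iter k (unpot N) x).
Proof.
move=> N0 cx.
have cn j : ncont (iter j (avg N) x) /\ ncont (iter j (unpot N) x).
  by elim: j => [//|j [IH IH']]; split; [exact: ncont_avg|exact: ncont_unpot].
elim: k => [|k IH] phi p1; first by rewrite conv_dirac0.
have [c1 c2] := cn k; rewrite !iterS {1}/avg fn_act// (IH _ p1).
have gb := fn_bcont (iter k (unpot N) x) p1.
rewrite (conv_comm (pavg N) (pB k) gb) -fn_act// -/(avg N _) avg_pot//.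
rewrite conv_bpotS conv_comm//; exact: fn_bcont.
Qed.

Lemma pn_unpot N k x : 0 < N -> ncont x ->
  pn (iter k (unpot N) x) <= (`|(N `^ s * (1 + N) `^ (- s))^-1| * (N `^ s * 2)) ^+ k * pn x.
Proof.
move=> N0; elim: k x => [|k IH] x cx; first by rewrite expr0 mul1r.
rewrite iterSr; apply: le_trans (IH _ (ncont_unpot N0 cx)) _.
set q := (X in X ^+ k); have q0 : 0 <= q by rewrite !mulr_ge0// powR_ge0.
rewrite exprSr -mulrA ler_wpM2l ?exprn_ge0//.
apply: le_trans (pnZ _ _) _; rewrite /q -mulrA ler_wpM2l//.
by apply: le_trans (pn_frac_le N0 cx) _; rewrite mulrA.
Qed.

Lemma pn_act_sub L x (r : R -> R) : pfun L -> L (fun=> 1) = 1 -> ncont x -> bcont r ->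
  (forall h, pn (psi h x - x) <= r h) -> pn (act L x - x) <= L r.
Proof.
move=> pL L1 cx rb H; apply: pn_dual => phi t p1; have Fp : F phi by case: p1.
have fb := fn_bcont x p1; rewrite fnB// fn_act//.
rewrite -[fn phi x t]mulr1 -L1 -(bplin_cst _ (pfun_bp pL)) /conv.
rewrite -(bplinB (pfun_bp pL)); [|exact: bcont_shift|exact: bcont_cst].
apply: le_trans (ler_norm _) _; apply: pfun_norm_le => //.
  by apply: bcontB; [exact: bcont_shift|exact: bcont_cst].
move=> h; apply: le_trans (H h); have := fn_le (psi h x - x) t p1.
by rewrite fnB// fn_psi (addrC h).
Qed.

(** Turns two bounds for one quantity, by [Z `|h| ^ p] and by [T], into a bound by a
    truncated modulus. *)
Lemma tmod_or (p T Z h : R) : 0 <= Z ->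
  Z * tmod p (T / Z) h = Z * `|h| `^ p \/ Z * tmod p (T / Z) h = T.
Proof.
move=> Z0; have [hn|hn] := leP (`|h| `^ p) (T / Z); rewrite /tmod.
  by left; rewrite (min_idPl hn).
rewrite (min_idPr (ltW hn)); have [->|Znz] := eqVneq Z 0; first by left; rewrite !mul0r.
by right; rewrite mulrC divfK.
Qed.

(** The scale at which smoothing is accurate depends only on bounds for the vector. *)
Lemma avg_small (b Q V e : R) : 0 < b -> 0 < Q -> 0 < V -> 0 < e -> exists2 N, 0 < N &
  forall x, ncont x -> pn x <= V -> (forall h, pn (psi h x - x) <= Q * `|h| `^ b) ->
  pn (avg N x - x) <= e.
Proof.
move=> b0 Q0 V0 e0; pose r h := Q * tmod b (2 * V / Q) h.
have n0 : 0 <= 2 * V / Q by rewrite divr_ge0 ?mulr_ge0 ?ltW.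
have rb : bcont r by apply: bcontZ; exact: bcont_tmod.
have p1 := pfun_bes1 s01.
have := dil_cvg p1 rb avgF_radius_cvg.
have -> : dil 0 (bes1 s) r = 0.
  rewrite /dil (_ : (fun h => _) = fun=> 0); first by rewrite (bplin_cst _ (pfun_bp p1)) mul0r.
  apply/funext => h; rewrite mul0r /r /tmod normr0 powR0 ?gt_eqF//.
  by rewrite (min_idPl n0) mulr0.
move=> /cvgrPdist_le/(_ e e0)[n _ /(_ n (leqnn n))]; rewrite /= sub0r normrN => hn.
exists n.+1%:R => // x cx xV xQ; apply: le_trans (le_trans (ler_norm _) hn).
apply: pn_act_sub => //.
  by have := symb_besF s01 (Num.sqrt (1 + n.+1%:R))^-1 0; rewrite /symb mul0r expr0n/= addr0 one_powR => h;
  rewrite -[RHS]h; congr besF; apply/funext => u; rewrite mul0r cos0.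
move=> h; rewrite /r; have [->|->] := tmod_or b (2 * V) h (ltW Q0); first exact: xQ.
apply: le_trans (pnB _ _) _; rewrite pn_psi; move: (pn x) xV => p; lra.
Qed.

Lemma iter_avg_small N e k x : 0 < N -> ncont x -> pn (avg N x - x) <= e ->
  pn (iter k (avg N) x - x) <= k%:R * e /\ pn (iter k (avg N) x) <= pn x.
Proof.
move=> N0 cx xe.
have cn j : ncont (iter j (avg N) x) by elim: j => [//|j IH]; exact: ncont_avg.
elim: k => [|k [IH IH']]; first by rewrite /= subrr pn0 mul0r.
rewrite iterS; split; last by apply: le_trans IH'; exact: pn_act.
have -> : avg N (iter k (avg N) x) - x = avg N (iter k (avg N) x - x) + (avg N x - x).
  by rewrite [avg N (_ - x)]/avg (actB (pavg N) (cn k) cx) -!/(avg N _) addrA subrK.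
apply: le_trans (pnD _ _) _; rewrite -natr1 mulrDl mul1r lerD//.
by apply: le_trans IH; apply: pn_act => //; exact: ncontB.
Qed.

(** * Inversion *)

Lemma increment_inverse a x h : x * a = 1 -> a * x = 1 ->
  psi h x - x = psi h x * (a - psi h a) * x.
Proof.
by move=> xa ax; rewrite mulrBr mulrBl -psiM xa psi1 mul1r -mulrA ax mulr1.
Qed.

Lemma pn_increment_inverse a x h : x * a = 1 -> a * x = 1 ->
  pn (psi h x - x) <= pn x ^+ 2 * pn (psi h a - a).
Proof.
move=> xa ax; rewrite (increment_inverse h xa ax) (pnBC (psi h a)).
apply: le_trans (pnM _ _) _; rewrite expr2 -mulrA mulrCA [leRHS]mulrC ler_wpM2r ?pn_ge0//.
by apply: le_trans (pnM _ _) _; rewrite pn_psi.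
Qed.

Lemma ncont_inverse a x : x * a = 1 -> a * x = 1 -> ncont a -> ncont x.
Proof.
move=> xa ax ca e e0; have X0 : 0 < pn x ^+ 2 + 1 by rewrite ltr_wpDl// sqr_ge0.
have [d d0 Hd] := ca _ (divr_gt0 e0 X0); exists d => // h /Hd ha.
apply: le_trans (pn_increment_inverse h xa ax) _.
apply: (@le_trans _ _ ((pn x ^+ 2 + 1) * (e / (pn x ^+ 2 + 1)))).
  by apply: ler_pM => //; [exact: sqr_ge0|exact: pn_ge0|rewrite lerDl].
by rewrite mulrC divfK// gt_eqF.
Qed.

(** The inverse [x] of [a] is approximated by a potential [b]; then [1 - a b] is
    small in norm, and [x] is the sum of the series of the [b (1 - a b) ^ k].  By
    the Leibniz rule the series converges also in the Bessel norm, since there the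
    smallness in norm governs the main term. *)
Lemma inverse_pot m (A0 V0 : R) : 0 < A0 -> 0 < V0 ->
  (forall a b, (exists y, is_pot m.+1 a y) -> (exists y, is_pot m.+1 b y) ->
     exists y, is_pot m.+1 (a * b) y) ->
  exists2 H, 0 <= H & forall a x ya, is_pot m.+1 a ya -> pn ya <= A0 ->
    x * a = 1 -> a * x = 1 -> pn x <= V0 -> exists2 y, is_pot m.+1 x y & pn y <= H.
Proof.
move=> A00 V00 Pmul; have A00' := ltW A00; have V00' := ltW V00.
have [s0 _] := andP s01; have [sb _] := hexp_gt s12.
have b0 : 0 < hexp s by exact: lt_trans sb.
have [C1 C10 HC1] := bnd_hoelder_small 0 ltr01.
pose A1 := 2 ^+ m.+1 * A0; have A10 : 0 <= A1 by rewrite mulr_ge0// exprn_ge0.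
(* A Hoelder constant for the inverse; the summand one makes it positive. *)
pose Q := V0 ^+ 2 * ((1 + C1) * A1) + 1.
have Q0 : 0 < Q by rewrite ltr_wpDl// mulr_ge0 ?sqr_ge0// mulr_ge0// addr_ge0.
(* [m + 1] smoothings, each of accuracy [e1], keep the norm of [1 - a b] below 1/8. *)
pose e1 := (8 * (A1 + 1) * m.+1%:R)^-1.
have e10 : 0 < e1 by rewrite invr_gt0 !mulr_gt0// ltr_wpDl.
have [N N0 HN] := avg_small b0 Q0 V00 e10.
pose S0 := (`|(N `^ s * (1 + N) `^ (- s))^-1| * (N `^ s * 2)) ^+ m.+1 * V0.
have S00 : 0 <= S0 by rewrite mulr_ge0// exprn_ge0// !mulr_ge0// powR_ge0.
have [Cs Cs0 HCs] := leibniz_submult (@leibnizP m.+1).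
pose Sc := pn 1 + Cs * (A0 * S0).
have Sc0 : 0 <= Sc.
  by apply: addr_ge0; [exact: pn_ge0|apply: mulr_ge0 => //; exact: mulr_ge0].
(* [Sc] bounds the seminorm of [1 - a b], so that [e2 Sc] is below 1/8. *)
pose e2 := (8 * (Sc + 1))^-1.
have e20 : 0 < e2 by rewrite invr_gt0 mulr_gt0// ltr_wpDl.
have [C C0 HC] := sn_mul_le m e20.
(* With both contributions to the main term at most 1/8, [B / 2 ^ k] solves the
   recursive inequality for the seminorms of the terms of the series. *)
pose B := S0 + 4 * (C * Sc * V0); have B0 : 0 <= B.
  by apply: addr_ge0 => //; apply: mulr_ge0 => //; apply: mulr_ge0 => //; exact: mulr_ge0.
exists (2 * B) => [|a x ya aya yaA xa ax xV]; first by rewrite mulr_ge0.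
have [fa sa] := fin_pot aya; have {}sa := le_trans sa yaA; have [ca _] := fa.
have a1 j : (j <= m.+1)%N -> sn j a <= A1.
  by move=> /fin_le/(_ fa)[_ /le_trans]; apply; rewrite ler_wpM2l ?exprn_ge0.
have pa : pn a <= A1 by have := a1 0%N isT; rewrite sn0.
have cx := ncont_inverse xa ax ca.
have X0 := pn_ge0 x.
have hx h : pn (psi h x - x) <= Q * `|h| `^ hexp s.
  have [f1a _] := fin_le (ltn0Sn m) fa.
  have h1 : pn (psi h a - a) <= `|h| `^ hexp s * ((1 + C1) * A1).
    apply: le_trans (HC1 _ h f1a) _; rewrite ler_wpM2l ?powR_ge0// mulrDl lerD//.
      by rewrite !mul1r; exact: a1.
    by rewrite ler_wpM2l.
  apply: le_trans (pn_increment_inverse h xa ax) _.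
  apply: (@le_trans _ _ (V0 ^+ 2 * (`|h| `^ hexp s * ((1 + C1) * A1)))).
    by apply: ler_pM => //; [exact: sqr_ge0|exact: pn_ge0|rewrite ler_sqr ?nnegrE].
  by rewrite mulrCA mulrC ler_wpM2r ?powR_ge0// lerDl.
have [hb pb] := iter_avg_small m.+1 N0 cx (HN _ cx xV hx).
have bP := is_pot_avg m.+1 N0 cx; set b := iter m.+1 (avg N) x in hb pb bP.
have [fb sb'] := fin_pot bP; have [cb _] := fb.
have {}sb' : sn m.+1 b <= S0.
  apply: le_trans sb' _; apply: le_trans (pn_unpot m.+1 N0 cx) _.
  by rewrite ler_wpM2l// exprn_ge0// !mulr_ge0// powR_ge0.
have {}pb := le_trans pb xV.
pose c := 1 - a * b.
have xc : x * c = x - b by rewrite /c mulrBr mulr1 mulrA xa mul1r.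
have pc : pn c <= 8^-1.
  have -> : c = a * (x - b) by rewrite /c mulrBr ax.
  apply: le_trans (pnM _ _) _; rewrite (pnBC x).
  apply: (@le_trans _ _ ((A1 + 1) * (m.+1%:R * e1))).
    by apply: ler_pM => //; [exact: pn_ge0|exact: pn_ge0|apply: le_trans pa _; rewrite lerDl].
  rewrite /e1 le_eqVlt; apply/orP; left; apply/eqP; field.
  by rewrite !gt_eqF// ltr_wpDl.
have [yab abp] := Pmul _ _ (ex_intro _ _ aya) (ex_intro _ _ bP).
have cpot := is_potB (is_pot1 m.+1) abp; rewrite -/c in cpot.
have [fc _] := fin_pot cpot; have [cc _] := fc.
have sc : sn m.+1 c <= Sc.
  have [f1 s1] := fin_pot (is_pot1 m.+1).
  apply: sn_le; apply: bndB; [exact: ncont1|exact: ncontM| |].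
    exact: bnd_mono s1 (snP f1).
  apply: bnd_mono (HCs a b _ _ ca cb (snP fa) (snP fb)).
  by rewrite ler_wpM2l// ler_pM// sn_ge0.
have C0' : 0 <= pn c by exact: pn_ge0.
pose z k := b * c ^+ k.
have zS k : z k.+1 = z k * c by rewrite /z exprSr mulrA.
have zP k : [/\ exists y, is_pot m.+1 (z k) y, sn m.+1 (z k) <= B * 2^-1 ^+ k &
    pn (z k) <= V0 * 2^-1 ^+ k].
  elim: k => [|k [[y zy] IH1 IH2]].
    rewrite /z expr0 !mulr1; split=> //; first by exists (iter m.+1 (unpot N) x).
    by apply: le_trans sb' _; rewrite lerDl !mulr_ge0.
  have [fz _] := fin_pot zy; have Z0 := sn_ge0 fz; have P0 := pn_ge0 (z k).
  have Sc0' := sn_ge0 fc.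
  rewrite zS exprSr; split; first by apply: Pmul; [exists y|eexists; exact: cpot].
    apply: le_trans (HC _ _ fz fc) _.
    have g1 : sn m.+1 (z k) * pn c <= sn m.+1 (z k) * 8^-1 by rewrite ler_wpM2l.
    have g2 : (e2 * sn m.+1 (z k) + C * pn (z k)) * sn m.+1 c <=
        (e2 * sn m.+1 (z k) + C * pn (z k)) * Sc.
      by rewrite ler_wpM2l// addr_ge0// mulr_ge0// ltW.
    have g3 : e2 * Sc <= 8^-1.
      rewrite /e2 invfM -mulrA ler_piMr// mulrC ler_pdivrMr ?mul1r ?lerDl//.
      by rewrite ltr_wpDl.
    have g4 := ler_wpM2r Z0 g3.
    have g5 : C * Sc * pn (z k) <= C * Sc * (V0 * 2^-1 ^+ k) by rewrite ler_wpM2l// mulr_ge0.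
    apply: le_trans (lerD g1 g2) _.
    have -> : (e2 * sn m.+1 (z k) + C * pn (z k)) * Sc =
      e2 * Sc * sn m.+1 (z k) + C * Sc * pn (z k) by ring.
    apply: le_trans (lerD (lexx _) (lerD g4 g5)) _.
    have -> : B * (2^-1 ^+ k * 2^-1) = 4^-1 * (B * 2^-1 ^+ k) +
        4^-1 * (S0 * 2^-1 ^+ k) + C * Sc * (V0 * 2^-1 ^+ k) by rewrite /B; field.
    have : 0 <= S0 * 2^-1 ^+ k by rewrite mulr_ge0// exprn_ge0// invr_ge0.
    move: IH1; move: (sn _ _) (B * _) (S0 * _) (C * Sc * _) => p1 p2 p3 p4; lra.
  apply: le_trans (pnM _ _) _; rewrite mulrA ler_pM//.
  by apply: le_trans pc _; rewrite lef_pV2 ?posrE// ler_nat.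
have tail n : x - \sum_(k < n) z k = x * c ^+ n.
  elim: n => [|n IH]; first by rewrite big_ord0 subr0 expr0 mulr1.
  by rewrite big_ord_recr/= opprD addrA IH /z -mulrBl -xc -mulrA -exprS.
have pcn n : pn (x * c ^+ n) <= V0 * 2^-1 ^+ n.
  elim: n => [|n IH]; first by rewrite !expr0 !mulr1.
  rewrite !exprSr !mulrA; apply: le_trans (pnM _ _) _; rewrite ler_pM ?pn_ge0//.
  by apply: le_trans pc _; rewrite lef_pV2 ?posrE// ler_nat.
apply: (@is_pot_series _ _ z B) => //.
  move=> k; have [[y zy] sz _] := zP k; exists y => //.
  exact: le_trans (pot_norm zy) sz.
move=> e e0.
have /cvgrPdist_le/(_ _ (divr_gt0 e0 V00))[n _ Hn] : (2^-1 ^+ n : R) @[n --> \oo] --> (0 : R).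
  by apply: cvg_expr; rewrite ger0_norm ?invr_ge0// invf_lt1// ltr1n.
exists n => n' /Hn; rewrite /= sub0r normrN ger0_norm ?exprn_ge0 ?invr_ge0// tail => hn.
by apply: le_trans (pcn n') _; rewrite mulrC -ler_pdivlMr.
Qed.

(** * The cubic bound *)

Lemma frac1 N : 0 < N -> frac N 1 = rs (N `^ s * (1 + N) `^ (- s)) 1.
Proof.
move=> N0; rewrite /frac -rsA; congr (rs _ _).
apply: pn_inj => phi p1 t; have Fp : F phi by case: p1.
have E : fn phi 1 = fun=> fn phi 1 0 by apply/funext => h; rewrite /fn !psi1.
rewrite fnB// fnZ// fn_act//; [|exact: pk|exact: ncont1].
rewrite E /conv (bplin_cst _ (pfun_bp (pk N0))) (kapF_mass s01 (ltW N0)).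
by move: (fn _ _ _) (_ `^ _) => p q; ring.
Qed.

Lemma pn_one_ge1 : 1 <= pn 1.
Proof.
apply: le_trans (an_le_pn 1); have := anM (1 : alg A) 1; rewrite mulr1.
have : 0 < an (1 : alg A).
  rewrite lt_neqAle an_ge0 andbT eq_sym; apply: contra_neq (oner_neq0 (alg A)).
  exact: an_eq0.
by move=> a0; rewrite -[X in X <= _]mulr1 ler_pM2l.
Qed.

(** At order one the Leibniz rule, applied to [x a = 1], expresses [frac N x] through
    [frac N a] and the defect, in which the increments of [x] are bounded by those of
    [a]. The three resulting terms are brought to the form of the largest one by
    [1 <= 2 pn x sn 1 a]. *)
Lemma bnd_inverse : exists2 K, 0 <= K & forall a x, fin 1 a -> x * a = 1 -> a * x = 1 ->
  bnd 1 x (K * pn x ^+ 3 * sn 1 a ^+ 2).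
Proof.
set b := hexp s; have [sb b1] := hexp_gt s12; rewrite -/b in sb b1.
have [s0 _] := andP s01; have bpos : 0 < 2 * b by rewrite mulr_gt0// (lt_trans s0).
have [Ct Ct0 HCt] := kapF_tmod s01 sb b1.
have [C C0 HC] := bnd_hoelder_small 0 ltr01.
pose k := 1 + C * 2; have k0 : 0 <= k by rewrite addr_ge0// mulr_ge0.
exists (Ct * k ^+ 2 + 10) => [|a x fa xa ax]; first by rewrite addr_ge0// mulr_ge0// sqr_ge0.
have [ca _] := fa; have cx := ncont_inverse xa ax ca.
have [_ pa] := fin_lower fa; rewrite sn0// in pa.
have S0 := sn_ge0 fa; have X0 := pn_ge0 x; have P0 := pn_ge0 a.
set S := sn 1 a in pa S0 *; set X := pn x in X0 *.
have XS : 1 <= 2 * (X * S).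
  apply: le_trans pn_one_ge1 _; rewrite -xa; apply: le_trans (pnM _ _) _.
  by rewrite mulrCA ler_wpM2l.
move=> N N0; have pN := pk N0; set w := leib_defect N x a.
pose Z := X ^+ 2 * (k * S) ^+ 2; pose T := X ^+ 2 * (2 * pn a) ^+ 2.
have Z0 : 0 <= Z by rewrite mulr_ge0// sqr_ge0.
have T0 : 0 <= T by rewrite mulr_ge0// sqr_ge0.
have n0 : 0 <= T / Z by rewrite divr_ge0.
have hw : pn w <= Ct * Z.
  pose v h := (psi h x - x) * (psi h a - a).
  pose r h := Z * tmod (2 * b) (T / Z) h.
  have : bnd 0 w (N `^ s * kapF s N r).
    apply: (@bnd_integral 0 (kapF s N) (N `^ s) _ v) => //.
    - exact: powR_ge0.
    - exact: ncont_leib_defect.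
    - by move=> h; apply: ncontM; apply: ncontB => //; exact: ncont_psi.
    - by move=> l K K0 cl; exact: (leib_defect_fun N0 cx ca K0 cl).
    - by apply: bcontZ; exact: bcont_tmod.
    move=> h; have hv : pn (v h) <= X ^+ 2 * pn (psi h a - a) ^+ 2.
      apply: le_trans (pnM _ _) _; rewrite [pn (psi h a - a) ^+ 2]expr2 mulrA ler_wpM2r ?pn_ge0//.
      exact: pn_increment_inverse.
    apply: le_trans hv _; have q0 := pn_ge0 (psi h a - a).
    rewrite /r; have [->|->] := tmod_or (2 * b) T h Z0; last first.
      rewrite ler_wpM2l ?sqr_ge0// ler_sqr ?nnegrE// ?mulr_ge0//.
      by apply: le_trans (pnB _ _) _; rewrite pn_psi mulr_natl mulr2n.
    rewrite /Z -mulrA ler_wpM2l ?sqr_ge0//.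
    rewrite (_ : 2 * b = b + b); last by rewrite mulr_natl mulr2n.
    rewrite powRD; last by apply/implyP; rewrite gt_eqF// -mulr2n -mulr_natl.
    rewrite -expr2 -exprMn ler_sqr ?nnegrE// ?mulr_ge0 ?powR_ge0//.
    apply: le_trans (HC _ h fa) _; rewrite mulrC ler_wpM2r ?powR_ge0//.
    by rewrite /k mulrDl lerD2l -mulrA ler_wpM2l.
  move=> /= h; apply: le_trans h _.
  rewrite /r (bplinZ (pfun_bp pN)); last exact: bcont_tmod.
  rewrite mulrCA [leRHS]mulrC ler_wpM2l//.
  apply: le_trans (ler_wpM2l (powR_ge0 _ _) (HCt _ _ (ltW N0) n0)) _.
  by rewrite mulrCA ler_piMr// powR_ratio_le1.
set q := N `^ s * (1 + N) `^ (- s) in w hw *.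
have q0 : 0 <= q by rewrite mulr_ge0 ?powR_ge0.
have q1 : q <= 1 by exact: powR_ratio_le1.
have -> : frac N x = (w * x - x * frac N a * x) + rs (q + q) x.
  have E : w = frac N x * a + x * frac N a - rs (q + q) 1.
    by rewrite /w /leib_defect xa frac1// -/q rsDl opprD addrA.
  by rewrite E mulrBl mulrDl -(mulrA _ a x) ax mulr1 rsAl mul1r [_ - _ - _]addrAC addrK subrK.
have h1 : pn (w * x) <= Ct * Z * X by apply: le_trans (pnM _ _) _; rewrite ler_wpM2r.
have h2 : pn (x * frac N a * x) <= X * S * X.
  apply: le_trans (pnM _ _) _; rewrite ler_wpM2r//; apply: le_trans (pnM _ _) _.
  by rewrite ler_wpM2l//; exact: (snP fa).
have h3 : pn (rs (q + q) x) <= 2 * X.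
  apply: le_trans (pnZ _ _) _; rewrite ger0_norm ?addr_ge0// ler_wpM2r//; lra.
have h4 := pnD (w * x - x * frac N a * x) (rs (q + q) x).
have h5 := pnB (w * x) (x * frac N a * x).
apply: le_trans h4 _; apply: le_trans (lerD (le_trans h5 (lerD h1 h2)) h3) _.
have -> : (Ct * k ^+ 2 + 10) * X ^+ 3 * S ^+ 2 = Ct * Z * X + 10 * (X * S) ^+ 2 * X.
  by rewrite /Z; ring.
rewrite -addrA lerD2l -mulrDl ler_wpM2r//.
move: (X * S) XS => u u1; nra.
Qed.

Lemma pn_le_an : exists2 M, 0 < M & forall x, pn x <= M * an x.
Proof.
have [M [M0 HM]] := psi_bound; exists (M + 1); first by rewrite ltr_wpDl.
move=> x; apply: pn_le => t; apply: le_trans (HM t x) _.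
by rewrite ler_wpM2r ?an_ge0// lerDl.
Qed.

Lemma bessel_normP r m G x : r = 2 * s * m%:R -> is_bessel_kernel r G ->
  bessel_potential F psi G x ->
  exists2 y, is_pot m x y & bessel_norm F psi G x = an y.
Proof.
move=> rsm hG [y xy]; rewrite /bessel_norm; case: xgetP => [_ -> [z /= xz <-]|none].
  by exists z => //; exact: (is_convE _ _ rsm hG).1.
by case: (none (nrm y)); exists y.
Qed.

Lemma bessel_control r m G : r = 2 * s * m.+1%:R -> is_bessel_kernel r G ->
  (forall a b : alg A, bessel_potential F psi G a ->
    bessel_potential F psi G b -> bessel_potential F psi G (a * b)) ->
  norm_controlled_inversion (bessel_potential F psi G) (bessel_norm F psi G).
Proof.
move=> rsm hG hP; have [M M0 HM] := pn_le_an.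
have PE x : bessel_potential F psi G x <-> exists y, is_pot m.+1 x y.
  by split=> -[y H]; exists y; apply/(is_convE _ _ rsm hG).
have ctrl (p : R * R) : exists H, 0 <= H /\ forall a : alg A, bessel_potential F psi G a ->
    a \is a GRing.unit -> bessel_norm F psi G a <= p.1 -> nrm (a^-1 : A) <= p.2 ->
    bessel_potential F psi G a^-1 /\ bessel_norm F psi G a^-1 <= H.
  have A0 : 0 < M * `|p.1| + 1 by rewrite ltr_wpDl// mulr_ge0// ltW.
  have V0 : 0 < M * `|p.2| + 1 by rewrite ltr_wpDl// mulr_ge0// ltW.
  have [|H H0 HH] := @inverse_pot m _ _ A0 V0.
    by move=> a b /PE Pa /PE Pb; apply/PE; exact: hP.
  exists H; split=> // a Pa ua ap vp; have [ya aya na] := bessel_normP rsm hG Pa.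
  have yaA : pn ya <= M * `|p.1| + 1.
    apply: le_trans (HM ya) _; rewrite -na.
    apply: (@le_trans _ _ (M * `|p.1|)); last by rewrite lerDl.
    by apply: ler_wpM2l; [exact: ltW|exact: le_trans ap (ler_norm _)].
  have xV : pn a^-1 <= M * `|p.2| + 1.
    apply: le_trans (HM a^-1) _; apply: (@le_trans _ _ (M * `|p.2|)); last by rewrite lerDl.
    by apply: ler_wpM2l; [exact: ltW|exact: le_trans vp (ler_norm _)].
  have [y xy yH] := HH a a^-1 ya aya yaA (mulVr ua) (mulrV ua) xV.
  have Pi : bessel_potential F psi G a^-1 by apply/PE; exists y.
  split=> //; have [z xz ->] := bessel_normP rsm hG Pi.
  apply: le_trans (an_le_pn z) _; apply: le_trans (pot_norm xz) _.
  by apply: le_trans yH; case: (fin_pot xy).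
have [h Hh] := choice ctrl; exists (fun u v => h (u, v)); split.
  by move=> u v _ _; case: (Hh (u, v)).
by move=> a Pa ua; have [_ H] := Hh (bessel_norm F psi G a, nrm (a^-1 : A)); exact: H.
Qed.

Lemma bessel_control_cubic r G : r = 2 * s * 1%:R -> is_bessel_kernel r G ->
  (forall a : alg A, bessel_potential F psi G a -> a \is a GRing.unit ->
     bessel_potential F psi G a^-1) ->
  exists C : R, 0 < C /\
    forall a : alg A, bessel_potential F psi G a -> a \is a GRing.unit ->
      bessel_norm F psi G a^-1 <= C * nrm (a^-1 : A) ^+ 3 * bessel_norm F psi G a ^+ 2.
Proof.
move=> rsm hG hinv; have [M M0 HM] := pn_le_an; have [K K0 HK] := bnd_inverse.
exists ((K + 1) * M ^+ 3 * M ^+ 2); split.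
  by rewrite !mulr_gt0 ?exprn_gt0// ltr_wpDl.
move=> a Pa ua; have Pi := hinv a Pa ua.
have [ya aya ->] := bessel_normP rsm hG Pa; have [z xz ->] := bessel_normP rsm hG Pi.
have [fa sa] := fin_pot aya.
apply: le_trans (an_le_pn z) _; apply: le_trans (pot_norm xz) _.
apply: le_trans (sn_le (HK a a^-1 fa (mulVr ua) (mulrV ua))) _.
have -> : (K + 1) * M ^+ 3 * M ^+ 2 * nrm (a^-1 : A) ^+ 3 * an ya ^+ 2 =
  (K + 1) * (M * nrm (a^-1 : A)) ^+ 3 * (M * an ya) ^+ 2 by ring.
have p0 := pn_ge0 a^-1; have S0 := sn_ge0 fa.
apply: ler_pM; [by rewrite mulr_ge0// exprn_ge0|exact: sqr_ge0| |].
  apply: ler_pM; [by []|by rewrite exprn_ge0|by rewrite lerDl|].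
  by rewrite lerXn2r ?nnegrE ?(le_trans p0 (HM _))//; exact: HM.
have h := le_trans sa (HM ya).
by rewrite lerXn2r ?nnegrE ?(le_trans S0 h).
Qed.

End group_action.

(* hP: norm-controlled inversion is a notion for Banach algebras; that P_r(A) is
   closed under products does not follow from hpsi. *)
Theorem theorem2p12 (R : realType) (A : banachAlgType R[i])
  (F : set (A -> R[i]^o)) (psi : R -> {lrmorphism alg A -> alg A})
  (hpsi : Cw_group F psi) (r : R) (hr : 0 < r)
  (G : R -> R[i]) (hG : is_bessel_kernel r G)
  (hP : forall a b : alg A, bessel_potential F psi G a ->
    bessel_potential F psi G b -> bessel_potential F psi G (a * b)) :
  norm_controlled_inversion
    (bessel_potential F psi G) (bessel_norm F psi G) /\
  (r < 1 ->
   exists C : R, 0 < C /\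
     forall a : alg A, bessel_potential F psi G a -> a \is a GRing.unit ->
       bessel_norm F psi G a^-1 <=
         C * nrm a^-1 ^+ 3 * bessel_norm F psi G a ^+ 2).
Proof.
have nci : norm_controlled_inversion (bessel_potential F psi G) (bessel_norm F psi G).
  pose m := Num.truncn r; pose s := r / (2 * m.+1%:R).
  have m0 : 0 < 2 * m.+1%:R :> R by rewrite mulr_gt0.
  have rm : r < m.+1%:R by exact: truncnS_gt.
  have s12 : 0 < s < 2^-1.
    by rewrite divr_gt0//= ltr_pdivrMr// mulrA mulVf// mul1r.
  apply: (bessel_control hpsi s12 _ hG hP (m := m)).
  by rewrite /s; field; rewrite gt_eqF.
split=> // r1; have s12 : 0 < r / 2 < 2^-1 by apply/andP; split; lra.
apply: (bessel_control_cubic hpsi s12 _ hG); first by field.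
by case: nci => h [_ H] a Pa ua; case: (H a Pa ua).
Qed.
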